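(* Let $T^*$ be the model completion of the (continuous first order) theory of Banach spaces. Then the models of $T^*$ are exactly the Gurarij spaces. In particular, since $T^*$ is $\aleph_0$-categorical, there exists a unique separable Gurarij space (up to isometric isomorphism).
   Context: All Banach spaces are real. Banach spaces are viewed either as metric structures in unbounded continuous logic, or as bounded metric structures in continuous first order logic via their closed unit balls (with the vector-space operations restricted to the ball, such as $0$, $x \mapsto -x$, $(x,y) \mapsto \frac{x+y}{2}$, and the norm as a predicate/distance). The theory of the class of Banach spaces is inductive and admits a model completion $T^*$, which is complete and $\aleph_0$-categorical. Here a model completion of an inductive theory $T$ is a companion $T^*$ of $T$ (every model of either theory embeds in a model of the other) that eliminates quantifiers. A Gurarij space is a Banach space $G$ such that for any $\varepsilon > 0$, finite-dimensional Banach spaces $E \subseteq F$ and linear isometric embedding $\varphi \colon E \to G$, there is a linear map $\psi \colon F \to G$ extending $\varphi$ with $(1-\varepsilon)\|x\| \leq \|\psi x\| \leq (1+\varepsilon)\|x\|$ for all $x \in F$. *)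

(* Defs.v *)
From HB Require Import structures.
From mathcomp Require Import all_boot all_order all_algebra.
From mathcomp Require Import all_classical all_reals all_analysis.

Set Implicit Arguments.
Unset Strict Implicit.
Unset Printing Implicit Defensive.

Import Order.TTheory GRing.Theory Num.Theory.
Import numFieldNormedType.Exports.

Local Open Scope classical_set_scope.
Local Open Scope ring_scope.

(** Conventions of bounded continuous logic: distances are bounded by 1 and
    predicates take values in [0, 1], with 0 standing for "true".  On the unit
    ball of a Banach space the distance symbol is therefore interpreted by
    `|x - y| / 2.  The function symbols are 0, x |-> - x, (x, y) |-> (x + y) / 2,
    and x |-> a x for each real a with `|a| <= 1 (these are limits of terms in
    the other symbols, so they add no expressive power); the only predicate
    symbol besides the distance is the norm. *)

Definition scalar (R : realType) := {a : R | `|a| <= 1}.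

#[short(type="completeMetricType")]
HB.structure Definition CompleteMetric (K : numDomainType) :=
  {T of Metric K T & Complete T}.

(** The inequalities [*_lip] are the moduli of uniform continuity that the
    language attaches to its symbols. *)
Record ball_structure (R : realType) := BallStructure {
  carrier :> completeMetricType R;
  s_zero : carrier;
  s_opp : carrier -> carrier;
  s_mid : carrier -> carrier -> carrier;
  s_scale : scalar R -> carrier -> carrier;
  s_norm : carrier -> R;
  s_dist_le1 : forall x y : carrier, mdist x y <= 1;
  s_norm_itv : forall x, 0 <= s_norm x <= 1;
  s_opp_lip : forall x y, mdist (s_opp x) (s_opp y) <= mdist x y;
  s_mid_lip : forall x x' y y',
    mdist (s_mid x y) (s_mid x' y') <= (mdist x x' + mdist y y') / 2;
  s_scale_lip : forall a x y, mdist (s_scale a x) (s_scale a y) <= mdist x y;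
  s_norm_lip : forall x y, `|s_norm x - s_norm y| <= 2 * mdist x y }.

Arguments s_zero {R}.
Arguments s_opp {R}.
Arguments s_mid {R}.
Arguments s_scale {R}.
Arguments s_norm {R}.

Inductive term (R : realType) (n : nat) : Type :=
| TVar of 'I_n
| TZero
| TOpp of term R n
| TMid of term R n & term R n
| TScale of scalar R & term R n.

Arguments TZero {R n}.

Definition unit_cube (R : realType) (k : nat) : set 'rV[R]_k :=
  [set v | forall i, 0 <= v ord0 i <= 1].
Arguments unit_cube : clear implicits.

Record connective (R : realType) (k : nat) := Connective {
  conn_fun :> 'rV[R]_k -> R;
  conn_continuous : {within unit_cube R k, continuous conn_fun};
  conn_itv : forall v, unit_cube R k v -> 0 <= conn_fun v <= 1 }.

(** [formula R n] is the type of formulas with free variables among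
    x_0, ..., x_(n-1).  The quantifiers [FSup] and [FInf] bind x_0 and shift the
    remaining variables. *)
Inductive formula (R : realType) : nat -> Type :=
| FNorm n of term R n : formula R n
| FDist n of term R n & term R n : formula R n
| FConn n k of connective R k & ('I_k -> formula R n) : formula R n
| FSup n of formula R n.+1 : formula R n
| FInf n of formula R n.+1 : formula R n.

Definition env_cons (A : Type) (n : nat) (x : A) (v : 'I_n -> A) (i : 'I_n.+1) :
  A := if unlift ord0 i is Some j then v j else x.

Fixpoint term_eval (R : realType) (M : ball_structure R) (n : nat)
    (v : 'I_n -> M) (t : term R n) : M :=
  match t with
  | TVar i => v i
  | TZero => s_zero M
  | TOpp t1 => s_opp M (term_eval v t1)
  | TMid t1 t2 => s_mid M (term_eval v t1) (term_eval v t2)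
  | TScale a t1 => s_scale M a (term_eval v t1)
  end.

Fixpoint eval (R : realType) (M : ball_structure R) (n : nat)
    (phi : formula R n) : ('I_n -> M) -> R :=
  match phi in formula _ n0 return ('I_n0 -> M) -> R with
  | FNorm _ t => fun v => s_norm M (term_eval v t)
  | FDist _ t1 t2 => fun v => mdist (term_eval v t1) (term_eval v t2)
  | FConn _ k u args => fun v => u (\row_(i < k) eval (args i) v)
  | FSup _ psi => fun v => sup (range (fun x => eval psi (env_cons x v)))
  | FInf _ psi => fun v => inf (range (fun x => eval psi (env_cons x v)))
  end.

Fixpoint quantifier_free (R : realType) (n : nat) (phi : formula R n) : Prop :=
  match phi with
  | FNorm _ _ | FDist _ _ _ => True
  | FConn _ _ _ args => forall i, quantifier_free (args i)
  | FSup _ _ | FInf _ _ => False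
  end.

(** A sentence has no free variable, so the environment is irrelevant. *)
Definition sentence_eval (R : realType) (M : ball_structure R)
  (phi : formula R 0) : R := eval phi (fun _ : 'I_0 => s_zero M).

(** A theory is a set of sentences, [phi] standing for the condition
    "phi = 0". *)
Definition theory (R : realType) := set (formula R 0).
Arguments theory : clear implicits.

Definition models (R : realType) (M : ball_structure R) (T : theory R) : Prop :=
  forall phi, T phi -> sentence_eval M phi = 0.

Record is_embedding (R : realType) (M N : ball_structure R) (h : M -> N) :
    Prop := IsEmbedding {
  emb_dist : forall x y, mdist (h x) (h y) = mdist x y;
  emb_zero : h (s_zero M) = s_zero N;
  emb_opp : forall x, h (s_opp M x) = s_opp N (h x);
  emb_mid : forall x y, h (s_mid M x y) = s_mid N (h x) (h y);
  emb_scale : forall a x, h (s_scale M a x) = s_scale N a (h x);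
  emb_norm : forall x, s_norm N (h x) = s_norm M x }.

Definition embeds (R : realType) (M N : ball_structure R) : Prop :=
  exists h : M -> N, is_embedding h.

Definition isomorphic (R : realType) (M N : ball_structure R) : Prop :=
  exists2 h : M -> N, is_embedding h & bijective h.

Definition companion (R : realType) (T T' : theory R) : Prop :=
  (forall M : ball_structure R, models M T ->
     exists2 N : ball_structure R, models N T' & embeds M N) /\
  (forall M : ball_structure R, models M T' ->
     exists2 N : ball_structure R, models N T & embeds M N).

(** In continuous logic, quantifier elimination means that every formula is,
    modulo the theory, a uniform limit of quantifier-free formulas in the same
    variables. *)
Definition eliminates_quantifiers (R : realType) (T : theory R) : Prop :=
  forall (n : nat) (phi : formula R n) (e : R), 0 < e ->
  exists2 psi : formula R n, quantifier_free psi &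
    forall M : ball_structure R, models M T ->
    forall v : 'I_n -> M, `|eval phi v - eval psi v| <= e.

Definition model_completion (R : realType) (T Tstar : theory R) : Prop :=
  companion T Tstar /\ eliminates_quantifiers Tstar.

Definition unit_ball (R : realType) (X : completeNormedModType R) : Type :=
  {x : X | `|x| <= 1}.

Section UnitBall.
Variables (R : realType) (X : completeNormedModType R).
Local Notation B := (unit_ball X).

HB.instance Definition _ := Choice.copy B {x : X | `|x| <= 1}.

Lemma ub_zero_subproof : `|0 : X| <= 1.
Proof. by rewrite normr0. Qed.
Definition ub_zero : B := exist _ (0 : X) ub_zero_subproof.
HB.instance Definition _ := isPointed.Build B ub_zero.

Definition ub_dist (x y : B) : R := `|val x - val y| / 2.

Lemma ub_distxx x : ub_dist x x = 0.
Proof. by rewrite /ub_dist subrr normr0 mul0r. Qed.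

Lemma ub_dist_positivity x y : ub_dist x y = 0 -> x = y.
Proof.
move/eqP; rewrite mulf_eq0 invr_eq0 pnatr_eq0 orbF normr_eq0 subr_eq0 => /eqP.
exact: val_inj.
Qed.

Lemma ub_dist_sym x y : ub_dist x y = ub_dist y x.
Proof. by rewrite /ub_dist distrC. Qed.

Lemma ub_dist_triangle y x z : ub_dist x z <= ub_dist x y + ub_dist y z.
Proof. by rewrite /ub_dist -mulrDl ler_pM2r ?invr_gt0// ler_distD. Qed.

HB.instance Definition _ := isMetric.Build R B
  ub_distxx ub_dist_positivity ub_dist_sym ub_dist_triangle.

Lemma ub_ballE (x : B) (e : R) (y : B) :
  ball x e y <-> `|val x - val y| / 2 < e.
Proof. by rewrite ballEmdist. Qed.

Lemma ub_complete (F : set_system B) : ProperFilter F -> cauchy F -> cvg F.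
Proof.
move=> FF /cauchy_ballP Fc.
pose G : set_system X := (val : B -> X) @ F.
have GF : ProperFilter G by exact: fmap_proper_filter.
have Gc : cauchy G.
  apply/cauchy_exP => e e0.
  have e20 : 0 < e / 2 by rewrite divr_gt0.
  have [x Fx] : exists x : B, F (ball x (e / 2)).
    by move: (e / 2) e20; apply/cauchyP/cauchy_ballP.
  exists (val x); suff : F [set y : B | ball (val x) e (val y)] by [].
  apply: filterS Fx => y /ub_ballE.
  by rewrite -ball_normE /= ltr_pM2r ?invr_gt0.
have [l Gl] : exists l : X, G --> l by apply/cvg_ex; exact: cauchy_cvg.
have l1 : `|l| <= 1.
  apply/ler_addgt0Pl => e e0.
  have : F [set y | ball l e (val y)] by apply: Gl; exact: nbhsx_ballx.
  move=> /filter_ex[z /=]; rewrite -ball_normE /= => lz.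
  rewrite -(subrK (val z) l) (le_trans (ler_normD _ _))//.
  by rewrite lerD ?(ltW lz)//; exact: (valP z).
apply/cvg_ex; exists (exist _ l l1 : B) => A.
rewrite -nbhs_ballE => -[e /= e0 eA].
have : F [set y | ball l (e * 2) (val y)].
  by apply: Gl; apply: nbhsx_ballx; rewrite mulr_gt0.
apply: filterS => y; rewrite -ball_normE /= => ly.
by apply: eA; apply/ub_ballE; rewrite ltr_pdivrMr.
Qed.

HB.instance Definition _ := Uniform_isComplete.Build B ub_complete.

Lemma ub_opp_subproof (x : B) : `|- val x| <= 1.
Proof. by rewrite normrN; exact: (valP x). Qed.
Definition ub_opp (x : B) : B := exist _ (- val x) (ub_opp_subproof x).

Lemma ub_mid_subproof (x y : B) : `|2^-1 *: (val x + val y)| <= 1.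
Proof.
rewrite normrZ gtr0_norm ?invr_gt0// ler_pdivrMl// mulr1.
apply: (le_trans (ler_normD _ _)); rewrite -[leRHS]/(1 + 1).
by apply: lerD; [exact: (valP x)|exact: (valP y)].
Qed.
Definition ub_mid (x y : B) : B :=
  exist _ (2^-1 *: (val x + val y)) (ub_mid_subproof x y).

Lemma ub_scale_subproof (a : scalar R) (x : B) : `|val a *: val x| <= 1.
Proof. by rewrite normrZ mulr_ile1//; [exact: (valP a)|exact: (valP x)]. Qed.
Definition ub_scale (a : scalar R) (x : B) : B :=
  exist _ (val a *: val x) (ub_scale_subproof a x).

Definition ub_norm (x : B) : R := `|val x|.

Lemma ub_dist_le1 (x y : B) : mdist x y <= 1.
Proof.
rewrite -[mdist _ _]/(ub_dist x y) /ub_dist ler_pdivrMr// mul1r.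
apply: (le_trans (ler_normB _ _)); rewrite -[leRHS]/(1 + 1).
by apply: lerD; [exact: (valP x)|exact: (valP y)].
Qed.

Lemma ub_norm_itv (x : B) : 0 <= ub_norm x <= 1.
Proof. by rewrite normr_ge0; exact: (valP x). Qed.

Lemma ub_opp_lip (x y : B) : mdist (ub_opp x) (ub_opp y) <= mdist x y.
Proof.
rewrite -[mdist x y]/(ub_dist x y) -[mdist _ _]/(ub_dist _ _) /ub_dist /=.
by rewrite -opprD normrN.
Qed.

Lemma ub_mid_lip (x x' y y' : B) :
  mdist (ub_mid x y) (ub_mid x' y') <= (mdist x x' + mdist y y') / 2.
Proof.
rewrite -[mdist x x']/(ub_dist _ _) -[mdist y y']/(ub_dist _ _).
rewrite -[mdist _ _]/(ub_dist _ _) /ub_dist /=.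
rewrite -scalerBr normrZ gtr0_norm ?invr_gt0// opprD addrACA -mulrDl.
by rewrite ler_pM2r ?invr_gt0// mulrC ler_pM2r ?invr_gt0// ler_normD.
Qed.

Lemma ub_scale_lip (a : scalar R) (x y : B) :
  mdist (ub_scale a x) (ub_scale a y) <= mdist x y.
Proof.
rewrite -[mdist x y]/(ub_dist x y) -[mdist _ _]/(ub_dist _ _) /ub_dist /=.
rewrite -scalerBr normrZ ler_pM2r ?invr_gt0//.
by rewrite ler_piMl//; exact: (valP a).
Qed.

Lemma ub_norm_lip (x y : B) : `|ub_norm x - ub_norm y| <= 2 * mdist x y.
Proof.
rewrite -[mdist x y]/(ub_dist x y) /ub_dist mulrC divfK ?pnatr_eq0//.
exact: ler_dist_dist.
Qed.

Definition ball_of : ball_structure R :=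
  @BallStructure R B ub_zero ub_opp ub_mid ub_scale ub_norm
    ub_dist_le1 ub_norm_itv ub_opp_lip ub_mid_lip ub_scale_lip ub_norm_lip.

End UnitBall.

Definition banach_theory (R : realType) : theory R :=
  [set phi | forall X : completeNormedModType R,
     sentence_eval (ball_of X) phi = 0].
Arguments banach_theory : clear implicits.

Definition finite_dimensional (R : realType) (V : lmodType R) : Prop :=
  exists (n : nat) (b : 'I_n -> V),
    forall x, exists c : 'I_n -> R, x = \sum_(i < n) c i *: b i.

Definition isometric (R : realType) (V W : normedModType R) (f : V -> W) :
  Prop := forall x, `|f x| = `|x|.

(** An inclusion of [E] in [F] is given as a linear isometric map [iota]. *)
Definition gurarij (R : realType) (G : completeNormedModType R) : Prop :=
  forall (e : R) (E F : completeNormedModType R)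
         (iota : {linear E -> F}) (phi : {linear E -> G}),
  0 < e -> finite_dimensional E -> finite_dimensional F ->
  isometric iota -> isometric phi ->
  exists psi : {linear F -> G},
    (forall x, psi (iota x) = phi x) /\
    (forall x, (1 - e) * `|x| <= `|psi x| <= (1 + e) * `|x|).

Definition separable (X : topologicalType) : Prop :=
  exists2 A : set X, countable A & dense A.

Definition isometrically_isomorphic (R : realType) (V W : normedModType R) :
  Prop := exists2 f : {linear V -> W}, isometric f & bijective f.

(* Main.v *)
Require Import Defs.
From HB Require Import structures.
From mathcomp Require Import all_boot all_order all_algebra.
From mathcomp Require Import all_classical all_reals all_analysis.
From mathcomp Require Import ring lra zify.
Import Defs.

Set Implicit Arguments.
Unset Strict Implicit.
Unset Printing Implicit Defensive.

Import Order.TTheory GRing.Theory Num.Theory.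
Import numFieldNormedType.Exports.

Local Open Scope classical_set_scope.
Local Open Scope ring_scope.

(** The geometric form of the theorem is a property of single vectors,
    [one_point]: whenever a Banach space Z contains G, every z in Z can be copied
    by some y in G in such a way that the norms of the combinations of y with
    finitely many given vectors of G are, up to a small error, those of the same
    combinations of z. This property implies that G is a Gurarij space
    ([one_point_gurarij]): to extend an isometry from E to F, send the vectors of a
    basis of F to G one at a time. After the first step the map is only almost
    isometric; F and G are then glued in an amalgam where corresponding vectors
    are close to each other ([amalgamation]), and the property applies again.
    Conversely, a Gurarij space copies whole finite families of Z, fixing those
    members that lie in G ([gurarij_realize]).

    Let T be a model completion. By quantifier elimination embeddings between
    models of T are elementary. If M is a model, included in a structure N that
    itself embeds in a model, then what exists in N over parameters of M already
    exists approximately in M ([sandwich]). A model M satisfies the universal theory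
    of unit balls, which suffices to embed it in the ball of a Banach space X built
    from the formal multiples 2^k m ([embed_in_ball]). For N the ball of X this gives
    that M is all of this ball, and for N the ball of a space Z containing X it
    gives [one_point]. So models are unit balls of Gurarij spaces
    ([model_gurarij]). Conversely the ball of a Gurarij space G embeds in a model,
    the ball of some X. Formulas being nearly quantifier-free there, they depend
    only on norms of combinations, so that copying vectors of X in G is the
    Tarski-Vaught test for this embedding ([gurarij_model]).

    Two separable Gurarij spaces are isometric by a back-and-forth in which each
    step moves the earlier vectors a little in order to make the correspondence
    more nearly isometric ([gurarij_unique]). A separable Gurarij space is the
    completion of the space of polynomials for a seminorm defined by successive
    extensions: the extension to X^k follows, if possible, the k-th item of a
    countable list of approximate descriptions of one-point extensions, and a
    description is followed whenever some Banach space realizes it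
    ([separable_gurarij_exists]). *)

(** * Linear identities in modules *)

Section LinearExpressions.
Variables (R : realType) (V : lmodType R).

Inductive lexp := LVar of nat | LZero | LAdd of lexp & lexp | LOpp of lexp
  | LScale of R & lexp.

Fixpoint leval (env : seq V) e : V :=
  match e with
  | LVar i => nth 0 env i
  | LZero => 0
  | LAdd e1 e2 => leval env e1 + leval env e2
  | LOpp e1 => - leval env e1
  | LScale a e1 => a *: leval env e1
  end.

Fixpoint lcoef e (i : nat) : R :=
  match e with
  | LVar j => if Nat.eqb i j then 1 else 0
  | LZero => 0
  | LAdd e1 e2 => lcoef e1 i + lcoef e2 i
  | LOpp e1 => - lcoef e1 i
  | LScale a e1 => a * lcoef e1 i
  end.

Lemma leval_coef env e :
  leval env e = \sum_(i < size env) lcoef e i *: nth 0 env i.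
Proof.
elim: e => [j||e1 I1 e2 I2|e1 I1|a e1 I1] /=.
- have eqbE (i k : nat) : Nat.eqb i k = (i == k) by elim: i k => [|i IH] [|k] //=.
  have [lt|ge] := ltnP j (size env).
    rewrite (bigD1 (Ordinal lt))//= eqbE eqxx scale1r big1 ?addr0// => i.
    by rewrite eqbE -val_eqE /= => /negbTE ->; rewrite scale0r.
  rewrite nth_default// big1// => i _; rewrite eqbE.
  by rewrite (ltn_eqF (leq_trans (ltn_ord i) ge)) scale0r.
- by rewrite big1// => i _; rewrite scale0r.
- by rewrite I1 I2 -big_split; apply: eq_bigr => i _; rewrite scalerDl.
- by rewrite I1 -sumrN; apply: eq_bigr => i _; rewrite scaleNr.
- by rewrite I1 scaler_sumr; apply: eq_bigr => i _; rewrite scalerA.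
Qed.

Fixpoint same_coefs n e1 e2 : Prop :=
  if n is m.+1 then lcoef e1 m = lcoef e2 m /\ same_coefs m e1 e2 else True.

Lemma leval_eq env e1 e2 :
  same_coefs (size env) e1 e2 -> leval env e1 = leval env e2.
Proof.
move=> h; rewrite !leval_coef; apply: eq_bigr => i _; congr (_ *: _).
have : (i < size env)%N by [].
elim: (size env) (i : nat) h => // n IH j /= [hn h]; rewrite ltnS leq_eqVlt.
by move=> /orP[/eqP ->//|]; exact: IH.
Qed.

End LinearExpressions.

Ltac lmod_index x l :=
  lazymatch l with
  | x :: _ => constr:(0%N)
  | _ :: ?t => let n := lmod_index x t in constr:(S n)
  end.

Ltac lmod_atoms l t :=
  lazymatch t with
  | GRing.add ?a ?b => let l1 := lmod_atoms l a in lmod_atoms l1 b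
  | GRing.opp ?a => lmod_atoms l a
  | GRing.scale _ ?a => lmod_atoms l a
  | GRing.zero => l
  | ?x => match l with
          | _ => let n := lmod_index x l in l
          | _ => constr:(x :: l)
          end
  end.

Ltac lmod_reify R l t :=
  lazymatch t with
  | GRing.add ?a ?b =>
    let e1 := lmod_reify R l a in let e2 := lmod_reify R l b in
    constr:(@LAdd R e1 e2)
  | GRing.opp ?a => let e := lmod_reify R l a in constr:(@LOpp R e)
  | GRing.scale ?c ?a => let e := lmod_reify R l a in constr:(@LScale R c e)
  | GRing.zero => constr:(@LZero R)
  | ?x => let n := lmod_index x l in constr:(@LVar R n)
  end.

(** [lmod_over R V] proves an equality of linear expressions of [V]: both sides
    are reified over their common atoms, and it remains one scalar identity per
    atom. *)
Ltac lmod_over R V :=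
  lazymatch goal with
  | |- ?a = ?b =>
    let l0 := lmod_atoms (@nil V) a in
    let l := lmod_atoms l0 b in
    let e1 := lmod_reify R l a in
    let e2 := lmod_reify R l b in
    apply: (@leval_eq R V l e1 e2);
    cbv [same_coefs size lcoef Nat.eqb];
    repeat (apply: conj; first by (ring || field)); exact: I
  end.

Lemma norm_eq_le (R : realType) (X : normedModType R) (x y : X) :
  x = y -> `|x| <= `|y|.
Proof. by move=> ->. Qed.

(** * Completion of a space whose laws hold up to distance zero *)

(** The laws of vector spaces are only required up to distance 0, so that formal
    expressions can be completed directly, without a quotient. *)
Record prenormed (R : realType) := Prenormed {
  pt :> Type;
  p0 : pt;
  padd : pt -> pt -> pt;
  pscale : R -> pt -> pt;
  pd : pt -> pt -> R;
  pdxx : forall x, pd x x = 0;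
  pdC : forall x y, pd x y = pd y x;
  pdT : forall y x z, pd x z <= pd x y + pd y z;
  pd_add : forall x x' y y',
    pd (padd x y) (padd x' y') <= pd x x' + pd y y';
  pd_scale : forall a x y, pd (pscale a x) (pscale a y) <= `|a| * pd x y;
  paddA : forall x y z, pd (padd x (padd y z)) (padd (padd x y) z) = 0;
  paddC : forall x y, pd (padd x y) (padd y x) = 0;
  padd0 : forall x, pd (padd p0 x) x = 0;
  paddN : forall x, pd (padd (pscale (-1) x) x) p0 = 0;
  pscaleA : forall a b x, pd (pscale a (pscale b x)) (pscale (a * b) x) = 0;
  pscale1 : forall x, pd (pscale 1 x) x = 0;
  pscaleDr : forall a x y,
    pd (pscale a (padd x y)) (padd (pscale a x) (pscale a y)) = 0;
  pscaleDl : forall a b x,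
    pd (pscale (a + b) x) (padd (pscale a x) (pscale b x)) = 0 }.

Lemma mul_div1_le (R : realType) (k e : R) : 0 <= k -> 0 < e ->
  k * (e / (k + 1)) <= e.
Proof.
move=> k0 e0; rewrite mulrA ler_pdivrMr ?ltr_wpDl// mulrC.
by rewrite ler_wpM2l ?(ltW e0)// lerDl.
Qed.

Section Prenormed.
Variables (R : realType) (V : prenormed R).
Implicit Types x y z : V.

Lemma pd_ge0 x y : 0 <= pd x y.
Proof. by have := pdT y x x; rewrite pdxx (pdC y x); lra. Qed.

Lemma pd_eql x x' y : pd x x' = 0 -> pd x y = pd x' y.
Proof.
move=> h; have := pdT x' x y; have := pdT x x' y.
by rewrite (pdC x' x) h => ? ?; apply/eqP; rewrite eq_le; apply/andP; split; lra.
Qed.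

Lemma pd_eqr x y y' : pd y y' = 0 -> pd x y = pd x y'.
Proof. by rewrite !(pdC x); exact: pd_eql. Qed.

Lemma padd_eq x x' y y' : pd x x' = 0 -> pd y y' = 0 ->
  pd (padd x y) (padd x' y') = 0.
Proof.
move=> h h'; apply/eqP; rewrite eq_le pd_ge0 andbT.
by rewrite (le_trans (pd_add _ _ _ _))// h h' addr0.
Qed.

Lemma pscale_eq a x x' : pd x x' = 0 -> pd (pscale a x) (pscale a x') = 0.
Proof.
move=> h; apply/eqP; rewrite eq_le pd_ge0 andbT.
by rewrite (le_trans (pd_scale _ _ _))// h mulr0.
Qed.

Lemma pscale0 a : pd (pscale a (p0 V)) (p0 V) = 0.
Proof.
have h : pd (p0 V) (pscale 0 (p0 V)) = 0.
  rewrite -[X in pscale X](addNr 1) (pd_eqr _ (pscaleDl _ _ _)).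
  rewrite (pd_eqr _ (padd_eq (pdxx _) (pscale1 _))).
  by rewrite (pd_eqr _ (paddN _)) pdxx.
rewrite (pd_eql _ (pscale_eq a h)) (pd_eql _ (pscaleA _ _ _)) mulr0.
by rewrite (pd_eqr _ h) pdxx.
Qed.

Lemma pd_sub u v : pd (padd u (pscale (-1) v)) (p0 V) = pd u v.
Proof.
apply/eqP; rewrite eq_le; apply/andP; split.
  have h := pd_add u v (pscale (-1) v) (pscale (-1) v).
  by move: h; rewrite pdxx addr0 (pd_eqr _ (paddC _ _)) (pd_eqr _ (paddN _)).
have h := pd_add (padd u (pscale (-1) v)) (p0 V) v v.
move: h; rewrite pdxx addr0 (pd_eqr _ (padd0 _)).
rewrite -(pd_eql _ (paddA _ _ _)) (pd_eql _ (padd_eq (pdxx _) (paddN _))).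
by rewrite (pd_eql _ (paddC _ _)) (pd_eql _ (padd0 _)).
Qed.

End Prenormed.

Section Completion.
Variables (R : realType) (V : prenormed R).
Implicit Types (v w : V) (e : R).

Definition approx_pt (g : V -> R) v e := forall w, `|g w - pd v w| <= e.

(** A point x of the completion is encoded by its distance function
    v |-> dist(x, v): points at distance 0 are then equal by extensionality. *)
Definition completion : Type :=
  {g : V -> R | `[< forall e, 0 < e -> exists v, approx_pt g v e >] }.
HB.instance Definition _ := gen_eqMixin completion.
HB.instance Definition _ := gen_choiceMixin completion.

Implicit Types g : completion.

Definition approx g v e := approx_pt (sval g) v e.

Lemma approx_ex g e : 0 < e -> exists v, approx g v e.
Proof. by move: e; apply/asboolP; exact: (svalP g). Qed.

Lemma approx_dist g v v' e e' : approx g v e -> approx g v' e' -> pd v v' <= e + e'.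
Proof.
move=> /(_ v') h1 /(_ v'); rewrite pdxx subr0 => h2.
by move: h1 h2; rewrite !ler_norml => /andP[? ?] /andP[? ?]; lra.
Qed.

Lemma approx_le g v e v' e' : approx g v e -> pd v v' <= e' - e -> approx g v' e'.
Proof.
move=> h l w; have := h w; have h1 := pdT v' v w; have h2 := pdT v v' w.
rewrite (pdC v' v) in h2.
rewrite !ler_norml => /andP[? ?]; apply/andP; split; lra.
Qed.

Lemma approx_ext g g' : (forall e, 0 < e -> exists2 v, approx g v e & approx g' v e) ->
  g = g'.
Proof.
move=> h; apply/val_inj/funext => w /=.
apply/eqP; rewrite -subr_eq0 -normr_eq0 -[_ == 0]/(_ == _) eq_le normr_ge0 andbT.
apply/ler_addgt0Pl => e e0; rewrite addr0.
have [v /(_ w) h1 /(_ w) h2] := h (e / 2) (divr_gt0 e0 (ltr0n _ 2)).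
move: h1 h2; rewrite !ler_norml => /andP[? ?] /andP[? ?]; apply/andP; split; lra.
Qed.

(** [Ap e v] is read as: v approximates the limit within e. Each such v bounds
    the distance of the limit to w by dist(v, w) + e, and consistency makes the
    infimum of these bounds correct within e for all v at once. *)
Lemma approx_limit (Ap : R -> V -> Prop) :
  (forall e, 0 < e -> exists v, Ap e v) ->
  (forall e v e' v', Ap e v -> Ap e' v' -> pd v v' <= e + e') ->
  {g : completion | forall e v, Ap e v -> approx g v e}.
Proof.
move=> ex cp.
pose S w := [set r | exists e v, Ap e v /\ r = pd v w + e].
have S0 w : S w !=set0 by have [v h] := ex 1 ltr01; exists (pd v w + 1), 1, v.
have lb e v w : Ap e v -> lbound (S w) (pd v w - e).
  move=> h _ [e' [v' [h' ->]]]; have := cp _ _ _ _ h h'; have := pdT v' v w; lra.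
pose g w := inf (S w).
have gP e v : Ap e v -> approx_pt g v e.
  move=> h w; rewrite ler_norml; apply/andP; split.
    by have := lb_le_inf (S0 w) (lb _ _ w h); rewrite -/(g w); lra.
  have : g w <= pd v w + e.
    apply: ge_inf; first by exists (pd v w - e); exact: lb.
    by exists e, v.
  lra.
have gB : `[< forall e, 0 < e -> exists v, approx_pt g v e >].
  by apply/asboolP => e /ex[v h]; exists v; exact: gP.
by exists (exist _ g gB).
Qed.

Lemma incl_subproof v :
  {g : completion | forall e v', 0 <= e /\ v' = v -> approx g v' e}.
Proof.
apply: approx_limit => [e /ltW e0|e _ e' _ [e0 ->] [e'0 ->]]; first by exists v.
by rewrite pdxx addr_ge0.
Qed.
Definition incl v : completion := sval (incl_subproof v).
Lemma approx_incl v : approx (incl v) v 0.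
Proof. exact: (svalP (incl_subproof v)). Qed.

Lemma cadd_subproof g g' : {g'' : completion | forall e w,
  (exists v v' a b, [/\ approx g v a, approx g' v' b, w = padd v v' & a + b <= e])
  -> approx g'' w e}.
Proof.
apply: approx_limit => [e e0|].
  have e20 : 0 < e / 2 by rewrite divr_gt0.
  have [v h] := approx_ex g e20; have [v' h'] := approx_ex g' e20.
  exists (padd v v'), v, v', (e / 2), (e / 2); split=> //; lra.
move=> e _ e' _ [v [v' [a [b [h1 h2 -> l]]]]] [w [w' [c [d [h3 h4 -> l']]]]].
have := pd_add v w v' w'; have := approx_dist h1 h3; have := approx_dist h2 h4; lra.
Qed.
Definition cadd g g' := sval (cadd_subproof g g').
Lemma approx_add g g' v v' e e' : approx g v e -> approx g' v' e' ->
  approx (cadd g g') (padd v v') (e + e').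
Proof.
by move=> h h'; apply: (svalP (cadd_subproof g g')); exists v, v', e, e'.
Qed.

Lemma cscale_subproof (a : R) g : {g' : completion | forall e w,
  (exists v b, [/\ approx g v b, w = pscale a v & `|a| * b <= e]) -> approx g' w e}.
Proof.
apply: approx_limit => [e e0|].
  have a1 : 0 < `|a| + 1 by rewrite ltr_wpDl.
  have [v h] := approx_ex g (divr_gt0 e0 a1).
  exists (pscale a v), v, (e / (`|a| + 1)); split=> //.
  exact: mul_div1_le.
move=> e _ e' _ [v [b [h1 -> l]]] [v' [b' [h2 -> l']]].
have := pd_scale a v v'; have := ler_wpM2l (normr_ge0 a) (approx_dist h1 h2).
rewrite mulrDr; lra.
Qed.
Definition cscale a g := sval (cscale_subproof a g).
Lemma approx_scale a g v e : approx g v e -> approx (cscale a g) (pscale a v) (`|a| * e).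
Proof. by move=> h; apply: (svalP (cscale_subproof a g)); exists v, e. Qed.

Definition czero := incl (p0 V).
Definition copp g := cscale (-1) g.

(** Every law of the completion comes from [V] in this way: both sides have
    approximations, built by the same operations, that are at distance 0. *)
Lemma approx_extD g g' (k : R) : 0 <= k ->
  (forall e, 0 < e -> exists v v', [/\ approx g v (k * e), approx g' v' (k * e) &
     pd v v' = 0]) -> g = g'.
Proof.
move=> k0 h; apply: approx_ext => e e0.
have k1 : 0 < k + 1 by rewrite ltr_wpDl.
have [v [v' [h1 h2 d]]] := h (e / (k + 1)) (divr_gt0 e0 k1).
have le := mul_div1_le k0 e0.
exists v'; first by apply: approx_le h1 _; rewrite d subr_ge0.
by apply: approx_le h2 _; rewrite pdxx subr_ge0.
Qed.

Lemma caddA : associative cadd.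
Proof.
move=> x y z; apply: (@approx_extD _ _ 3) => // e e0.
have [u hu] := approx_ex x e0; have [v hv] := approx_ex y e0.
have [w hw] := approx_ex z e0.
exists (padd u (padd v w)), (padd (padd u v) w); split; last exact: paddA.
  have -> : 3 * e = e + (e + e) by ring.
  by do !apply: approx_add.
have -> : 3 * e = e + e + e by ring.
by do !apply: approx_add.
Qed.

Lemma caddC : commutative cadd.
Proof.
move=> x y; apply: (@approx_extD _ _ 2) => // e e0.
have [u hu] := approx_ex x e0; have [v hv] := approx_ex y e0.
exists (padd u v), (padd v u); split; last exact: paddC.
  by rewrite mulr2n mulrDl mul1r; exact: approx_add.
by rewrite mulr2n mulrDl mul1r; exact: approx_add.
Qed.

Lemma cadd0 : left_id czero cadd.
Proof.
move=> x; apply: (@approx_extD _ _ 1) => // e e0.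
have [u hu] := approx_ex x e0.
exists (padd (p0 V) u), u; rewrite mul1r; split=> //; last exact: padd0.
rewrite -[e]add0r; apply: approx_add => //; exact: approx_incl.
Qed.

Lemma caddN : left_inverse czero copp cadd.
Proof.
move=> x; apply: (@approx_extD _ _ 2) => // e e0.
have [u hu] := approx_ex x e0.
exists (padd (pscale (-1) u) u), (p0 V); split=> //; last exact: paddN.
  rewrite mulr2n mulrDl mul1r; apply: approx_add => //.
  by have := approx_scale (-1) hu; rewrite normrN normr1 mul1r.
by apply: approx_le (approx_incl _) _; rewrite pdxx subr0 mulr_ge0// ltW.
Qed.

HB.instance Definition _ := GRing.isZmodule.Build completion caddA caddC cadd0 caddN.

Lemma cscaleA a b x : cscale a (cscale b x) = cscale (a * b) x.
Proof.
apply: (@approx_extD _ _ (`|a| * `|b|)) => [|e e0]; first exact: mulr_ge0.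
have [u hu] := approx_ex x e0.
exists (pscale a (pscale b u)), (pscale (a * b) u).
split; last exact: pscaleA.
  by rewrite -mulrA; do 2!apply: approx_scale.
by rewrite -normrM; exact: approx_scale.
Qed.

Lemma cscale1 : left_id 1 cscale.
Proof.
move=> x; apply: (@approx_extD _ _ 1) => // e e0.
have [u hu] := approx_ex x e0.
exists (pscale 1 u), u; split; last exact: pscale1.
  by have := approx_scale 1 hu; rewrite normr1.
by rewrite mul1r.
Qed.

Lemma cscaleDr : right_distributive cscale +%R.
Proof.
move=> a x y; apply: (@approx_extD _ _ (`|a| * 2)) => [|e e0].
  exact: mulr_ge0.
have [u hu] := approx_ex x e0; have [v hv] := approx_ex y e0.
exists (pscale a (padd u v)), (padd (pscale a u) (pscale a v)).
split; last exact: pscaleDr.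
  rewrite -mulrA; apply: approx_scale; rewrite mulr2n mulrDl mul1r.
  exact: approx_add.
rewrite -mulrA mulr2n mulrDl mul1r mulrDr.
by apply: approx_add; apply: approx_scale.
Qed.

Lemma cscaleDl x : {morph cscale^~ x : a b / a + b}.
Proof.
move=> a b; apply: (@approx_extD _ _ (`|a| + `|b|)) => [|e e0].
  exact: addr_ge0.
have [u hu] := approx_ex x e0.
exists (pscale (a + b) u), (padd (pscale a u) (pscale b u)).
split; last exact: pscaleDl.
  apply: approx_le (approx_scale (a + b) hu) _; rewrite pdxx -mulrBl mulr_ge0 ?(ltW e0)//.
  by rewrite subr_ge0 ler_normD.
by rewrite mulrDl; apply: approx_add; apply: approx_scale.
Qed.

HB.instance Definition _ := GRing.Zmodule_isLmodule.Build R completion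
  cscaleA cscale1 cscaleDr cscaleDl.

(** The norm is the distance to the origin, a value of the encoding function. *)
Definition cnorm g : R := sval g (p0 V).

Lemma approx_norm g v e : approx g v e -> `|cnorm g - pd v (p0 V)| <= e.
Proof. exact. Qed.

Lemma cnorm_add g g' : cnorm (g + g') <= cnorm g + cnorm g'.
Proof.
apply/ler_addgt0Pl => e e0; have e4 : 0 < e / 4 by rewrite divr_gt0.
have [u hu] := approx_ex g e4; have [v hv] := approx_ex g' e4.
have := approx_norm hu; have := approx_norm hv.
have := approx_norm (approx_add hu hv); rewrite -[cadd _ _]/(g + g').
have := pd_add u (p0 V) v (p0 V); have := pdT (padd (p0 V) (p0 V)) (padd u v) (p0 V).
rewrite padd0 !ler_norml => ? ? /andP[? ?] /andP[? ?] /andP[? ?]; lra.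
Qed.

Lemma cnorm_scale_le a g : cnorm (a *: g) <= `|a| * cnorm g.
Proof.
apply/ler_addgt0Pl => e e0.
have a1 : 0 < `|a| + 1 by rewrite ltr_wpDl.
have e2 : 0 < e / 2 by rewrite divr_gt0.
have [u hu] := approx_ex g (divr_gt0 e2 a1).
have := approx_norm hu; have := approx_norm (approx_scale a hu).
rewrite -[cscale _ _]/(a *: g).
have h1 := pd_scale a u (p0 V); rewrite (pd_eqr _ (pscale0 _ _)) in h1.
have l := mul_div1_le (normr_ge0 a) e2.
set c := e / 2 / _ in l *.
set b := `|a| * c in l *.
move=> h3 h4.
have h5 : `|a| * pd u (p0 V) <= `|a| * (cnorm g) + b.
  by rewrite /b -mulrDr ler_wpM2l//; move: h4; rewrite ler_norml => /andP[? ?]; lra.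
move: h3; rewrite ler_norml => /andP[? ?]; lra.
Qed.

Lemma cnorm_ge0 g : 0 <= cnorm g.
Proof.
have := cnorm_add g (- g); have := cnorm_scale_le (-1) g.
rewrite scaleN1r subrr normrN normr1 mul1r.
have : 0 <= cnorm 0.
  have := approx_norm (approx_incl (p0 V)); rewrite pdxx subr0 normr_le0 => /eqP h.
  by rewrite -[X in cnorm X]/(incl (p0 V)) h.
lra.
Qed.

Lemma cnorm_scale a g : cnorm (a *: g) = `|a| * cnorm g.
Proof.
have [->|a0] := eqVneq a 0.
  apply/eqP; rewrite eq_le cnorm_scale_le normr0 mul0r; exact: cnorm_ge0.
apply/eqP; rewrite eq_le cnorm_scale_le/=.
have := cnorm_scale_le a^-1 (a *: g); rewrite scalerA mulVf// scale1r normfV.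
by rewrite ler_pdivlMl ?normr_gt0.
Qed.

Lemma cnorm_approx g g' v e e' : approx g v e -> approx g' v e' ->
  cnorm (g - g') <= e + e'.
Proof.
move=> h /(approx_scale (-1)); rewrite normrN normr1 mul1r.
rewrite -[cscale _ _]/(_ *: g') scaleN1r => h'; have := approx_norm (approx_add h h').
rewrite -[cadd _ _]/(g - g') (pd_eql _ (paddC _ _)) (pd_eql _ (paddN _)).
by rewrite pdxx subr0 => /(le_trans (ler_norm _)).
Qed.

(** If u approximates g' - g, then u + v approximates g' and dist(u + v, v) is
    about the norm of g' - g. *)
Lemma approx_cnorm g g' v e : approx g v e -> approx g' v (e + cnorm (g - g')).
Proof.
move=> h w; apply/ler_addgt0Pl => d d0.
have d4 : 0 < d / 4 by rewrite divr_gt0.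
have [u hu] := approx_ex (g' - g) d4.
have := approx_add hu h; rewrite -[cadd _ _]/(g' - g + g) subrK => /(_ w).
have := approx_norm hu; 
rewrite -[X in cnorm X]opprB -[X in cnorm X]scaleN1r cnorm_scale normrN normr1 mul1r.
have := pd_add u (p0 V) v v; rewrite pdxx => h1.
have h2 := padd0 v.
have h3 := pdT (padd (p0 V) v) (padd u v) v.
have h4 := pdT v (padd u v) w.
have h5 := pdT (padd u v) v w; rewrite (pdC v (padd u v)) in h5.
rewrite !ler_norml => /andP[? ?] /andP[? ?]; apply/andP; split; lra.
Qed.

Lemma cnorm_eq0 g : cnorm g = 0 -> g = 0.
Proof.
move=> g0; apply: approx_ext => e e0; have [v h] := approx_ex g e0.
by exists v => //; have := approx_cnorm 0 h; rewrite subr0 g0 addr0.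
Qed.

HB.instance Definition _ := Lmodule_isNormed.Build R completion
  cnorm_add cnorm_scale cnorm_eq0.

Lemma completion_complete (F : set_system completion) :
  ProperFilter F -> cauchy F -> cvg F.
Proof.
move=> FF /cauchy_ballP Fc.
have [|e v e' v' h h'|l lP] := @approx_limit (fun e v => F [set g | approx g v e]).
- move=> e e0; have e20 : 0 < e / 2 by rewrite divr_gt0.
  have [x Fx] : exists x : completion, F (ball x (e / 2)).
    by move: (e / 2) e20; apply/cauchyP/cauchy_ballP.
  have [v hv] := approx_ex x e20; exists v; apply: filterS Fx => y.
  rewrite -ball_normE /= => h; have := approx_cnorm y hv => h'.
  apply: approx_le h' _; rewrite pdxx subr_ge0.
  have : cnorm (x - y) < e / 2 by [].
  lra.
- have /filter_ex[g [/= hg hg']] : F ([set g | approx g v e] `&` [set g | approx g v' e']).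
    exact: filterI.
  exact: approx_dist hg hg'.
apply/cvg_ex; exists l => A; rewrite -nbhs_ballE => -[e /= e0 eA].
have e40 : 0 < e / 4 by rewrite divr_gt0.
have [v hv] : exists v, F [set g | approx g v (e / 4)].
  have e80 : 0 < e / 8 by rewrite divr_gt0.
  have [x Fx] : exists x : completion, F (ball x (e / 8)).
    by move: (e / 8) e80; apply/cauchyP/cauchy_ballP.
  have [v hv] := approx_ex x e80; exists v; apply: filterS Fx => y.
  rewrite -ball_normE /= => h; have := approx_cnorm y hv => h'.
  apply: approx_le h' _; rewrite pdxx subr_ge0.
  have : cnorm (x - y) < e / 8 by [].
  lra.
apply: filterS (hv) => g hg; apply: eA; rewrite -ball_normE /=.
suff : cnorm (l - g) < e by [].
have := cnorm_approx (lP _ _ hv) hg; lra.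
Qed.

HB.instance Definition _ := Uniform_isComplete.Build completion completion_complete.

End Completion.

Lemma prenormed_completion (R : realType) (V : prenormed R) :
  exists (B : completeNormedModType R) (i : V -> B),
  [/\ forall u v, i (padd u v) = i u + i v,
      forall a v, i (pscale a v) = a *: i v,
      forall u v, `|i u - i v| = pd u v &
      forall (x : B) e, 0 < e -> exists v, `|x - i v| <= e].
Proof.
have iD (u v : V) : incl (padd u v) = incl u + incl v.
  apply: approx_ext => e e0; exists (padd u v).
    by apply: approx_le (approx_incl _) _; rewrite pdxx subr0 ltW.
  apply: approx_le (approx_add (approx_incl u) (approx_incl v)) _.
  by rewrite pdxx addr0 subr0 ltW.
have iZ a (v : V) : incl (pscale a v) = a *: incl v.
  apply: approx_ext => e e0; exists (pscale a v).
    by apply: approx_le (approx_incl _) _; rewrite pdxx subr0 ltW.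
  apply: approx_le (approx_scale a (approx_incl v)) _.
  by rewrite pdxx mulr0 subr0 ltW.
exists (completion V : completeNormedModType R), (@incl R V); split => //.
- move=> u v.
  have h := approx_add (approx_incl u) (approx_scale (-1) (approx_incl v)).
  have := approx_norm h; rewrite mulr0 addr0 normr_le0 subr_eq0 => /eqP.
  rewrite -[cadd _ _]/(incl u + -1 *: incl v) scaleN1r pd_sub => h'.
  by rewrite -[LHS]/(cnorm _) h'.
- move=> x e e0; have [v h] := approx_ex x e0; exists v.
  have := cnorm_approx h (approx_incl v); rewrite addr0; exact.
Qed.

(** * Seminorms and limits of approximations *)

Record seminorm (R : realType) (V : lmodType R) (p : V -> R) : Prop := Seminorm {
  sn_add : forall x y, p (x + y) <= p x + p y;
  sn_scale : forall a x, p (a *: x) = `|a| * p x }.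

Section Seminorm.
Variables (R : realType) (V : lmodType R) (p : V -> R).
Hypothesis hp : seminorm p.

Lemma sn0 : p 0 = 0.
Proof. by rewrite -(scale0r 0) (sn_scale hp) normr0 mul0r. Qed.

Lemma snN x : p (- x) = p x.
Proof. by rewrite -scaleN1r (sn_scale hp) normrN normr1 mul1r. Qed.

Lemma sn_ge0 x : 0 <= p x.
Proof. by have := sn_add hp x (- x); rewrite subrr sn0 snN; lra. Qed.

Lemma snB x y : p (x - y) = p (y - x).
Proof. by rewrite -snN opprB. Qed.

Definition sn_pre : prenormed R.
Proof.
refine (@Prenormed R V 0 +%R *:%R (fun x y => p (x - y)) _ _ _ _ _ _ _ _ _ _ _ _ _).
- by move=> x; rewrite subrr sn0.
- exact: snB.
- by move=> y x z; rewrite -[x - z](subrKA y); exact: sn_add.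
- by move=> x x' y y'; rewrite opprD addrACA; exact: sn_add.
- by move=> a x y; rewrite -scalerBr (sn_scale hp).
- by move=> x y z; rewrite addrA subrr sn0.
- by move=> x y; rewrite [y + x]addrC subrr sn0.
- by move=> x; rewrite add0r subrr sn0.
- by move=> x; rewrite scaleN1r addNr subrr sn0.
- by move=> a b x; rewrite scalerA subrr sn0.
- by move=> x; rewrite scale1r subrr sn0.
- by move=> a x y; rewrite scalerDr subrr sn0.
- by move=> a b x; rewrite scalerDl subrr sn0.
Defined.

Lemma seminorm_completion : exists (B : completeNormedModType R)
    (i : {linear V -> B}),
  (forall v, `|i v| = p v) /\
  (forall x e, 0 < e -> exists v, `|x - i v| <= e).
Proof.
have [B [i [iD iZ id dense]]] := prenormed_completion sn_pre.
have il : linear (i : V -> B) by move=> a x y; rewrite -iZ -iD.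
pose f : {linear V -> B} :=
  HB.pack (i : V -> B) (GRing.isLinear.Build _ _ _ _ (i : V -> B) il).
exists B, f; split=> // v.
have := id v 0; rewrite -[pd _ _]/(p (v - 0)) subr0 => <-.
by rewrite -[i 0]/(f 0) raddf0 subr0.
Qed.

End Seminorm.

Lemma norm_seminorm (R : realType) (V : normedModType R) :
  seminorm (fun x : V => `|x|).
Proof. by split=> [x y|a x]; [exact: ler_normD|rewrite normrZ]. Qed.

(** Completeness in terms of approximations instead of filters: the sets of
    points that approximate within e form a Cauchy filter base. *)
Lemma complete_limit (R : realType) (T : completePseudoMetricType R)
    (Ap : R -> T -> Prop) :
  (forall e, 0 < e -> exists v, Ap e v) ->
  (forall e v e' v', Ap e v -> Ap e' v' -> ball v (e + e') v') ->
  exists x, forall e v d, Ap e v -> 0 < d -> ball x (e + d) v.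
Proof.
move=> ex cp.
pose S (e : R) := [set v | exists2 e', e' <= e & Ap e' v].
pose F := filter_from [set e : R | 0 < e] S.
have FF : ProperFilter F.
  apply: filter_from_proper; last first.
    by move=> e /= /ex[v h]; exists v, e.
  apply: filter_from_filter; first by exists 1 => /=.
  move=> e e' /= e0 e0'; exists (Num.min e e'); first by rewrite /= lt_min e0.
  by move=> v [d]; rewrite le_min => /andP[? ?] h; split; exists d.
have Fc : cauchy F.
  apply/cauchy_exP => e e0; have e2 : 0 < e / 2 by rewrite divr_gt0.
  have [v h] := ex _ e2.
  exists v, (e / 2) => // w [d de hw].
  apply: (@le_ball _ _ v (e / 2 + d)); first lra.
  exact: cp.
have /cvg_ex[/= l Fl] : cvg F by exact: cauchy_cvg.
exists l => e v d h d0.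
have d2 : 0 < d / 2 by rewrite divr_gt0.
have : F (ball l (d / 2)) by apply: Fl; exact: nbhsx_ballx.
case=> d' /= d'0 sub.
have [w hw] := ex (Num.min d' (d / 2)) ltac:(by rewrite lt_min d'0).
have lw : ball l (d / 2) w.
  by apply: sub; exists (Num.min d' (d / 2)) => //; rewrite ge_min lexx.
have wv := cp _ _ _ _ hw h.
apply: (@le_ball _ _ l (d / 2 + (Num.min d' (d / 2) + e))); last exact: ball_triangle lw wv.
have : Num.min d' (d / 2) <= d / 2 by rewrite ge_min lexx orbT.
lra.
Qed.

Lemma banach_limit (R : realType) (X : completeNormedModType R)
    (Ap : R -> X -> Prop) :
  (forall e, 0 < e -> exists v, Ap e v) ->
  (forall e v e' v', Ap e v -> Ap e' v' -> `|v - v'| <= e + e') ->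
  exists x, forall e v, Ap e v -> `|x - v| <= e.
Proof.
move=> ex cp.
have [e e0|e v e' v' [d hd h] [d' hd' h']|x hx] :=
  @complete_limit R X (fun e v => exists2 d, d < e & Ap d v).
- have e2 : 0 < e / 2 by rewrite divr_gt0.
  have [w h'] := ex _ e2; exists w, (e / 2) => //; lra.
- by rewrite -ball_normE /=; have := cp _ _ _ _ h h'; lra.
exists x => e v h; apply/ler_addgt0Pl => d d0.
have d2 : 0 < d / 2 by rewrite divr_gt0.
have := hx (e + d / 2) v (d / 2) ltac:(by exists e => //; lra) d2.
by rewrite -ball_normE /=; lra.
Qed.

(** * Linear combinations of finite families *)

Section LinearCombinations.
Variable R : realType.
Implicit Types (c : nat -> R) (n : nat).

(** A finite family is a sequence together with the number n of its relevant
    terms, which makes it easy to extend families and to compare families living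
    in different spaces. *)
Definition lc (V : lmodType R) n c (u : nat -> V) : V :=
  \sum_(i < n) c i *: u i.

Definition l1 n c : R := \sum_(i < n) `|c i|.

Lemma l1_ge0 n c : 0 <= l1 n c.
Proof. exact: sumr_ge0. Qed.

Lemma l1S n c : l1 n.+1 c = l1 n c + `|c n|.
Proof. by rewrite /l1 big_ord_recr. Qed.

Lemma le_l1 n c i : (i < n)%N -> `|c i| <= l1 n c.
Proof.
move=> h; rewrite /l1 (bigD1 (Ordinal h))//= lerDl.
exact: sumr_ge0.
Qed.

Lemma eq_l1 n c c' : (forall i, (i < n)%N -> c i = c' i) -> l1 n c = l1 n c'.
Proof. by move=> h; apply: eq_bigr => i _; rewrite h. Qed.

Lemma l1Z n a c : l1 n (fun i => a * c i) = `|a| * l1 n c.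
Proof. by rewrite /l1 mulr_sumr; apply: eq_bigr => i _; rewrite normrM. Qed.

Section Lmod.
Variable V : lmodType R.
Implicit Type u : nat -> V.

Lemma lc0 c u : lc 0 c u = 0.
Proof. by rewrite /lc big_ord0. Qed.

Lemma lcS n c u : lc n.+1 c u = lc n c u + c n *: u n.
Proof. by rewrite /lc big_ord_recr. Qed.

Lemma eq_lc n c c' u u' : (forall i, (i < n)%N -> c i = c' i) ->
  (forall i, (i < n)%N -> u i = u' i) -> lc n c u = lc n c' u'.
Proof. by move=> h h'; apply: eq_bigr => i _; rewrite h ?h'. Qed.

Lemma lc_add n c c' u : lc n (fun i => c i + c' i) u = lc n c u + lc n c' u.
Proof. by rewrite /lc -big_split; apply: eq_bigr => i _; rewrite scalerDl. Qed.

Lemma lc_scale n a c u : lc n (fun i => a * c i) u = a *: lc n c u.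
Proof. by rewrite /lc scaler_sumr; apply: eq_bigr => i _; rewrite scalerA. Qed.

Lemma lc_opp n c u : lc n (fun i => - c i) u = - lc n c u.
Proof. by rewrite /lc -sumrN; apply: eq_bigr => i _; rewrite scaleNr. Qed.

Lemma lc_sub n c c' u : lc n (fun i => c i - c' i) u = lc n c u - lc n c' u.
Proof. by rewrite (lc_add n c (fun i => - c' i)) lc_opp. Qed.

Lemma lc_subr n c u u' : lc n c (fun i => u i - u' i) = lc n c u - lc n c u'.
Proof. by rewrite /lc -sumrB; apply: eq_bigr => i _; rewrite scalerBr. Qed.

Definition delta i : nat -> R := fun j => (j == i)%:R.

Lemma lc_delta n i u : (i < n)%N -> lc n (delta i) u = u i.
Proof.
move=> h; rewrite /lc (bigD1 (Ordinal h))//= /delta eqxx scale1r big1 ?addr0//.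
move=> j; rewrite -val_eqE /= => /negbTE ->; exact: scale0r.
Qed.

Definition trunc n c : nat -> R := fun i => if (i < n)%N then c i else 0.

Lemma lc_trunc n m c u : (n <= m)%N -> lc m (trunc n c) u = lc n c u.
Proof.
move=> /subnKC <-; elim: (m - n)%N => [|k IH].
  rewrite addn0; apply: eq_lc => // i h; by rewrite /trunc h.
by rewrite addnS lcS IH /trunc ltnNge leq_addr /= scale0r addr0.
Qed.

Lemma lc_lc n m c (a : nat -> nat -> R) u :
  lc n c (fun i => lc m (a i) u) = lc m (fun j => \sum_(i < n) c i * a i j) u.
Proof.
rewrite /lc; under eq_bigr do rewrite scaler_sumr.
rewrite exchange_big; apply: eq_bigr => j _; rewrite scaler_suml.
by apply: eq_bigr => i _; rewrite scalerA.
Qed.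

End Lmod.

Lemma linear_lc (V W : lmodType R) (f : {linear V -> W}) n c u :
  f (lc n c u) = lc n c (f \o u).
Proof. by rewrite /lc linear_sum; apply: eq_bigr => i _; rewrite linearZ. Qed.

Lemma lc_seminorm (V : lmodType R) (p : V -> R) n (u : nat -> V) :
  seminorm p -> seminorm (fun c : nat -> R => p (lc n c u)).
Proof.
move=> hp; split=> [x y|a x].
  by rewrite (lc_add n x y); exact: sn_add.
by rewrite (lc_scale n a x) (sn_scale hp).
Qed.

Lemma sn_lc_le (V : lmodType R) (p : V -> R) n c (u : nat -> V) B :
  seminorm p -> (forall i, (i < n)%N -> p (u i) <= B) ->
  p (lc n c u) <= B * l1 n c.
Proof.
move=> hp; elim: n => [|n IH] h.
  by rewrite lc0 sn0// /l1 big_ord0 mulr0.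
rewrite lcS l1S mulrDr (le_trans (sn_add hp _ _))// lerD//.
  by apply: IH => i hi; apply: h; exact: ltnW.
by rewrite (sn_scale hp) mulrC ler_wpM2r// h.
Qed.

Lemma norm_lc_le (V : normedModType R) n c (u : nat -> V) B :
  (forall i, (i < n)%N -> `|u i| <= B) -> `|lc n c u| <= B * l1 n c.
Proof. by move=> h; apply: (sn_lc_le _ (norm_seminorm V)). Qed.

Lemma norm_lc_sub (V : normedModType R) n c (u u' : nat -> V) B :
  (forall i, (i < n)%N -> `|u i - u' i| <= B) ->
  `|lc n c u - lc n c u'| <= B * l1 n c.
Proof. by move=> h; rewrite -lc_subr; exact: norm_lc_le. Qed.

End LinearCombinations.

(** * Finite-dimensional subspaces *)

Section FiniteDimension.
Variable R : realType.

Definition in_span (V : lmodType R) n (u : nat -> V) x := exists c, x = lc n c u.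

(** If c u + a x were small for a not 0, dividing by a would bring x close to the
    span; so being away from the span bounds the coefficient of x by the norm. *)
Lemma span_dist (X : normedModType R) n (u : nat -> X) (x : X) :
  (forall y, (forall e, 0 < e -> exists c, `|y - lc n c u| <= e) ->
     in_span n u y) ->
  ~ in_span n u x ->
  exists2 d, 0 < d & forall c a, `|a| * d <= `|lc n c u + a *: x|.
Proof.
move=> clo nx; have /existsNP[d /not_implyP[d0 hd]] :=
  contra_not (clo x) nx.
exists d => // c a; have [->|a0] := eqVneq a 0; first by rewrite normr0 mul0r.
rewrite leNgt; apply/negP => lt; apply: hd.
exists (fun i => - a^-1 * c i); rewrite lc_scale scaleNr opprK.
rewrite -(ler_pM2l (_ : 0 < `|a|)) ?normr_gt0// -normrZ scalerDr scalerA.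
by rewrite mulfV// scale1r addrC ltW.
Qed.

(** Induction on n. Unless it is redundant, the last vector is at positive
    distance from the previous span, so its coefficients in approximations of x
    converge by [span_dist]; subtracting the limit reduces to the previous span. *)
Lemma span_closed (X : normedModType R) n (u : nat -> X) (x : X) :
  (forall e, 0 < e -> exists c, `|x - lc n c u| <= e) -> in_span n u x.
Proof.
elim: n x => [|n IH] x h.
  exists (fun=> 0); rewrite lc0; apply/eqP; rewrite -normr_eq0 eq_le normr_ge0 andbT.
  by apply/ler_addgt0Pl => e /h[c]; rewrite lc0 subr0 addr0.
have [[a ua]|nu] := pselect (in_span n u (u n)).
  have sub c : lc n.+1 c u = lc n (fun i => c i + c n * a i) u.
    by rewrite lcS ua (lc_add n c (fun i => c n * a i)) lc_scale.
  have [|c ->] := IH x.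
    by move=> e /h[c hc]; exists (fun i => c i + c n * a i); rewrite -sub.
  by exists (trunc n c); rewrite lc_trunc.
have [d d0 hd] := span_dist IH nu.
(* the coefficient of [u n] in x, as a limit *)
have [e e0||a ha] := @banach_limit R R^o (fun e a => exists c,
    `|x - (lc n c u + a *: u n)| <= e * d).
- have [c] := h _ (mulr_gt0 e0 d0); rewrite lcS => hc.
  by exists (c n), c.
- move=> e a e' a' [c hc] [c' hc'].
  rewrite -(ler_pM2r d0).
  have := hd (fun i => c i - c' i) (a - a'); rewrite lc_sub scalerBl => /le_trans; apply.
  rewrite mulrDl; apply: le_trans (lerD hc hc').
  rewrite -[`|x - (lc n c u + _)|]normrN; apply: le_trans (ler_normD _ _).
  by apply: norm_eq_le; lmod_over R X.
have [|c hc] := IH (x - a *: u n).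
  move=> e e0; pose K := d + `|u n|.
  have K0 : 0 < K by rewrite ltr_pwDl.
  have [c] := h _ (mulr_gt0 (divr_gt0 e0 K0) d0); rewrite lcS => hc.
  exists c; have := ha _ (c n) (ex_intro _ c hc) => h1.
  have -> : x - a *: u n - lc n c u = (x - (lc n c u + c n *: u n)) - (a - c n) *: u n.
    by lmod_over R X.
  rewrite (le_trans (ler_normB _ _))// normrZ.
  have h2 := ler_wpM2r (normr_ge0 (u n)) h1.
  have -> : e = e / K * d + e / K * `|u n| by rewrite -mulrDr divfK// gt_eqF.
  exact: lerD.
exists (fun i => trunc n c i + a * delta R n i).
rewrite lc_add lc_trunc// lc_scale lc_delta// -hc subrK//.
Qed.

Definition lin_free (V : lmodType R) n (u : nat -> V) :=
  forall c, lc n c u = 0 -> forall i, (i < n)%N -> c i = 0.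

Lemma lin_freeS (V : lmodType R) n (u : nat -> V) :
  lin_free n u -> ~ in_span n u (u n) -> lin_free n.+1 u.
Proof.
move=> fr nu c; rewrite lcS => h.
have cn : c n = 0.
  apply: contrapT => /eqP c0; apply: nu.
  exists (fun i => - (c n)^-1 * c i); rewrite lc_scale scaleNr.
  move/eqP: h; rewrite addr_eq0 => /eqP ->.
  by rewrite scalerN opprK scalerA mulVf// scale1r.
move: h; rewrite cn scale0r addr0 => /fr h i.
by rewrite ltnS leq_eqVlt => /orP[/eqP ->|/h].
Qed.

Lemma lin_free_pred (V : lmodType R) n (u : nat -> V) :
  lin_free n.+1 u -> lin_free n u /\ ~ in_span n u (u n).
Proof.
move=> fr; split.
  move=> c h i hi; have := fr (trunc n c); rewrite lc_trunc// => /(_ h i (ltnW hi)).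
  by rewrite /trunc hi.
move=> [c hc]; have := fr (fun i => trunc n c i - delta R n i).
rewrite lc_sub lc_trunc// lc_delta// -hc subrr => /(_ erefl n (ltnSn n)).
rewrite /trunc ltnn /delta eqxx sub0r => /eqP.
by rewrite oppr_eq0 oner_eq0.
Qed.

(** All norms on a finite-dimensional space are equivalent. The last coefficient
    is bounded by [span_dist], and removing the last vector then costs a multiple
    of the norm. *)
Lemma bounded_coefs (X : normedModType R) n (u : nat -> X) :
  lin_free n u -> exists2 K, 0 < K & forall c, l1 n c <= K * `|lc n c u|.
Proof.
elim: n => [|n IH].
  by exists 1 => // c; rewrite /l1 big_ord0 mulr_ge0.
move=> /lin_free_pred[/IH[K K0 hK] /(span_dist (@span_closed _ n u))[d d0 hd]].
exists (K * (1 + d^-1 * `|u n|) + d^-1).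
  by rewrite ltr_pwDr ?invr_gt0// mulr_ge0 ?(ltW K0)// addr_ge0// mulr_ge0// invr_ge0 ltW.
move=> c; rewrite l1S lcS mulrDl lerD//; last first.
  by rewrite ler_pdivlMl// mulrC.
apply: le_trans (hK c) _; rewrite -mulrA ler_pM2l//.
have h1 : `|c n| <= d^-1 * `|lc n c u + c n *: u n| by rewrite ler_pdivlMl// mulrC.
rewrite -{1}[lc n c u](addrK (c n *: u n)) (le_trans (ler_normB _ _))//.
rewrite mulrDl mul1r lerD// normrZ mulrAC ler_wpM2r//.
Qed.

(** Finite-dimensional subspaces as spaces of their own: complete the seminorm
    that u induces on coefficients. The images of the unit vectors span a dense
    subspace, which is closed by [span_closed]. *)
Lemma span_space (X : normedModType R) n (u : nat -> X) :
  exists (E : completeNormedModType R) (e : nat -> E),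
    (forall c, `|lc n c e| = `|lc n c u|) /\ (forall x, in_span n e x).
Proof.
have hp := lc_seminorm n u (norm_seminorm X).
have [E [i [ni dense]]] := seminorm_completion hp.
pose e j : E := i (delta R j).
have ie c : i c = lc n c e.
  have -> : lc n c e = i (lc n c (delta R)) by rewrite linear_lc.
  apply/eqP; rewrite -subr_eq0 -raddfB -normr_eq0 ni; apply/eqP.
  rewrite (_ : lc n _ u = 0) ?normr0//.
  apply: big1 => j _; rewrite (_ : (_ : nat -> R) _ = 0) ?scale0r//.
  rewrite /lc -[(_ - _) _]/(c j - (\sum_(k < n) c k *: delta R k) j).
  rewrite fct_sumE (bigD1 j)//= -[(_ *: _) _]/(c j * delta R j j) /delta eqxx mulr1.
  rewrite big1 ?addr0 ?subrr// => k; rewrite -val_eqE /= => kj.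
  by rewrite -[(_ *: _) _]/(c k * delta R k j) /delta eq_sym (negbTE kj) mulr0.
exists E, e; split=> [c|x]; first by rewrite -ie ni.
apply: span_closed => d /(dense x)[c]; rewrite ie => hc; by exists c.
Qed.

Lemma finite_dimensional_span (V : lmodType R) n (u : nat -> V) :
  (forall x, in_span n u x) -> finite_dimensional V.
Proof.
move=> h; exists n, (fun i => u i) => x; have [c ->] := h x.
by exists (fun i => c i).
Qed.

Lemma linear_extension (E X : lmodType R) n
    (e : nat -> E) (u : nat -> X) :
  (forall x, in_span n e x) ->
  (forall c, lc n c e = 0 -> lc n c u = 0) ->
  exists f : {linear E -> X}, forall c, f (lc n c e) = lc n c u.
Proof.
move=> sp h; have [k hk] := choice sp.
have eqf c c' : lc n c e = lc n c' e -> lc n c u = lc n c' u.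
  move=> cc; apply/eqP; rewrite -subr_eq0 -lc_sub; apply/eqP/h.
  by rewrite lc_sub cc subrr.
pose f x := lc n (k x) u.
have fl : linear f.
  move=> a x y; rewrite /f -lc_scale -lc_add; apply: eqf.
  by rewrite -hk lc_add lc_scale -!hk.
exists (HB.pack f (GRing.isLinear.Build _ _ _ _ f fl) : {linear E -> X}).
by move=> c; apply: eqf; rewrite -hk.
Qed.

End FiniteDimension.

(** * Almost isometric families, amalgamation and one-point extensions *)

Section Closeness.
Variable R : realType.

(** The error is measured against the l1 norm of the coefficients. The condition
    is thus homogeneous in the coefficients, and errors of successive steps add up
    without factors depending on n. *)
Definition eps_close (V W : normedModType R) n (d : R) (u : nat -> V) (w : nat -> W) :=
  forall c, `| `|lc n c u| - `|lc n c w| | <= d * l1 n c.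

Lemma eps_close_sym (V W : normedModType R) n d (u : nat -> V) (w : nat -> W) :
  eps_close n d u w -> eps_close n d w u.
Proof. by move=> h c; rewrite distrC. Qed.

Lemma eps_close_trans (U V W : normedModType R) n d d' (u : nat -> U) (v : nat -> V)
    (w : nat -> W) :
  eps_close n d u v -> eps_close n d' v w -> eps_close n (d + d') u w.
Proof.
move=> h h' c; rewrite mulrDl; apply: le_trans (lerD (h c) (h' c)).
exact: ler_distD.
Qed.

Lemma eps_close_le (V W : normedModType R) n m d d' (u : nat -> V) (w : nat -> W) :
  eps_close n d u w -> (m <= n)%N -> d <= d' -> eps_close m d' u w.
Proof.
move=> h mn dd c; have := h (trunc m c); rewrite !lc_trunc// => /le_trans; apply.
have -> : l1 n (trunc m c) = l1 m c.
  rewrite -(subnKC mn); elim: (n - m)%N => [|k IH].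
    by rewrite addn0; apply: eq_l1 => i hi; rewrite /trunc hi.
  by rewrite addnS l1S IH /trunc ltnNge leq_addr /= normr0 addr0.
by rewrite ler_wpM2r// l1_ge0.
Qed.

Lemma eps_close_perturb (V : normedModType R) n d (u w : nat -> V) :
  (forall i, (i < n)%N -> `|u i - w i| <= d) -> eps_close n d u w.
Proof.
move=> h c; apply: le_trans (norm_lc_sub c h); exact: ler_dist_dist.
Qed.

Lemma eps_close_isometric (V W : normedModType R) n (f : {linear V -> W}) (v : nat -> V) :
  isometric f -> eps_close n 0 v (f \o v).
Proof. by move=> hf c; rewrite -linear_lc hf subrr normr0 mul0r. Qed.

Lemma eq_eps_close (V W : normedModType R) n d (u u' : nat -> V) (w w' : nat -> W) :
  (forall i, (i < n)%N -> u i = u' i) -> (forall i, (i < n)%N -> w i = w' i) ->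
  eps_close n d u w -> eps_close n d u' w'.
Proof.
move=> h h' k c; rewrite -(eq_lc (c := c) _ h)// -(eq_lc (c := c) _ h')//.
Qed.

Lemma seminorm_of_le (V : lmodType R) (p : V -> R) : p 0 = 0 ->
  (forall x y, p (x + y) <= p x + p y) ->
  (forall a x, a != 0 -> p (a *: x) <= `|a| * p x) -> seminorm p.
Proof.
move=> p0 pD pZ; split=> // a x.
have [->|a0] := eqVneq a 0; first by rewrite scale0r normr0 mul0r.
apply/eqP; rewrite eq_le pZ//=.
have a1 : a^-1 != 0 by rewrite invr_eq0.
have := pZ a^-1 (a *: x) a1.
by rewrite scalerA mulVf// scale1r normfV ler_pdivlMl ?normr_gt0.
Qed.

(** The norm of (x, y) in the amalgam is the infimum over c of
    |x + sum c_i u_i| + |y - sum c_i w_i| + d |c|_1: the largest seminorm that is at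
    most the norm on U and on W and puts u_i within d of w_i. Closeness of u and w says exactly that
    no c makes a vector of U or of W shorter. *)
Lemma amalgamation (U W : completeNormedModType R) n (u : nat -> U) (w : nat -> W)
    (d : R) : 0 <= d -> eps_close n d u w ->
  exists (Z : completeNormedModType R) (j : {linear U -> Z}) (h : {linear W -> Z}),
    [/\ isometric j, isometric h &
        forall i, (i < n)%N -> `|j (u i) - h (w i)| <= d].
Proof.
move=> d0 uw.
pose f (z : U * W) c := `|z.1 + lc n c u| + `|z.2 - lc n c w| + d * l1 n c.
have f_ge0 z c : 0 <= f z c by rewrite !addr_ge0// mulr_ge0// l1_ge0.
pose q z := inf (range (f z)).
have q_le z c : q z <= f z c.
  by apply: ge_inf; [exists 0 => _ [c' _ <-]|exists c].
have le_q z r : (forall c, r <= f z c) -> r <= q z.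
  move=> h; apply: lb_le_inf; first by exists (f z (fun=> 0)), (fun=> 0).
  by move=> _ [c _ <-].
have q_ge0 z : 0 <= q z by exact: le_q.
have lcz (V : lmodType R) (x : nat -> V) : @lc R V n (fun=> 0) x = 0.
  by rewrite /lc big1// => i _; rewrite scale0r.
have l1z : l1 n (fun=> 0 : R) = 0 by rewrite /l1 big1// => i _; rewrite normr0.
have fz z : f z (fun=> 0) = `|z.1| + `|z.2|.
  by rewrite /f !lcz l1z mulr0 addr0 subr0 addr0.
have sq : seminorm q.
  apply: seminorm_of_le.
  - apply/eqP; rewrite eq_le q_ge0 andbT (le_trans (q_le _ (fun=> 0)))//.
    by rewrite fz !normr0 addr0.
  - move=> z z'; rewrite -lerBlDl; apply: (le_q) => c'; rewrite lerBlDl -lerBlDr.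
    apply: (le_q) => c; rewrite lerBlDr.
    apply: le_trans (q_le _ (fun i => c i + c' i)) _; rewrite /f.
    have -> : `|z.1 + lc n c u| + `|z.2 - lc n c w| + d * l1 n c +
      (`|z'.1 + lc n c' u| + `|z'.2 - lc n c' w| + d * l1 n c') =
      (`|z.1 + lc n c u| + `|z'.1 + lc n c' u|) +
      (`|z.2 - lc n c w| + `|z'.2 - lc n c' w|) + d * (l1 n c + l1 n c') by ring.
    rewrite !lc_add; apply: lerD; [apply: lerD|].
    + apply: le_trans (ler_normD _ _); apply: norm_eq_le => /=; lmod_over R U.
    + apply: le_trans (ler_normD _ _); apply: norm_eq_le => /=; lmod_over R W.
    + rewrite ler_wpM2l// /l1 -big_split; apply: ler_sum => i _; exact: ler_normD.
  - move=> a z a0; rewrite -ler_pdivrMl ?normr_gt0//; apply: (le_q) => c.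
    rewrite ler_pdivrMl ?normr_gt0//; apply: le_trans (q_le _ (fun i => a * c i)) _.
    by rewrite /f !lc_scale l1Z /= -scalerDr -scalerBr !normrZ mulrCA -!mulrDr.
have [Z [i [ni _]]] := seminorm_completion sq.
have jl : linear (fun x : U => i (x, 0)).
  move=> a x y; rewrite -linearP; congr (i _).
  by congr pair; rewrite /= scaler0 addr0.
have hl : linear (fun x : W => i (0, x)).
  move=> a x y; rewrite -linearP; congr (i _).
  by congr pair; rewrite /= scaler0 addr0.
exists Z, (HB.pack (fun x : U => i (x, 0))
  (GRing.isLinear.Build _ _ _ _ (fun x : U => i (x, 0)) jl) : {linear U -> Z}).
exists (HB.pack (fun x : W => i (0, x))
  (GRing.isLinear.Build _ _ _ _ (fun x : W => i (0, x)) hl) : {linear W -> Z}).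
split=> [x|y|k kn] /=.
- rewrite ni; apply/eqP; rewrite eq_le; apply/andP; split.
    by rewrite (le_trans (q_le _ (fun=> 0)))// fz /= normr0 addr0.
  apply: (le_q) => c; rewrite /f /= sub0r normrN -addrA.
  have := uw c; rewrite ler_norml => /andP[_ h].
  have : `|x| <= `|x + lc n c u| + `|lc n c u|.
    by rewrite -{1}[x](addrK (lc n c u)) ler_normB.
  lra.
- rewrite ni; apply/eqP; rewrite eq_le; apply/andP; split.
    by rewrite (le_trans (q_le _ (fun=> 0)))// fz /= normr0 add0r.
  apply: (le_q) => c; rewrite /f /= add0r.
  have := uw c; rewrite ler_norml => /andP[h _].
  have : `|y| <= `|y - lc n c w| + `|lc n c w|.
    by rewrite -{1}[y](subrK (lc n c w)) ler_normD.
  lra.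
- rewrite -raddfB ni; apply: le_trans (q_le _ (fun i => - delta R k i)) _.
  rewrite /f /= !lc_opp !lc_delta// subr0 subrr normr0 sub0r add0r opprK addNr.
  rewrite normr0 add0r -[leRHS]mulr1 ler_wpM2l//.
  rewrite /l1 (bigD1 (Ordinal kn))//= big1 ?addr0.
    by rewrite /delta eqxx normrN normr1.
  by move=> l; rewrite -val_eqE /= /delta => /negbTE ->; rewrite normrN normr0.
Qed.

Definition ext (V : Type) n (v : nat -> V) (y : V) i := if (i < n)%N then v i else y.

Lemma lc_ext (V : lmodType R) n c (v : nat -> V) y :
  lc n.+1 c (ext n v y) = lc n c v + c n *: y.
Proof.
rewrite lcS; congr (_ + _).
  by apply: eq_lc => // i hi; rewrite /ext hi.
by rewrite /ext ltnn.
Qed.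

(** The form of the Gurarij property that a formula with a single existential
    quantifier can express: it speaks of one new vector, and its error is
    proportional to the coefficients, not to the norms of the combinations. *)
Definition one_point (G : completeNormedModType R) :=
  forall (Z : completeNormedModType R) (h : {linear G -> Z}) n (v : nat -> G) (z : Z)
    (d : R), isometric h -> 0 < d ->
  exists y, eps_close n.+1 d (ext n (h \o v) z) (ext n v y).

Section OnePoint.
Variables (G : completeNormedModType R).
Hypothesis hG : one_point G.

(** In an amalgam where u_i and g_i are at distance d, the vector [u n] becomes a
    point over the family g of G. *)
Lemma one_point_step (F : completeNormedModType R) n d e (u : nat -> F) (g : nat -> G) :
  0 <= d -> d < e -> eps_close n d u g -> exists y, eps_close n.+1 e u (ext n g y).
Proof.
move=> d0 de /(amalgamation d0)[Z [j [h [jj hh jh]]]].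
have ed : 0 < e - d by rewrite subr_gt0.
have [y hy] := hG n g (j (u n)) hh ed.
exists y; rewrite -[e](subrK d) addrC; apply: eps_close_trans hy.
rewrite -[d]add0r; apply: eps_close_trans (eps_close_isometric _ _ jj) _.
apply: eps_close_perturb => i; rewrite ltnS leq_eqVlt /ext => /orP[/eqP ->|hi] /=.
  by rewrite ltnn subrr normr0.
by rewrite hi jh.
Qed.

Lemma one_point_iter (F : completeNormedModType R) n k d e (u : nat -> F) (g : nat -> G) :
  0 <= d -> d < e -> eps_close n d u g ->
  exists2 g', forall i, (i < n)%N -> g' i = g i & eps_close (n + k) e u g'.
Proof.
move=> d0; elim: k e => [|k IH] e de h.
  by exists g => //; rewrite addn0; apply: eps_close_le h _ (ltW de).
have de2 : d < (d + e) / 2 by lra.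
have de3 : (d + e) / 2 < e by lra.
have [g' gg h'] := IH ((d + e) / 2) de2 h.
have [y hy] := one_point_step (ltW (le_lt_trans d0 de2)) de3 h'.
exists (ext (n + k) g' y); last by rewrite addnS.
by move=> i hi; rewrite /ext ltn_addr// gg.
Qed.

End OnePoint.

Lemma in_span_sum (V : lmodType R) n (u : nat -> V) (I : finType) (b : I -> V)
    (c : I -> R) :
  (forall i, in_span n u (b i)) -> in_span n u (\sum_i c i *: b i).
Proof.
move=> h; apply: (big_ind (in_span n u)).
- by exists (fun=> 0); rewrite /lc big1// => i _; rewrite scale0r.
- by move=> x y [a ->] [a' ->]; exists (fun i => a i + a' i); rewrite lc_add.
- by move=> i _; have [a ->] := h i; exists (fun j => c i * a j); rewrite lc_scale.
Qed.

Lemma complete_basis (V : lmodType R) n (u : nat -> V) :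
  lin_free n u -> finite_dimensional V ->
  exists k (u' : nat -> V), [/\ forall i, (i < n)%N -> u' i = u i,
    lin_free (n + k) u' & forall x, in_span (n + k) u' x].
Proof.
move=> fr [N [b hb]].
suff /(_ N) [k [u' [h1 h2 h3]]] : forall j, exists k (u' : nat -> V),
    [/\ forall i, (i < n)%N -> u' i = u i, lin_free (n + k) u' &
        forall i : 'I_N, (i < j)%N -> in_span (n + k) u' (b i)].
  exists k, u'; split=> // x; have [c ->] := hb x.
  by apply: in_span_sum => i; exact: h3.
elim=> [|j [k [u' [h1 h2 h3]]]]; first by exists 0%N, u; rewrite addn0.
have [jN|Nj] := ltnP j N; last first.
  by exists k, u'; split=> // i _; apply: h3; exact: leq_trans (ltn_ord i) Nj.
have [sp|nsp] := pselect (in_span (n + k) u' (b (Ordinal jN))).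
  exists k, u'; split=> // i; rewrite ltnS leq_eqVlt => /orP[/eqP ij|]; last exact: h3.
  by rewrite (_ : i = Ordinal jN)//; exact: val_inj.
have agree i : (i < n + k)%N -> u' i = ext (n + k) u' (b (Ordinal jN)) i.
  by move=> hi; rewrite /ext hi.
have spE m : in_span (n + k) u' m -> in_span (n + k) (ext (n + k) u' (b (Ordinal jN))) m.
  by move=> [c ->]; exists c; exact: eq_lc.
exists k.+1, (ext (n + k) u' (b (Ordinal jN))); rewrite addnS; split.
- by move=> i hi; rewrite -agree ?h1// ltn_addr.
- apply: lin_freeS.
    by move=> c hc; apply: h2; rewrite -hc; apply: eq_lc.
  rewrite {2}/ext ltnn => -[c hc]; apply: nsp; exists c; rewrite hc.
  by apply: eq_lc => // i hi; rewrite agree.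
- move=> i; rewrite ltnS leq_eqVlt => /orP[/eqP ij|/h3 [c ->]].
    exists (delta R (n + k)); rewrite lc_delta// /ext ltnn.
    by congr b; exact: val_inj.
  exists (trunc (n + k) c); rewrite lc_trunc//; exact: eq_lc.
Qed.

(** A basis of E goes isometrically to G; extend it to a basis of F, and add the
    images of the other basis vectors one by one. As the vectors are independent,
    [bounded_coefs] turns the final l1 error into a relative error. *)
Lemma one_point_gurarij (G : completeNormedModType R) : one_point G -> gurarij G.
Proof.
move=> hG e E F iota phi e0 fE fF hi hp.
have [|n [b [_ bfree bspan]]] := @complete_basis E 0 (fun=> 0) _ fE; first by move=> c _ i.
rewrite add0n in bfree bspan.
have [|k [u [ub ufree uspan]]] := @complete_basis F n (iota \o b) _ fF.
  move=> c; rewrite -linear_lc => h; apply: bfree.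
  by apply/eqP; rewrite -normr_eq0 -hi h normr0.
have [K K0 hK] := bounded_coefs ufree.
have clo : eps_close n 0 u (phi \o b).
  have := eps_close_trans (eps_close_sym (eps_close_isometric n b hi)) (eps_close_isometric n b hp).
  by rewrite addr0; apply: eq_eps_close => // i hin; rewrite ub.
have [g gb cg] := one_point_iter hG k (lexx 0) (divr_gt0 e0 K0) clo.
have [|psi hpsi] := @linear_extension R F G (n + k) u g uspan.
  move=> c /ufree hc; rewrite /lc big1// => i _; rewrite hc ?scale0r//.
exists psi; split=> x.
  have [c ->] := bspan x; rewrite (linear_lc iota) (linear_lc phi).
  rewrite -(eq_lc (c := c) (fun _ _ => erefl) ub).
  rewrite -(lc_trunc c u (leq_addr k n)) hpsi lc_trunc ?leq_addr//.
  exact: eq_lc.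
have [c ->] := uspan x; rewrite hpsi.
have h1 : `| `|lc (n + k) c u| - `|lc (n + k) c g| | <= e * `|lc (n + k) c u|.
  apply: le_trans (cg c) _; rewrite -mulrA ler_pM2l// ler_pdivrMl//.
by move: h1; rewrite ler_norml => /andP[? ?]; apply/andP; split; lra.
Qed.

(** The Gurarij property for the span of v inside the span of u. A relative error
    d / (B + 1) becomes an l1 error d when B bounds the norms of the u_i. *)
Lemma gurarij_realize (G : completeNormedModType R) : gurarij G ->
  forall (Z : completeNormedModType R) (h : {linear G -> Z}) n N (v : nat -> G)
    (u : nat -> Z) (d : R), isometric h -> 0 < d -> (n <= N)%N ->
  (forall i, (i < n)%N -> u i = h (v i)) ->
  exists2 y, forall i, (i < n)%N -> y i = v i & eps_close N d u y.
Proof.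
move=> hG Z h n N v u d hh d0 nN uv.
have [E [e [ne spe]]] := span_space n v.
have [F [f [nf spf]]] := span_space N u.
have nef c : `|lc n c f| = `|lc n c e|.
  rewrite -(lc_trunc c f nN) nf lc_trunc// ne -hh linear_lc.
  by congr (`|_|); exact: eq_lc.
have [|iota hiota] := @linear_extension R E F n e f spe.
  by move=> c /(congr1 (fun x => `|x|)); rewrite -nef normr0 => /eqP; rewrite normr_eq0 => /eqP.
have [|phi hphi] := @linear_extension R E G n e v spe.
  by move=> c /(congr1 (fun x => `|x|)); rewrite ne normr0 => /eqP; rewrite normr_eq0 => /eqP.
pose B := \sum_(i < N) `|u i|.
have B0 : 0 <= B by exact: sumr_ge0.
have uB i : (i < N)%N -> `|u i| <= B.
  by move=> iN; rewrite /B (bigD1 (Ordinal iN))//= lerDl sumr_ge0.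
have B1 : 0 < B + 1 by rewrite ltr_wpDl.
have [||psi [psi1 psi2]] := hG (d / (B + 1)) E F iota phi (divr_gt0 d0 B1)
  (finite_dimensional_span spe) (finite_dimensional_span spf).
- by move=> x; have [c ->] := spe x; rewrite hiota nef.
- by move=> x; have [c ->] := spe x; rewrite hphi ne.
exists (psi \o f) => [i hi|c] /=.
  have -> : f i = iota (e i) by rewrite -(lc_delta e hi) hiota lc_delta.
  by rewrite psi1 -(lc_delta e hi) hphi lc_delta.
rewrite -linear_lc; have := psi2 (lc N c f); rewrite nf.
have h1 := norm_lc_le c uB.
have h2 : d / (B + 1) * `|lc N c u| <= d * l1 N c.
  apply: le_trans (ler_wpM2l _ h1) _; first by rewrite divr_ge0 ?ltW.
  rewrite mulrA ler_wpM2r ?l1_ge0// -mulrA ler_piMr ?(ltW d0)//.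
  by rewrite ler_pdivrMl// mulr1 lerDl.
by move=> /andP[? ?]; rewrite ler_norml; apply/andP; split; lra.
Qed.

End Closeness.

(** * Uniqueness of the separable Gurarij space *)

Section Uniqueness.
Variable R : realType.

(** Repeating each value infinitely often lets a construction by stages wait until
    it is able to deal with a given requirement. *)
Lemma recurrent_enum (T : countType) :
  exists t : nat -> option T, forall x K, exists2 k, (K <= k)%N & t k = Some x.
Proof.
pose t k : option T := omap fst (unpickle k : option (T * nat)).
exists t => x K.
have [r hr] : exists r : nat, (K <= pickle (x, r))%N; last first.
  by exists (pickle (x, r)) => //; rewrite /t pickleK.
apply: contrapT => /forallNP lt.
have ltK (r : nat) : (pickle (x, r) < K)%N by rewrite ltnNge; apply/negP; exact: lt.
pose f (r : 'I_K.+1) := Ordinal (ltK r).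
have : injective f.
  by move=> r r' /(congr1 val) /= /(pcan_inj pickleK) [] /val_inj.
by move/leq_card; rewrite !card_ord ltnn.
Qed.

Definition half_pow k : R := 2^-1 ^+ k.

Lemma half_pow_gt0 k : 0 < half_pow k.
Proof. by rewrite exprn_gt0// invr_gt0. Qed.

Lemma half_powS k : half_pow k.+1 = half_pow k / 2.
Proof. by rewrite /half_pow exprSr. Qed.

Lemma half_pow_small (e : R) : 0 < e ->
  exists K, forall k, (K <= k)%N -> half_pow k <= e.
Proof.
move=> e0; exists (Num.trunc e^-1).+1 => k hk.
rewrite /half_pow exprVn invf_ple ?posrE ?exprn_gt0//.
apply: ltW; apply: lt_le_trans (truncnS_gt _) _.
rewrite -natrX ler_nat (leq_trans hk)// ltnW// ltn_expl//.
Qed.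

Section Relation.
Variables (G H : completeNormedModType R) (v : nat -> G) (w : nat -> H).
Hypothesis vw : forall n, eps_close n 0 v w.

(** The graph of the isometry sending each v_i to w_i. It is symmetric in the two
    spaces, so that the inverse map is obtained in the same way. *)
Definition span_rel x y := forall e, 0 < e -> exists n c,
  `|x - lc n c v| <= e /\ `|y - lc n c w| <= e.

Lemma close0_norm n c : `|lc n c w| = `|lc n c v|.
Proof.
have := vw n c; rewrite mul0r normr_le0 subr_eq0 => /eqP ->; exact: erefl.
Qed.

Lemma lc_common V (u : nat -> V : lmodType R) n m (c c' : nat -> R) a :
  lc (n + m) (fun i => a * trunc n c i + trunc m c' i) u = a *: lc n c u + lc m c' u.
Proof.
by rewrite (lc_add _ (fun i => a * trunc n c i)) lc_scale !lc_trunc// ?leq_addr// leq_addl.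
Qed.

Lemma span_rel_total : (forall x e, 0 < e -> exists n c, `|x - lc n c v| <= e) ->
  forall x, exists y, span_rel x y.
Proof.
move=> dv x; have [e /(dv x)[n [c h]]|e y e' y' [n [c [h ->]]] [n' [c' [h' ->]]]|y hy] :=
  @banach_limit R H (fun e y => exists n c, `|x - lc n c v| <= e /\ y = lc n c w).
- by exists (lc n c w), n, c.
- rewrite distrC -scaleN1r addrC -lc_common close0_norm lc_common scaleN1r.
  apply: le_trans (lerD h h'); rewrite -[leRHS]addrC.
  rewrite -[`|x - lc n' c' v|]normrN; apply: le_trans (ler_normD _ _).
  by apply: norm_eq_le; lmod_over R G.
- exists y => e /(dv x)[n [c h]]; exists n, c; split=> //.
  by apply: hy; exists n, c.
Qed.

Lemma span_rel_norm x y : span_rel x y -> `|x| = `|y|.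
Proof.
move=> h; apply/eqP; rewrite -subr_eq0 -normr_le0; apply/ler_addgt0Pl => e e0.
have e2 : 0 < e / 2 by rewrite divr_gt0.
have [n [c [h1 h2]]] := h _ e2; have := close0_norm n c.
have := ler_dist_dist x (lc n c v); have := ler_dist_dist y (lc n c w).
rewrite !ler_norml => /andP[? ?] /andP[? ?] ?; apply/andP; split; lra.
Qed.

Lemma span_rel_lin a x y x' y' : span_rel x y -> span_rel x' y' ->
  span_rel (a *: x + x') (a *: y + y').
Proof.
move=> h h' e e0; have e2 : 0 < e / 2 by rewrite divr_gt0.
have a1 : 0 < `|a| + 1 by rewrite ltr_wpDl.
have [n [c [h1 h2]]] := h _ (divr_gt0 e2 a1); have [m [c' [h3 h4]]] := h' _ e2.
exists (n + m)%N, (fun i => a * trunc n c i + trunc m c' i); rewrite !lc_common.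
have l := mul_div1_le (normr_ge0 a) e2.
split; rewrite opprD addrACA -scalerBr [e]splitr;
  apply: le_trans (ler_normD _ _) _; rewrite normrZ lerD//;
  by apply: le_trans l; rewrite ler_wpM2l.
Qed.

Lemma span_rel_fun x y y' : span_rel x y -> span_rel x y' -> y = y'.
Proof.
move=> h h'; have := span_rel_norm (span_rel_lin (-1) h h').
rewrite !scaleN1r addNr normr0 addrC => /esym/eqP.
by rewrite normr_eq0 subr_eq0 => /eqP.
Qed.

End Relation.

Lemma span_rel_sym (G H : completeNormedModType R) (v : nat -> G) (w : nat -> H) x y :
  span_rel v w x y -> span_rel w v y x.
Proof. by move=> h e /h[n [c [? ?]]]; exists n, c. Qed.

Lemma isometry_of_dense (G H : completeNormedModType R) (v : nat -> G) (w : nat -> H) :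
  (forall n, eps_close n 0 v w) ->
  (forall x e, 0 < e -> exists n c, `|x - lc n c v| <= e) ->
  (forall y e, 0 < e -> exists n c, `|y - lc n c w| <= e) ->
  isometrically_isomorphic G H.
Proof.
move=> vw dv dw; have wv n : eps_close n 0 w v by exact: eps_close_sym.
have [f hf] := choice (span_rel_total vw dv).
have [g hg] := choice (span_rel_total wv dw).
have fl : linear f.
  by move=> a x y; apply: (span_rel_fun vw (hf _)); exact: span_rel_lin.
exists (HB.pack f (GRing.isLinear.Build _ _ _ _ f fl) : {linear G -> H}).
  by move=> x; rewrite (span_rel_norm vw (hf x)).
exists g => [x|y] /=.
  by apply: (span_rel_fun wv (hg _)); exact: span_rel_sym.
by apply: (span_rel_fun vw (hf _)); exact: span_rel_sym.
Qed.

Lemma lc_shift (V : lmodType R) n m c (u : nat -> V) :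
  lc (n + m) (fun i => if (i < n)%N then 0 else c (i - n)%N) u =
  lc m c (fun i => u (n + i)%N).
Proof.
rewrite /lc big_split_ord /= big1 ?add0r => [|i _]; last by rewrite ltn_ord scale0r.
by apply: eq_bigr => i _; rewrite ltnNge leq_addr /= addKn.
Qed.

Lemma l1_shift n m (c : nat -> R) :
  l1 (n + m) (fun i => if (i < n)%N then 0 else c (i - n)%N) = l1 m c.
Proof.
rewrite /l1 big_split_ord /= big1 ?add0r => [|i _]; last by rewrite ltn_ord normr0.
by apply: eq_bigr => i _; rewrite ltnNge leq_addr /= addKn.
Qed.

Lemma l1_delta n i : (i < n)%N -> l1 n (delta R i) = 1.
Proof.
move=> h; rewrite /l1 (bigD1 (Ordinal h))//= /delta eqxx normr1 big1 ?addr0//.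
by move=> j; rewrite -val_eqE /= => /negbTE ->; rewrite normr0.
Qed.

Lemma l1_sub n (c c' : nat -> R) : l1 n (fun i => c i - c' i) <= l1 n c + l1 n c'.
Proof. by rewrite /l1 -big_split; apply: ler_sum => i _; exact: ler_normB. Qed.

Lemma eps_close_dist (V W : normedModType R) n d (u : nat -> V) (w : nat -> W) i j :
  0 <= d -> eps_close n d u w -> (i < n)%N -> (j < n)%N ->
  `|w i - w j| <= `|u i - u j| + 2 * d.
Proof.
move=> d0 h hi hj; have := h (fun k => delta R i k - delta R j k).
rewrite !lc_sub !lc_delta// ler_norml => /andP[h1 _].
have h2 := ler_wpM2l d0 (l1_sub n (delta R i) (delta R j)).
rewrite !l1_delta// in h2.
lra.
Qed.

(** Realize in H the family (v, x), seen in an amalgam where v_i and w_i are at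
    distance d. The new family is close to (v, x) within e, independently of d: at
    the cost of moving w by d + e, the quality of the correspondence is improved,
    which is what makes the back-and-forth converge. *)
Lemma forth (G H : completeNormedModType R) n (v : nat -> G) (w : nat -> H) (d e : R) x :
  gurarij H -> 0 <= d -> 0 < e -> eps_close n d v w ->
  exists2 y, forall i, (i < n)%N -> `|y i - w i| <= d + e & eps_close n.+1 e (ext n v x) y.
Proof.
move=> hH d0 e0 /(amalgamation d0)[Z [j [h [jj hh jh]]]].
(* w, kept to measure how far the new vectors are from it, then v and x *)
pose u i := if (i < n)%N then h (w i) else j (ext n v x (i - n)%N).
have e2 : 0 < e / 2 by rewrite divr_gt0.
have [|y yw hy] := gurarij_realize (v := w) (u := u) hH hh e2 (leq_addr n.+1 n).
  by move=> i hi; rewrite /u hi.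
exists (fun i => y (n + i)%N) => [i hi|c].
  rewrite -(yw i hi).
  have := @eps_close_dist _ _ _ _ _ _ (n + i) i (ltW e2) hy ltac:(by rewrite ltn_add2l ltnS ltnW)
     ltac:(by rewrite ltn_addr).
  rewrite {1 2}/u hi ltnNge leq_addr /= addKn /ext hi.
  have := jh _ hi; lra.
have := hy (fun i => if (i < n)%N then 0 else c (i - n)%N).
rewrite !lc_shift l1_shift.
have -> : lc n.+1 c (fun i => u (n + i)%N) = j (lc n.+1 c (ext n v x)).
  rewrite linear_lc; apply: eq_lc => // i hi.
  by rewrite /u ltnNge leq_addr /= addKn.
rewrite jj => /le_trans; apply; rewrite ler_wpM2r ?l1_ge0//; lra.
Qed.

Lemma back_and_forth_step (G H : completeNormedModType R) n (v : nat -> G) (w : nat -> H)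
    (d : R) x y : gurarij G -> gurarij H -> 0 < d -> eps_close n d v w ->
  exists v' w', [/\ eps_close n.+2 (d / 2) v' w',
    forall i, (i < n)%N -> `|v' i - v i| <= 2 * d /\ `|w' i - w i| <= 2 * d,
    `|v' n - x| <= 2 * d & `|w' n.+1 - y| <= 2 * d].
Proof.
move=> hG hH d0 h; have d2 : 0 < d / 2 by rewrite divr_gt0.
have [w1 hw1 h1] := forth x hH (ltW d0) d2 h.
have [v2 hv2 h2] := forth y hG (ltW d2) d2 (eps_close_sym h1).
exists v2, (ext n.+1 w1 y); split; first exact: eps_close_sym.
- move=> i hi; split.
    by have := hv2 i (ltnW hi); rewrite /ext hi; lra.
  by rewrite /ext (leqW hi); have := hw1 i hi; lra.
- by have := hv2 n (ltnSn n); rewrite /ext ltnn; lra.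
- by rewrite /ext ltnn subrr normr0 mulr_ge0// ltW.
Qed.

Lemma telescoped_limit (X : completeNormedModType R) (v : nat -> nat -> X) :
  (forall k i, (i < k.*2)%N -> `|v k.+1 i - v k i| <= 2 * half_pow k) ->
  exists V : nat -> X, forall k i, (i < k.*2)%N -> `|V i - v k i| <= 4 * half_pow k.
Proof.
move=> h; suff /choice[V hV] : forall i, exists V, forall k, (i < k.*2)%N ->
    `|V - v k i| <= 4 * half_pow k by exists V => k i; exact: hV.
move=> i.
have tele k l : (i < k.*2)%N -> (k <= l)%N ->
    `|v l i - v k i| <= 4 * (half_pow k - half_pow l).
  move=> ik /subnKC <-; elim: (l - k)%N => [|m IH].
    by rewrite addn0 !subrr normr0 mulr0.
  rewrite addnS half_powS -[_ - _](subrKA (v (k + m)%N i)).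
  apply: le_trans (ler_normD _ _) _.
  have := h (k + m)%N i ltac:(apply: leq_trans ik _; by rewrite leq_double leq_addr).
  lra.
have tele' k l : (i < k.*2)%N -> (i < l.*2)%N ->
    `|v k i - v l i| <= 4 * half_pow k + 4 * half_pow l.
  move=> ik il; have hk := half_pow_gt0 k; have hl := half_pow_gt0 l.
  have [kl|/ltnW lk] := leqP k l.
    rewrite distrC; have := tele _ _ ik kl; lra.
  have := tele _ _ il lk; lra.
have [e e0|e x e' x' [k [ik -> ke]] [l [il -> le]]|V hV] := @banach_limit R X
  (fun e x => exists k, [/\ (i < k.*2)%N, x = v k i & 4 * half_pow k <= e]).
- have [K hK] := half_pow_small (divr_gt0 e0 (ltr0n R 4)).
  exists (v (K + i.+1)%N i), (K + i.+1)%N; split=> //.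
    by rewrite -addnn; apply: ltn_addl; rewrite addnS ltnS leq_addl.
  by have := hK (K + i.+1)%N (leq_addr _ _); rewrite ler_pdivlMr// mulrC.
- have := tele' _ _ ik il; lra.
- by exists V => k ik; apply: hV; exists k.
Qed.

(** Stage k has 2k vectors on each side, corresponding within 2^-k, and it moves
    the vectors of the previous stage by at most twice the previous error. In the
    limit the correspondence is isometric. The limits of the vectors inserted for
    [g k] and [h k] stay within 4 2^-k of them, hence span dense subspaces as soon
    as late terms of g and h approximate every vector. *)
Lemma gurarij_unique (G H : completeNormedModType R) (g : nat -> G) (h : nat -> H) :
  gurarij G -> gurarij H ->
  (forall x e, 0 < e -> forall K, exists2 k, (K <= k)%N & `|x - g k| <= e) ->
  (forall y e, 0 < e -> forall K, exists2 k, (K <= k)%N & `|y - h k| <= e) ->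
  isometrically_isomorphic G H.
Proof.
move=> hG hH dg dh.
pose St := ((nat -> G) * (nat -> H))%type.
pose good (k : nat) (s : St) := eps_close k.*2 (half_pow k) s.1 s.2.
have step (ks : nat * St) : exists s' : St, good ks.1 ks.2 -> [/\ good ks.1.+1 s',
    forall i, (i < ks.1.*2)%N -> `|s'.1 i - ks.2.1 i| <= 2 * half_pow ks.1 /\
       `|s'.2 i - ks.2.2 i| <= 2 * half_pow ks.1,
    `|s'.1 ks.1.*2 - g ks.1| <= 2 * half_pow ks.1 &
    `|s'.2 ks.1.*2.+1 - h ks.1| <= 2 * half_pow ks.1].
  case: ks => k [v w] /=; have [gd|ngd] := pselect (good k (v, w)); last by exists (v, w).
  have [v' [w' [h1 h2 h3 h4]]] :=
    back_and_forth_step (g k) (h k) hG hH (half_pow_gt0 k) gd.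
  by exists (v', w') => _; split=> //; rewrite /good doubleS half_powS.
have [f hf] := choice step.
pose s := fix s k : St := if k is j.+1 then f (j, s j) else (fun=> 0, fun=> 0).
have sg k : good k (s k).
  elim: k => [|k IH]; last by have [] := hf (k, s k) IH.
  by move=> c; rewrite /= !lc0 !normr0 subrr normr0 mulr_ge0// ?l1_ge0// ltW ?half_pow_gt0.
have ss k := hf (k, s k) (sg k).
have [V hV] : exists V : nat -> G, forall k i, (i < k.*2)%N ->
    `|V i - (s k).1 i| <= 4 * half_pow k.
  by apply: telescoped_limit => k i ik; have [_ /(_ i ik)[]] := ss k.
have [W hW] : exists W : nat -> H, forall k i, (i < k.*2)%N ->
    `|W i - (s k).2 i| <= 4 * half_pow k.
  by apply: telescoped_limit => k i ik; have [_ /(_ i ik)[]] := ss k.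
have VWk k : eps_close k.*2 (9 * half_pow k) V W.
  have -> : 9 * half_pow k = 4 * half_pow k + (half_pow k + 4 * half_pow k) by ring.
  apply: eps_close_trans (eps_close_perturb (hV k)) _.
  apply: eps_close_trans (sg k) (eps_close_sym (eps_close_perturb (hW k))).
have VW n : eps_close n 0 V W.
  move=> c; rewrite mul0r; apply/ler_addgt0Pl => e e0; rewrite addr0.
  have l0 : 0 < 9 * (l1 n c + 1) by rewrite mulr_gt0// ltr_wpDl// l1_ge0.
  have [K hK] := half_pow_small (divr_gt0 e0 l0).
  have nK : (n <= (K + n).*2)%N by rewrite -addnn -addnA addnC -addnA leq_addr.
  apply: le_trans (eps_close_le (VWk (K + n)%N) nK (lexx _) c) _.
  have := hK (K + n)%N (leq_addr _ _); rewrite ler_pdivlMr// => /(le_trans _); apply.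
  rewrite -mulrA mulrCA; have := half_pow_gt0 (K + n); have := l1_ge0 n c => l10 hp0.
  by rewrite ler_pM2l// ler_pM2l// lerDl.
have near_V k : `|V k.*2 - g k| <= 4 * half_pow k.
  rewrite -[_ - _](subrKA ((s k.+1).1 k.*2)); apply: le_trans (ler_normD _ _) _.
  have [_ _ h1 _] := ss k; have := hV k.+1 k.*2; rewrite doubleS half_powS.
  move=> /(_ (leqW (leqnn _))); rewrite -[s k.+1]/(f (k, s k)) /= in h1 *; lra.
have near_W k : `|W k.*2.+1 - h k| <= 4 * half_pow k.
  rewrite -[_ - _](subrKA ((s k.+1).2 k.*2.+1)); apply: le_trans (ler_normD _ _) _.
  have [_ _ _ h1] := ss k; have := hW k.+1 k.*2.+1; rewrite doubleS half_powS.
  move=> /(_ (leqnn _)); rewrite -[s k.+1]/(f (k, s k)) /= in h1 *; lra.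
apply: (isometry_of_dense VW).
- move=> x e e0; have e5 : 0 < e / 5 by rewrite divr_gt0.
  have [K hK] := half_pow_small e5; have [k kK hk] := dg x _ e5 K.
  exists k.*2.+1, (delta R k.*2); rewrite lc_delta//.
  rewrite -[_ - _](subrKA (g k)); apply: le_trans (ler_normD _ _) _.
  by have := near_V k; rewrite distrC; have := hK k kK; lra.
- move=> x e e0; have e5 : 0 < e / 5 by rewrite divr_gt0.
  have [K hK] := half_pow_small e5; have [k kK hk] := dh x _ e5 K.
  exists k.*2.+2, (delta R k.*2.+1); rewrite lc_delta//.
  rewrite -[_ - _](subrKA (h k)); apply: le_trans (ler_normD _ _) _.
  by have := near_W k; rewrite distrC; have := hK k kK; lra.
Qed.

Lemma separable_enum (X : completeNormedModType R) : separable X ->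
  exists g : nat -> X, forall x e, 0 < e -> forall K,
    exists2 k, (K <= k)%N & `|x - g k| <= e.
Proof.
move=> [A /countable_injP[f finj] dA].
have [t ht] := @recurrent_enum nat.
have [a ha] : exists a : nat -> X, forall x, A x -> a (f x) = x.
  have /choice[a ha] : forall m, exists y, (exists2 x, A x & f x = m) ->
      A y /\ f y = m.
    move=> m; have [[x Ax fx]|no] := pselect (exists2 x, A x & f x = m).
      by exists x.
    by exists 0.
  exists a => x Ax; have [Aa fa] := ha (f x) (ex_intro2 _ _ x Ax erefl).
  by apply: finj; rewrite ?inE.
exists (fun k => if t k is Some m then a m else 0) => x e e0 K.
have [y [/= xy Ay]] : (ball x e `&` A) !=set0.
  by apply: dA; [exists x; exact: ballxx|exact: ball_open].
have [k Kk tk] := ht (f y) K.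
exists k => //; rewrite tk ha//; apply: ltW.
by move: xy; rewrite -ball_normE.
Qed.

End Uniqueness.

(** * Finite control of seminorms *)

Section Nets.
Variable R : realType.

(** Bounded by the l1 norm of the first n coefficients, such a seminorm depends on
    these coefficients only. *)
Record lip_seminorm n (B : R) (p : (nat -> R) -> R) : Prop := LipSeminorm {
  lip_sn : seminorm p;
  lip_le : forall c, p c <= B * l1 n c }.

Lemma lip_sub n B p c c' : lip_seminorm n B p ->
  p c - p c' <= B * l1 n (fun i => c i - c' i).
Proof.
move=> hp; apply: le_trans (lip_le hp (c - c')); rewrite lerBlDl.
by apply: le_trans (sn_add (lip_sn hp) _ _); rewrite addrC subrK.
Qed.

Lemma lip_dist n B p c c' : lip_seminorm n B p ->
  `|p c - p c'| <= B * l1 n (fun i => c i - c' i).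
Proof.
move=> hp; rewrite ler_norml lip_sub// andbT lerNl opprB.
rewrite (_ : l1 n _ = l1 n (fun i => c' i - c i)) ?lip_sub//.
by apply: eq_bigr => i _; rewrite distrC.
Qed.

Lemma lip_ext n B p c c' : lip_seminorm n B p ->
  (forall i, (i < n)%N -> c i = c' i) -> p c = p c'.
Proof.
move=> hp h; apply/eqP; rewrite -subr_eq0 -normr_le0; apply: le_trans (lip_dist _ _ hp) _.
by rewrite /l1 big1 ?mulr0// => i _; rewrite h// subrr normr0.
Qed.

Lemma lip_lc (V : normedModType R) n (u : nat -> V) B :
  (forall i, (i < n)%N -> `|u i| <= B) -> lip_seminorm n B (fun c => `|lc n c u|).
Proof.
by move=> h; split; [exact: lc_seminorm (norm_seminorm V)|move=> c; exact: norm_lc_le].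
Qed.

(** The index k * L + l pairs the point k of a net for the first m coordinates with
    the point l of a net of [-1, 1]. *)
Lemma cube_net m (e : R) : 0 < e -> exists K (A : nat -> nat -> R),
  (forall k i, (k < K)%N -> `|A k i| <= 1) /\
  forall c, (forall i, (i < m)%N -> `|c i| <= 1) ->
    exists2 k, (k < K)%N & forall i, (i < m)%N -> `|c i - A k i| <= e.
Proof.
move=> e0.
have [L [B [B1 hB]]] : exists L (B : nat -> R),
    (forall l, (l < L)%N -> `|B l| <= 1) /\
    forall x, `|x| <= 1 -> exists2 l, (l < L)%N & `|x - B l| <= e.
  exists (Num.trunc (2 / e)).+1, (fun l => l%:R * e - 1); split=> [l|x].
    rewrite ltnS truncn_ge_nat ?divr_ge0 ?(ltW e0)// ler_pdivlMr// => h.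
    by rewrite ler_norml; apply/andP; split; [rewrite lerBrDl subrr mulr_ge0// ltW|lra].
  rewrite ler_norml => /andP[x1 x2].
  have y0 : 0 <= (x + 1) / e by rewrite divr_ge0 ?(ltW e0)//; lra.
  exists (Num.trunc ((x + 1) / e)).
    rewrite ltnS truncn_ge_nat ?divr_ge0 ?(ltW e0)//.
    apply: le_trans (_ : (x + 1) / e <= _); first by rewrite truncn_le.
    by rewrite ler_pM2r ?invr_gt0//; lra.
  have /andP[h1 h2] := truncn_itv y0; move: h1 h2.
  rewrite ler_pdivlMr// ltr_pdivrMr// -natr1 mulrDl mul1r => h1 h2.
  by rewrite ler_norml; apply/andP; split; lra.
elim: m => [|m [K [A [A1 hA]]]].
  exists 1%N, (fun _ _ => 0); split=> [k i _|c _]; first by rewrite normr0.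
  by exists 0%N.
exists (K * L)%N, (fun j i => if (i < m)%N then A (j %/ L)%N i else B (j %% L)%N).
split=> [k i kKL|c hc].
  have L0 : (0 < L)%N by case: (L) kKL; rewrite ?muln0.
  by case: ifP => _; [apply: A1; rewrite ltn_divLR|apply: B1; rewrite ltn_mod].
have [k kK hk] := hA c (fun i hi => hc i (leqW hi)).
have [l lL hl] := hB _ (hc m (ltnSn m)).
have L0 : (0 < L)%N by exact: leq_ltn_trans lL.
exists (k * L + l)%N; first by rewrite -ltn_divLR// divnMDl// divn_small// addn0.
move=> i; rewrite ltnS leq_eqVlt => /orP[/eqP ->|hi].
  by rewrite ltnn modnMDl modn_small.
by rewrite hi divnMDl// divn_small// addn0 hk.
Qed.

(** By homogeneity it suffices to compare f and g on vectors of l1 norm 1, where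
    both are Lipschitz and a point of the net is near. *)
Lemma net_control m K (A : nat -> nat -> R) (e : R) :
  (forall c, (forall i, (i < m)%N -> `|c i| <= 1) ->
    exists2 k, (k < K)%N & forall i, (i < m)%N -> `|c i - A k i| <= e) ->
  forall B d f g, 0 <= B -> lip_seminorm m B f -> lip_seminorm m B g ->
    (forall k, (k < K)%N -> `|f (A k) - g (A k)| <= d) ->
    forall c, `|f c - g c| <= (d + 2 * B * m%:R * e) * l1 m c.
Proof.
move=> hA B d f g B0 hf hg fg c.
have [l0|lN0] := eqVneq (l1 m c) 0.
  have := lip_le hf c; have := lip_le hg c; rewrite l0 !mulr0.
  have := sn_ge0 (lip_sn hf) c; have := sn_ge0 (lip_sn hg) c.
  by move=> ? ? ? ?; rewrite ler_norml; apply/andP; split; lra.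
have l_gt0 : 0 < l1 m c by rewrite lt0r lN0 l1_ge0.
pose c' : nat -> R := (l1 m c)^-1 *: c.
have -> : c = l1 m c *: c' by rewrite scalerA mulfV// scale1r.
rewrite (sn_scale (lip_sn hf)) (sn_scale (lip_sn hg)) -mulrBr normrM normr_id.
rewrite (_ : l1 m (l1 m c *: c') = l1 m c); last first.
  by apply: eq_bigr => i _; rewrite /c' scalerA mulfV// scale1r.
rewrite (ger0_norm (l1_ge0 _ _)) mulrC ler_pM2r//.
have [|k kK hk] := hA c'.
  move=> i im; rewrite -[c' i]/((l1 m c)^-1 * c i) normrM normfV (gtr0_norm l_gt0).
  by rewrite ler_pdivrMl// mulr1 le_l1.
have h1 : l1 m (fun i => c' i - A k i) <= m%:R * e.
  apply: le_trans (ler_sum _ (fun (i : 'I_m) _ => hk i (ltn_ord i))) _.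
  by rewrite sumr_const card_ord mulr_natl.
have h2 := ler_wpM2l B0 h1.
have := lip_dist c' (A k) hf; have := lip_dist c' (A k) hg; have := fg k kK.
rewrite !ler_norml => /andP[? ?] /andP[? ?] /andP[? ?]; apply/andP; split; lra.
Qed.

End Nets.

(** * Existence of a separable Gurarij space *)

Section Existence.
Variable R : realType.

(** Coefficients over e_0, ..., e_(m-1), z become coefficients over the first k
    basis vectors with z in position k. *)
Definition emb m k (c : nat -> R) : nat -> R := fun i => trunc m c i + c m * delta R k i.

Lemma lc_emb (V : lmodType R) m k c (u : nat -> V) : (m <= k)%N ->
  lc k.+1 (emb m k c) u = lc m.+1 c (ext m u (u k)).
Proof.
by move=> mk; rewrite (lc_add _ (trunc m c)) lc_trunc ?leqW// lc_scale lc_delta// lc_ext.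
Qed.

Let code := (nat * nat * nat * seq nat)%type.

Lemma nets_exist : exists (K : nat -> nat -> nat) (A : nat -> nat -> nat -> nat -> R),
  forall m q c, (forall i, (i < m)%N -> `|c i| <= 1) ->
  exists2 k, (k < K m q)%N & forall i, (i < m)%N -> `|c i - A m q k i| <= q.+1%:R^-1.
Proof.
have h (mq : nat * nat) : exists KA : nat * (nat -> nat -> R),
    forall c, (forall i, (i < mq.1)%N -> `|c i| <= 1) ->
    exists2 k, (k < KA.1)%N & forall i, (i < mq.1)%N -> `|c i - KA.2 k i| <= mq.2.+1%:R^-1.
  have [K [A [_ hA]]] := @cube_net R mq.1 mq.2.+1%:R^-1 ltac:(by rewrite invr_gt0).
  by exists (K, A).
have [f hf] := choice h.
by exists (fun m q => (f (m, q)).1), (fun m q => (f (m, q)).2) => m q; exact: hf (m, q).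
Qed.

Section Chain.
Variables (K : nat -> nat -> nat) (A : nat -> nat -> nat -> nat -> R).
Variable t : nat -> option code.

(** A code prescribes the seminorm on combinations of e_0, ..., e_(m-1) and e_k
    with coefficients in a finite net, rounded to multiples of 1 / (q + 1), together
    with a bound on e_k. There are countably many codes. *)
Definition matches k (p : (nat -> R) -> R) (x : code) :=
  let: (m, q, B, r) := x in
  [/\ (m <= k)%N, p (delta R k) <= B%:R & forall j, (j < K m.+1 q)%N ->
    `|p (emb m k (A m.+1 q j)) - (nth 0%N r j)%:R / q.+1%:R| <= q.+1%:R^-1].

Definition extends k (p p' : (nat -> R) -> R) :=
  (exists2 B, 0 <= B & lip_seminorm k.+1 B p') /\
  forall c, p' (trunc k c) = p c.

(** The extension of p by the new vector e_k follows the code [t k] if some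
    extension does. Which one is immaterial: where a code matters, a Banach space
    containing e_0, ..., e_(k-1) shows that it can be followed. *)
Definition chain_step k p p' := extends k p p' /\
  forall x, t k = Some x -> (exists2 p'', extends k p p'' & matches k p'' x) ->
    matches k p' x.

Lemma chain_step_ex k p : (exists2 B, 0 <= B & lip_seminorm k B p) ->
  exists p', chain_step k p p'.
Proof.
move=> [B B0 hp].
have pp : extends k p p.
  split.
    exists B => //; split=> [|c]; first exact: lip_sn hp.
    by apply: le_trans (lip_le hp c) _; rewrite ler_wpM2l// l1S lerDl.
  by move=> c; apply: lip_ext hp _ => i ik; rewrite /trunc ik.
case e : (t k) => [x|]; last by exists p; split=> // x; rewrite e.
have [[p' h1 h2]|no] := pselect (exists2 p'', extends k p p'' & matches k p'' x).
  by exists p'; split=> // y; rewrite e => -[<-].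
by exists p; split=> // y; rewrite e => -[<-] /no.
Qed.

Lemma chain_exists : exists p : nat -> (nat -> R) -> R,
  (forall k, exists2 B, 0 <= B & lip_seminorm k B (p k)) /\
  forall k, chain_step k (p k) (p k.+1).
Proof.
have step (kp : nat * ((nat -> R) -> R)) : exists p',
    (exists2 B, 0 <= B & lip_seminorm kp.1 B kp.2) -> chain_step kp.1 kp.2 p'.
  have [/chain_step_ex[p' h]|no] := pselect (exists2 B, 0 <= B & lip_seminorm kp.1 B kp.2).
    by exists p'.
  by exists kp.2.
have [f hf] := choice step.
pose p := fix p k : (nat -> R) -> R := if k is j.+1 then f (j, p j) else fun=> 0.
have pl k : exists2 B, 0 <= B & lip_seminorm k B (p k).
  elim: k => [|k IH]; last by have [[]] := hf (k, p k) IH.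
  exists 0 => //; split; first by split=> [x y|a x] /=; rewrite ?addr0 ?mulr0.
  by move=> c; rewrite mul0r.
by exists p; split=> // k; exact: hf (k, p k) (pl k).
Qed.

End Chain.

Lemma rat_approx (x e : R) : 0 < e -> exists r : rat, `|x - ratr r| <= e.
Proof.
move=> e0; have [r] := @rat_in_itvoo R (x - e) (x + e) ltac:(lra).
rewrite in_itv /= => /andP[h1 h2]; exists r.
by rewrite ler_norml; apply/andP; split; lra.
Qed.

Lemma floor_approx (x : R) q : 0 <= x ->
  `|x - (Num.trunc (x * q.+1%:R))%:R / q.+1%:R| <= q.+1%:R^-1.
Proof.
move=> x0; have h0 : 0 <= x * q.+1%:R by rewrite mulr_ge0.
have /andP[] := truncn_itv h0; set T := Num.trunc _.
rewrite -[T.+1%:R]natr1 -ler_pdivrMr// -ltr_pdivlMr// mulrDl mul1r => h1 h2.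
by rewrite ger0_norm ?subr_ge0// lerBlDl ltW.
Qed.

Lemma rational_span_separable (G : completeNormedModType R) (e : nat -> G) :
  (forall x d, 0 < d -> exists n c, `|x - lc n c e| <= d) -> separable G.
Proof.
move=> de; pose F (s : seq rat) := lc (size s) (fun i => ratr (nth 0 s i)) e.
pose S := [set x | exists s, x = F s].
exists S.
  have [f hf] : exists f : G -> seq rat, forall x, S x -> x = F (f x).
    have /choice[f hf] : forall x : G, exists s, S x -> x = F s.
      move=> x; have [[s ->]|no] := pselect (S x); first by exists s.
      by exists [::].
    by exists f.
  apply/countable_injP; exists (fun x => pickle (f x)) => x y; rewrite !inE.
  by move=> /hf {2}-> /hf {2}-> /(pcan_inj pickleK) ->.
move=> O [x Ox] oO.
have /nbhs_ballP[d /= d0 dO] : nbhs x O by exact: open_nbhs_nbhs.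
have d4 : 0 < d / 4 by rewrite divr_gt0.
have [n [c hc]] := de x _ d4.
pose B := \sum_(i < n) `|e i|.
have B0 : 0 <= B by exact: sumr_ge0.
have eB i : (i < n)%N -> `|e i| <= B.
  by move=> iN; rewrite /B (bigD1 (Ordinal iN))//= lerDl sumr_ge0.
have nB : 0 < n%:R * B + 1 by rewrite ltr_wpDl// mulr_ge0.
have /choice[r hr] : forall i, exists r : rat, `|c i - ratr r| <= d / 4 / (n%:R * B + 1).
  by move=> i; apply: rat_approx; rewrite divr_gt0.
exists (F (mkseq r n)); split; last by exists (mkseq r n).
apply: dO; rewrite -ball_normE /=.
have -> : F (mkseq r n) = lc n (fun i => ratr (r i)) e.
  by rewrite /F size_mkseq; apply: eq_lc => // i hi; rewrite nth_mkseq.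
have h1 : `|lc n c e - lc n (fun i => ratr (r i)) e| <= d / 4.
  rewrite -lc_sub; apply: le_trans (norm_lc_le _ eB) _.
  have h : l1 n (fun i => c i - ratr (r i)) <= n%:R * (d / 4 / (n%:R * B + 1)).
    apply: le_trans (ler_sum _ (fun (i : 'I_n) _ => hr i)) _.
    by rewrite sumr_const card_ord [leRHS]mulr_natl.
  apply: le_trans (ler_wpM2l B0 h) _; rewrite mulrA [B * _]mulrC.
  by apply: mul_div1_le => //; rewrite mulr_ge0.
rewrite -(subrKA (lc n c e)); apply: le_lt_trans (ler_normD _ _) _; lra.
Qed.

(** [one_point] restricted to families that are initial segments of a fixed
    sequence. *)
Definition one_point_seq (G : completeNormedModType R) (e : nat -> G) :=
  forall (Z : completeNormedModType R) (h : {linear G -> Z}) m (z : Z) (d : R),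
  isometric h -> 0 < d ->
  exists y, eps_close m.+1 d (ext m (h \o e) z) (ext m e y).

Lemma common_approx (G : completeNormedModType R) (e : nat -> G) :
  (forall x d, 0 < d -> exists n c, `|x - lc n c e| <= d) ->
  forall n (v : nat -> G) d, 0 < d -> exists N (a : nat -> nat -> R),
    forall i, (i < n)%N -> `|v i - lc N (a i) e| <= d.
Proof.
move=> de n v d d0.
have /choice[s hs] : forall i, exists Nc : nat * (nat -> R),
    `|v i - lc Nc.1 Nc.2 e| <= d.
  by move=> i; have [N [c h]] := de (v i) d d0; exists (N, c).
exists (\max_(i < n) (s i).1)%N, (fun i => trunc (s i).1 (s i).2) => i hi.
by rewrite lc_trunc// (leq_bigmax (Ordinal hi)).
Qed.

(** Replace v by nearby combinations of the sequence e; M bounds the l1 norms that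
    this change of families produces. *)
Lemma one_point_of_seq (G : completeNormedModType R) (e : nat -> G) :
  (forall x d, 0 < d -> exists n c, `|x - lc n c e| <= d) ->
  one_point_seq e -> one_point G.
Proof.
move=> de he Z h n v z d hh d0; have d4 : 0 < d / 4 by rewrite divr_gt0.
have [N [a ha]] := common_approx de n v d4.
pose M := \sum_(i < n) \sum_(j < N) `|a i j|.
have M0 : 0 <= M by apply: sumr_ge0 => i _; exact: sumr_ge0.
have M1 : 0 < M + 1 by rewrite ltr_wpDl.
have [y hy] := he Z h N z (d / 2 / (M + 1)) hh ltac:(by rewrite divr_gt0// divr_gt0).
exists y; pose w i := lc N (a i) e.
have -> : d = d / 4 + (d / 2 + d / 4) by field.
apply: eps_close_trans (_ : eps_close _ _ _ (ext n (h \o w) z)) _.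
  apply: eps_close_perturb => i; rewrite ltnS leq_eqVlt /ext => /orP[/eqP ->|hi].
    by rewrite ltnn subrr normr0 ltW.
  by rewrite hi /= -raddfB hh ha.
apply: eps_close_trans (_ : eps_close _ _ _ (ext n w y)) _; last first.
  apply: eps_close_perturb => i; rewrite ltnS leq_eqVlt /ext => /orP[/eqP ->|hi].
    by rewrite ltnn subrr normr0 ltW.
  by rewrite hi /= distrC ha.
move=> c; pose c' j := if (j < N)%N then \sum_(i < n) c i * a i j else c n.
have lcE (V : lmodType R) (u : nat -> V) x :
    lc n.+1 c (ext n (fun i => lc N (a i) u) x) = lc N.+1 c' (ext N u x).
  rewrite !lc_ext lc_lc {2}/c' ltnn; congr (_ + _).
  by apply: eq_lc => // j hj; rewrite /c' hj.
have -> : lc n.+1 c (ext n (h \o w) z) = lc N.+1 c' (ext N (h \o e) z).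
  rewrite -lcE; apply: eq_lc => // i hi; rewrite /ext; case: ifP => // _.
  exact: linear_lc.
rewrite (lcE G); apply: le_trans (hy c') _.
rewrite -mulrA ler_pM2l; last exact: divr_gt0.
rewrite ler_pdivrMl//.
rewrite !l1S {2}/c' ltnn mulrDr; apply: lerD; last first.
  by rewrite mulrDl mul1r lerDr mulr_ge0.
apply: le_trans (_ : l1 n c * M <= _); last first.
  by rewrite mulrC ler_wpM2r ?l1_ge0// lerDl.
rewrite /l1 (eq_bigr (fun j : 'I_N => `|\sum_(i < n) c i * a i j|)); last first.
  by move=> j _; rewrite /c' ltn_ord.
apply: le_trans (_ : \sum_(j < N) \sum_(i < n) `|c i| * `|a i j| <= _).
  apply: ler_sum => j _; apply: le_trans (ler_norm_sum _ _ _) _.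
  by apply: ler_sum => i _; rewrite normrM.
rewrite exchange_big /= mulr_sumr; apply: ler_sum => i _; rewrite -mulr_sumr.
by rewrite ler_wpM2r ?sumr_ge0//; exact: (le_l1 c (ltn_ord i)).
Qed.

(** Complete the polynomials for the union of a chain of seminorms p_k, where p_k
    lives on the span of X^0, ..., X^(k-1). Given a point z over an initial segment
    of the X^i, round the norms of its combinations to a code; this code is treated
    at a late stage k, where the ambient space shows that it can be followed, and
    then X^k behaves like z. *)
Lemma separable_gurarij_exists : exists2 G : completeNormedModType R,
  gurarij G & separable G.
Proof.
have [K [A netA]] := nets_exist.
have [t ht] := recurrent_enum code.
have [p [plip pstep]] := chain_exists K A t.
have pext k c : p k.+1 (trunc k c) = p k c by have [[_]] := pstep k.
have psup m n (c : nat -> R) : (forall i, (n <= i)%N -> c i = 0) -> (n <= m)%N ->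
    p m c = p n c.
  move=> hc /subnKC <-; elim: (m - n)%N => [|k IH]; first by rewrite addn0.
  rewrite addnS -IH -(pext (n + k)%N c); congr (p _ _); apply/funext => i.
  rewrite /trunc; case: ltnP => // h; apply: hc; exact: leq_trans (leq_addr _ _) h.
pose co (x : {poly R}) : nat -> R := fun i => x`_i.
have co0 (x : {poly R}) i : (size x <= i)%N -> co x i = 0 by exact: nth_default.
pose P (x : {poly R}) := p (size x) (co x).
have PE m (x : {poly R}) : (size x <= m)%N -> P x = p m (co x).
  by move=> h; apply: esym; apply: psup h; exact: co0.
have sP : seminorm P.
  split=> [x y|a x].
    pose m := maxn (size x) (size y).
    have [B _ [hp _]] := plip m.
    rewrite (PE m) ?size_polyD// (PE m x) ?leq_maxl// (PE m y) ?leq_maxr//.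
    apply: le_trans (sn_add hp _ _); rewrite (_ : co (x + y) = co x + co y)//.
    by apply/funext => i; rewrite /co coefD.
  have [B _ [hp _]] := plip (size x).
  rewrite (PE (size x)) ?size_scale_leq// -(sn_scale hp).
  rewrite (_ : co (a *: x) = a *: co x)//.
  by apply/funext => i; rewrite /co coefZ.
have [G [i [ni dense]]] := seminorm_completion sP.
pose e k : G := i 'X^k.
have ie m c : lc m c e = i (\poly_(j < m) c j).
  by rewrite poly_def linear_sum; apply: eq_bigr => j _; rewrite linearZ.
have ne m c : `|lc m c e| = p m c.
  rewrite ie ni (PE m) ?size_poly//; have [B _ hp] := plip m.
  by apply: lip_ext hp _ => j jm; rewrite /co coef_poly jm.
have de x d : 0 < d -> exists n c, `|x - lc n c e| <= d.
  move=> /(dense x)[v hv]; exists (size v), (co v); rewrite ie.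
  by rewrite [\poly_(_ < _) _](_ : _ = v)//; exact: coefK.
exists G; last exact: rational_span_separable de.
apply: one_point_gurarij; apply: (one_point_of_seq de).
move=> Z h m z d hh d0.
pose u := ext m (h \o e) z.
pose f c := `|lc m.+1 c u|.
pose b := \sum_(j < m.+1) `|u j|.
pose B := (Num.trunc b).+1.
have uB j : (j < m.+1)%N -> `|u j| <= B%:R.
  move=> hj; apply: le_trans (ltW (truncnS_gt b)).
  by rewrite /b (bigD1 (Ordinal hj))//= lerDl sumr_ge0.
have fl : lip_seminorm m.+1 B%:R f by exact: lip_lc.
(* rounding errors and [net_control] will add up to L / (q + 1) *)
pose L := 2 + 2 * B%:R * m.+1%:R : R.
have L0 : 0 < L by rewrite ltr_wpDr// !mulr_ge0.
pose q := Num.trunc (L / d).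
have qd : L / q.+1%:R <= d.
  by rewrite ler_pdivrMr// mulrC -ler_pdivrMr// ltW// truncnS_gt.
pose r := mkseq (fun j => Num.trunc (f (A m.+1 q j) * q.+1%:R)) (K m.+1 q).
have fr j : (j < K m.+1 q)%N ->
    `|f (A m.+1 q j) - (nth 0%N r j)%:R / q.+1%:R| <= q.+1%:R^-1.
  move=> hj; rewrite nth_mkseq//.
  by apply: floor_approx; exact: normr_ge0.
have [k mk tk] := ht (m, q, B, r) m.
have [_ /(_ _ tk) pm] := pstep k.
have hm : matches K A k (p k.+1) (m, q, B, r).
  apply: pm; exists (fun c => `|lc k.+1 c (ext k (h \o e) z)|).
    split.
      pose b' := \sum_(j < k.+1) `|ext k (h \o e) z j|.
      exists b'; first exact: sumr_ge0.
      apply: lip_lc => j hj.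
      by rewrite /b' (bigD1 (Ordinal hj))//= lerDl sumr_ge0.
    move=> c; rewrite lc_trunc// -ne -hh linear_lc; congr (`|_|).
    by apply: eq_lc => // j jk; rewrite /ext jk.
  have embE c : `|lc k.+1 (emb m k c) (ext k (h \o e) z)| = f c.
    rewrite lc_emb//; congr (`|_|); apply: eq_lc => // j jm; rewrite /u /ext ltnn.
    by case: ifP => // jm'; rewrite (leq_trans jm').
  split=> //; last by move=> j hj; rewrite embE fr.
  rewrite lc_delta// /ext ltnn.
  by have := uB m (ltnSn m); rewrite /u /ext ltnn.
have [_ hB hr] := hm.
exists (e k).
pose g c := `|lc m.+1 c (ext m e (e k))|.
have gE c : g c = p k.+1 (emb m k c) by rewrite /g -lc_emb// ne.
have gl : lip_seminorm m.+1 B%:R g.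
  apply: lip_lc => j; rewrite ltnS leq_eqVlt /ext => /orP[/eqP ->|hj].
    by rewrite ltnn -(lc_delta e (ltnSn k)) ne.
  by have := uB j (leqW hj); rewrite hj /u /ext hj /= hh.
move=> c; apply: le_trans (net_control (netA m.+1 q) (d := 2 / q.+1%:R) _ fl gl _ c) _ => //.
  move=> j hj; apply: le_trans (ler_distD ((nth 0%N r j)%:R / q.+1%:R) _ _) _.
  have -> : 2 / q.+1%:R = q.+1%:R^-1 + q.+1%:R^-1 :> R by rewrite mulr2n mulrDl mul1r.
  by apply: lerD; [exact: fr|rewrite distrC gE hr].
rewrite ler_wpM2r ?l1_ge0//; apply: le_trans qd.
by rewrite -mulrDl.
Qed.

End Existence.

(** * Formulas, embeddings and quantifier elimination *)

Section Formulas.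
Variable R : realType.
Implicit Types M N : ball_structure R.

Lemma env_cons_map (A B : Type) (h : A -> B) n (x : A) (v : 'I_n -> A) :
  h \o env_cons x v = env_cons (h x) (h \o v).
Proof. by apply/funext => i; rewrite /env_cons /=; case: unlift. Qed.

Lemma env_cons0 (A : Type) n (x : A) (v : 'I_n -> A) : env_cons x v ord0 = x.
Proof. by rewrite /env_cons unlift_none. Qed.

Lemma env_cons_lift (A : Type) n (x : A) (v : 'I_n -> A) i :
  env_cons x v (lift ord0 i) = v i.
Proof. by rewrite /env_cons liftK. Qed.

Lemma env_consE (A : Type) n (v : 'I_n.+1 -> A) :
  v = env_cons (v ord0) (fun i => v (lift ord0 i)).
Proof.
by apply/funext => i; rewrite /env_cons; case: unliftP => [j ->|->].
Qed.

Lemma env0_unique (A : Type) (v w : 'I_0 -> A) : v = w.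
Proof. by apply/funext => -[]. Qed.

Lemma eval_itv M n (phi : formula R n) (v : 'I_n -> M) : 0 <= eval phi v <= 1.
Proof.
elim: phi v => {n} [n t|n t s|n k u args IH|n psi IH|n psi IH] v /=.
- exact: s_norm_itv.
- by rewrite mdist_ge0 s_dist_le1.
- by apply: conn_itv => i; rewrite mxE.
- have ub : ubound (range (fun x => eval psi (env_cons x v))) 1.
    by move=> _ [x _ <-]; have /andP[] := IH (env_cons x v).
  apply/andP; split; last first.
    by apply: ge_sup ub; exists (eval psi (env_cons (s_zero M) v)), (s_zero M).
  have /andP[h _] := IH (env_cons (s_zero M) v); apply: le_trans h _.
  by apply: ub_le_sup; [exists 1|exists (s_zero M)].
- have lb : lbound (range (fun x => eval psi (env_cons x v))) 0.
    by move=> _ [x _ <-]; have /andP[] := IH (env_cons x v).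
  apply/andP; split.
    by apply: lb_le_inf lb; exists (eval psi (env_cons (s_zero M) v)), (s_zero M).
  have /andP[_ h] := IH (env_cons (s_zero M) v); apply: le_trans h.
  by apply: ge_inf; [exists 0|exists (s_zero M)].
Qed.

Lemma eval_ge0 M n (phi : formula R n) (v : 'I_n -> M) : 0 <= eval phi v.
Proof. by have /andP[] := eval_itv phi v. Qed.

Lemma le_sup_eval M n (psi : formula R n.+1) (v : 'I_n -> M) x :
  eval psi (env_cons x v) <= eval (FSup psi) v.
Proof.
apply: ub_le_sup; last by exists x.
by exists 1 => _ [y _ <-]; have /andP[] := eval_itv psi (env_cons y v).
Qed.

Lemma sup_eval_le M n (psi : formula R n.+1) (v : 'I_n -> M) r :
  (forall x, eval psi (env_cons x v) <= r) -> eval (FSup psi) v <= r.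
Proof.
move=> h; apply: ge_sup => [|_ [x _ <-]//].
by exists (eval psi (env_cons (s_zero M) v)), (s_zero M).
Qed.

Lemma inf_eval_le M n (psi : formula R n.+1) (v : 'I_n -> M) x :
  eval (FInf psi) v <= eval psi (env_cons x v).
Proof.
apply: ge_inf; last by exists x.
by exists 0 => _ [y _ <-]; exact: eval_ge0.
Qed.

Lemma le_inf_eval M n (psi : formula R n.+1) (v : 'I_n -> M) r :
  (forall x, r <= eval psi (env_cons x v)) -> r <= eval (FInf psi) v.
Proof.
move=> h; apply: lb_le_inf => [|_ [x _ <-]//].
by exists (eval psi (env_cons (s_zero M) v)), (s_zero M).
Qed.

Lemma inf_eval_approx M n (psi : formula R n.+1) (v : 'I_n -> M) e : 0 < e ->
  exists x, eval psi (env_cons x v) <= eval (FInf psi) v + e.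
Proof.
move=> e0; apply: contrapT => /forallNP h.
suff : eval (FInf psi) v + e <= eval (FInf psi) v by rewrite gerDl leNgt e0.
by apply: le_inf_eval => x; apply: ltW; rewrite ltNge; apply/negP.
Qed.

Section Embeddings.
Variables (M N : ball_structure R) (h : M -> N).
Hypothesis hh : is_embedding h.

Lemma term_eval_emb n (t : term R n) v : h (term_eval v t) = term_eval (h \o v) t.
Proof.
elim: t => [i||t IH|t IHt s IHs|a t IH] //=.
- exact: emb_zero.
- by rewrite (emb_opp hh) IH.
- by rewrite (emb_mid hh) IHt IHs.
- by rewrite (emb_scale hh) IH.
Qed.

Lemma qf_eval_emb n (phi : formula R n) v : quantifier_free phi ->
  eval phi (h \o v) = eval phi v.
Proof.
elim: phi v => {n} [n t|n t s|n k u args IH|n psi IH|n psi IH] v //= qf.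
- by rewrite -term_eval_emb (emb_norm hh).
- by rewrite -!term_eval_emb (emb_dist hh).
- by congr (u _); apply/rowP => i; rewrite !mxE IH.
Qed.

Lemma iso_eval n (phi : formula R n) v : bijective h ->
  eval phi (h \o v) = eval phi v.
Proof.
move=> [g hK gK].
elim: phi v => {n} [n t|n t s|n k u args IH|n psi IH|n psi IH] v //=.
- by rewrite -term_eval_emb (emb_norm hh).
- by rewrite -!term_eval_emb (emb_dist hh).
- by congr (u _); apply/rowP => i; rewrite !mxE IH.
- congr (sup _); apply/seteqP; split => _ [x _ <-].
    by exists (g x) => //; rewrite -IH env_cons_map gK.
  by exists (h x) => //; rewrite -IH env_cons_map.
- congr (inf _); apply/seteqP; split => _ [x _ <-].
    by exists (g x) => //; rewrite -IH env_cons_map gK.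
  by exists (h x) => //; rewrite -IH env_cons_map.
Qed.

End Embeddings.

Lemma iso_models M N (h : M -> N) (T : theory R) : is_embedding h -> bijective h ->
  models M T <-> models N T.
Proof.
move=> hh hb; split=> hM phi /hM; rewrite /sentence_eval.
  by rewrite -(iso_eval hh phi _ hb) => <-; congr (eval _ _); exact: env0_unique.
by rewrite -(iso_eval hh phi _ hb) => <-; congr (eval _ _); exact: env0_unique.
Qed.

Lemma embedding_comp (M N P : ball_structure R) (h : M -> N) (g : N -> P) :
  is_embedding h -> is_embedding g -> is_embedding (g \o h).
Proof.
move=> [h1 h2 h3 h4 h5 h6] [g1 g2 g3 g4 g5 g6].
by split=> * /=; rewrite ?g1 ?h1 ?h2 ?g2 ?h3 ?g3 ?h4 ?g4 ?h5 ?g5 ?g6 ?h6.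
Qed.

Section Elementary.
Variables (T : theory R).
Hypothesis qe : eliminates_quantifiers T.

Lemma embedding_elementary M N (h : M -> N) n (phi : formula R n) v :
  models M T -> models N T -> is_embedding h -> eval phi (h \o v) = eval phi v.
Proof.
move=> hM hN hh; apply/eqP; rewrite -subr_eq0 -normr_le0.
apply/ler_addgt0Pl => e e0; rewrite addr0.
have [psi qf hpsi] := qe phi (divr_gt0 e0 (ltr0n R 2)).
have h1 := hpsi M hM v; have h2 := hpsi N hN (h \o v).
rewrite (qf_eval_emb hh v qf) in h2.
have := ler_distD (eval psi v) (eval phi (h \o v)) (eval phi v).
rewrite [`|eval psi v - _|]distrC; lra.
Qed.

(** For M < N < P with M and P models: an existential formula over M that nearly
    holds in N nearly holds in P, hence in M, as M is elementary in P. *)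
Lemma sandwich (M N P : ball_structure R) (h : M -> N) (g : N -> P) n (psi : formula R n.+1)
    (v : 'I_n -> M) x e :
  models M T -> models P T -> is_embedding h -> is_embedding g ->
  quantifier_free psi -> 0 < e ->
  exists y, eval psi (env_cons y v) <= eval psi (env_cons x (h \o v)) + e.
Proof.
move=> hM hP hh hg qf e0.
have [y hy] := inf_eval_approx psi v e0.
exists y; apply: le_trans hy _; rewrite lerD2r.
rewrite -(embedding_elementary (FInf psi) v hM hP (embedding_comp hh hg)).
apply: le_trans (inf_eval_le psi _ (g x)) _.
by rewrite -[(g \o h) \o v]/(g \o (h \o v)) -env_cons_map (qf_eval_emb hg).
Qed.

End Elementary.

Fixpoint sups n : formula R n -> formula R 0 :=
  match n return formula R n -> formula R 0 with
  | 0 => id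
  | m.+1 => fun phi => sups (FSup phi)
  end.

Lemma sups_eval M n (phi : formula R n) :
  sentence_eval M (sups phi) = 0 <-> forall v : 'I_n -> M, eval phi v = 0.
Proof.
elim: n phi => [|n IH] phi /=.
  by split=> [h v|]; [rewrite (env0_unique v (fun=> s_zero M))|exact].
rewrite IH; split=> h v.
  rewrite (env_consE v); apply/eqP; rewrite eq_le eval_ge0 andbT.
  rewrite -(h (fun i => v (lift ord0 i))); exact: le_sup_eval.
apply/eqP; rewrite eq_le eval_ge0 andbT; apply: sup_eval_le => x.
by rewrite h.
Qed.

(** The universal theory of unit balls, in the form of the quantifier-free formulas
    vanishing identically on them. Unlike the whole theory, it passes to
    substructures. *)
Definition banach_like M := forall n (phi : formula R n), quantifier_free phi ->
  (forall (X : completeNormedModType R) (v : 'I_n -> ball_of X), eval phi v = 0) ->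
  forall v : 'I_n -> M, eval phi v = 0.

Lemma embedded_banach_like M N (h : M -> N) :
  models N (banach_theory R) -> is_embedding h -> banach_like M.
Proof.
move=> hN hh n phi qf hphi v; rewrite -(qf_eval_emb hh v qf).
by apply: (sups_eval N phi).1; apply: hN => X; apply/sups_eval.
Qed.

Lemma ball_of_models (X : completeNormedModType R) : models (ball_of X) (banach_theory R).
Proof. by move=> phi; exact. Qed.

End Formulas.

(** * Transfer of identities of unit balls *)

Section Transfer.
Variable R : realType.

Section AbsDiff.
Variables a b : R.
Hypotheses (a01 : 0 <= a <= 1) (b01 : 0 <= b <= 1).

Definition absdiff_fun (v : 'rV[R]_2) : R :=
  `|a * v ord0 ord0 - b * v ord0 (lift ord0 ord0)|.

Lemma absdiff_continuous : {within unit_cube R 2, continuous absdiff_fun}.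
Proof.
apply: continuous_subspaceT => v; have Fv : Filter (nbhs v) by exact: nbhs_filter.
apply: (@cvg_norm _ R^o).
apply: (@cvgB _ R^o).
  by apply: cvgM; [exact: cvg_cst|exact: coord_continuous].
by apply: cvgM; [exact: cvg_cst|exact: coord_continuous].
Qed.

Lemma absdiff_itv v : unit_cube R 2 v -> 0 <= absdiff_fun v <= 1.
Proof.
move=> hv; rewrite normr_ge0 /=.
have /andP[x0 x1] := hv ord0; have /andP[y0 y1] := hv (lift ord0 ord0).
move/andP: a01 => [a0 a1]; move/andP: b01 => [b0 b1].
have h1 := mulr_ile1 a0 x0 a1 x1; have h2 := mulr_ile1 b0 y0 b1 y1.
have h3 := mulr_ge0 a0 x0; have h4 := mulr_ge0 b0 y0.
by rewrite ler_norml; apply/andP; split; lra.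
Qed.

Definition absdiff := Connective absdiff_continuous absdiff_itv.

End AbsDiff.

Variable M : ball_structure R.
Hypothesis hM : banach_like M.

Lemma transfer_term n (t s : term R n) :
  (forall (X : completeNormedModType R) (v : 'I_n -> ball_of X),
     term_eval v t = term_eval v s) ->
  forall v : 'I_n -> M, term_eval v t = term_eval v s.
Proof.
move=> h v; apply: mdist_positivity.
by apply: (hM (phi := FDist t s)) => // X w /=; rewrite h mdistxx.
Qed.

(** Linear equations between values of formulas are expressible because |a s - b t|
    is a connective. *)
Lemma transfer_dist n (a b : R) (phi psi : formula R n) : 0 <= a <= 1 -> 0 <= b <= 1 ->
  quantifier_free phi -> quantifier_free psi ->
  (forall (X : completeNormedModType R) (v : 'I_n -> ball_of X),
     a * eval phi v = b * eval psi v) ->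
  forall v : 'I_n -> M, a * eval phi v = b * eval psi v.
Proof.
move=> a01 b01 qf1 qf2 h v.
pose args (i : 'I_2) := if i == ord0 then phi else psi.
have := hM (phi := FConn (absdiff a01 b01) args).
move=> /(_ _ _ v); rewrite /= /absdiff_fun !mxE /args /=.
move=> h'; apply/eqP; rewrite -subr_eq0 -normr_eq0; apply/eqP; apply: h' => [i|X w].
  by case: ifP.
by rewrite !mxE /args /= h subrr normr0.
Qed.

End Transfer.

(** * Structures satisfying the universal theory are parts of unit balls *)

Section Representation.
Variable R : realType.

Lemma scal0_subproof : `|0 : R| <= 1. Proof. by rewrite normr0. Qed.
Definition scal (a : R) : scalar R := insubd (exist _ 0 scal0_subproof : scalar R) a.

Lemma scalE (a : R) : `|a| <= 1 -> val (scal a) = a.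
Proof. by move=> h; rewrite val_insubd h. Qed.

Lemma scal_val (a : scalar R) : scal (val a) = a.
Proof. by rewrite /scal valKd. Qed.

Section Facts.
Variable M : ball_structure R.
Hypothesis hM : banach_like M.
Implicit Types x y z : M.

Local Notation S a x := (s_scale M (scal a) x).
Local Notation mid := (s_mid M).
Local Notation X0 := (@TVar R 3 (@Ordinal 3 0 isT)).
Local Notation X1 := (@TVar R 3 (@Ordinal 3 1 isT)).
Local Notation X2 := (@TVar R 3 (@Ordinal 3 2 isT)).

Let env3 (A : Type) (x y z : A) (i : 'I_3) : A := nth x [:: x; y; z] i.

Lemma transfer3 (t s : term R 3) :
  (forall (X : completeNormedModType R) (v : 'I_3 -> ball_of X),
     val (term_eval v t) = val (term_eval v s)) ->
  forall x y z, term_eval (env3 x y z) t = term_eval (env3 x y z) s.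
Proof.
by move=> h x y z; apply: (transfer_term hM) => X v; apply: val_inj; exact: h.
Qed.

Lemma half_le1 : `|2^-1 : R| <= 1.
Proof. by rewrite ger0_norm ?invr_ge0// invf_le1// ler1n. Qed.

Lemma S_S a b x : `|a| <= 1 -> `|b| <= 1 -> S a (S b x) = S (a * b) x.
Proof.
move=> ha hb; apply: (transfer3 (t := TScale (scal a) (TScale (scal b) X0))
  (s := TScale (scal (a * b)) X0) _ x x x) => X v /=.
by rewrite !scalE ?normrM ?mulr_ile1//; lmod_over R X.
Qed.

Lemma S_mid a x y : `|a| <= 1 -> mid (S a x) (S a y) = S a (mid x y).
Proof.
move=> ha; apply: (transfer3 (t := TMid (TScale (scal a) X0) (TScale (scal a) X1))
  (s := TScale (scal a) (TMid X0 X1)) _ x y x) => X v /=.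
by rewrite !scalE//; lmod_over R X.
Qed.

Lemma midC x y : mid x y = mid y x.
Proof.
apply: (transfer3 (t := TMid X0 X1) (s := TMid X1 X0) _ x y x) => X v /=.
by lmod_over R X.
Qed.

Lemma midA x y z : mid (S 2^-1 x) (mid y z) = mid (mid x y) (S 2^-1 z).
Proof.
apply: (transfer3 (t := TMid (TScale (scal 2^-1) X0) (TMid X1 X2))
  (s := TMid (TMid X0 X1) (TScale (scal 2^-1) X2)) _ x y z) => X v /=.
by rewrite !scalE ?half_le1//; lmod_over R X.
Qed.

Lemma midN x : mid (S (-1) x) x = s_zero M.
Proof.
apply: (transfer3 (t := TMid (TScale (scal (-1)) X0) X0) (s := TZero) _ x x x) => X v /=.
by rewrite !scalE ?normrN ?normr1//; lmod_over R X.
Qed.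

Lemma midxx x : mid x x = x.
Proof.
apply: (transfer3 (t := TMid X0 X0) (s := X0) _ x x x) => X v /=.
by lmod_over R X.
Qed.

Lemma S1 x : S 1 x = x.
Proof.
apply: (transfer3 (t := TScale (scal 1) X0) (s := X0) _ x x x) => X v /=.
by rewrite !scalE ?normr1//; lmod_over R X.
Qed.

Lemma S_mean a b x : `|a| <= 1 -> `|b| <= 1 ->
  S ((a + b) / 2) x = mid (S a x) (S b x).
Proof.
move=> ha hb; apply: (transfer3 (t := TScale (scal ((a + b) / 2)) X0)
  (s := TMid (TScale (scal a) X0) (TScale (scal b) X0)) _ x x x) => X v /=.
rewrite !scalE//; first by lmod_over R X.
rewrite normrM [`|2^-1|]ger0_norm ?invr_ge0// ler_pdivrMr// mul1r.
by apply: le_trans (ler_normD _ _) _; rewrite -[leRHS]/(1 + 1) lerD.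
Qed.

Lemma mid0 x : mid (s_zero M) x = S 2^-1 x.
Proof.
apply: (transfer3 (t := TMid TZero X0) (s := TScale (scal 2^-1) X0) _ x x x) => X v /=.
by rewrite !scalE ?half_le1//; lmod_over R X.
Qed.

Lemma S_zero a : S a (s_zero M) = s_zero M.
Proof.
apply: (transfer3 (t := TScale (scal a) TZero) (s := TZero) _
    (s_zero M) (s_zero M) (s_zero M)) => X v /=.
by lmod_over R X.
Qed.

Lemma opp_S x : s_opp M x = S (-1) x.
Proof.
apply: (transfer3 (t := TOpp X0) (s := TScale (scal (-1)) X0) _ x x x) => X v /=.
by rewrite !scalE ?normrN ?normr1//; lmod_over R X.
Qed.

Lemma dist_S a x y : `|a| <= 1 -> mdist (S a x) (S a y) = `|a| * mdist x y.
Proof.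
move=> ha; rewrite -[LHS]mul1r.
apply: (transfer_dist hM (phi := FDist (TScale (scal a) X0) (TScale (scal a) X1))
  (psi := FDist X0 X1) _ _ _ _ _ (env3 x y x)) => //.
- by rewrite ler01 lexx.
- by rewrite normr_ge0.
move=> X v /=; rewrite mul1r -[mdist _ _]/(ub_dist _ _) /ub_dist /= scalE//.
by rewrite -scalerBr normrZ -mulrA.
Qed.

Lemma norm_dist x : s_norm M x = 2 * mdist x (s_zero M).
Proof.
suff : 2^-1 * s_norm M x = 1 * mdist x (s_zero M).
  by move/(congr1 (fun t => 2 * t)); rewrite mulrA mulfV// !mul1r.
apply: (transfer_dist hM (phi := FNorm X0) (psi := FDist X0 TZero) _ _ _ _ _ (env3 x x x)) => //.
- by rewrite invr_ge0 ler0n invf_le1// ler1n.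
- by rewrite ler01 lexx.
move=> X v /=; rewrite mul1r -[mdist _ _]/(ub_dist _ _) /ub_dist /= subr0.
by rewrite mulrC.
Qed.

Local Notation hp := (half_pow R).

Lemma hp_le1 k : `|hp k| <= 1.
Proof.
rewrite ger0_norm ?(ltW (half_pow_gt0 _ _))// /half_pow exprn_ile1 ?invr_ge0//.
by rewrite invf_le1// ler1n.
Qed.

Lemma hpD j k : hp (j + k) = hp j * hp k.
Proof. by rewrite /half_pow exprD. Qed.

Lemma hp1 : hp 1 = 2^-1. Proof. exact: expr1. Qed.

Lemma hp_pow k : 2 ^+ k * hp k = 1 :> R.
Proof. by rewrite /half_pow -exprMn mulfV ?expr1n. Qed.

Let P := (M * nat)%type.
Implicit Types u v w : P.

(** A pair (m, k) stands for the formal multiple 2^k m. At level K it is represented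
    by the element 2^(k - K) m of the ball; operations and distances of formal
    multiples are computed at any level large enough for all of them. *)
Definition at_level K u : M := S (hp (K - u.2)) u.1.

Lemma at_level_add K j u : (u.2 <= K)%N -> at_level (K + j) u = S (hp j) (at_level K u).
Proof.
by move=> h; rewrite /at_level S_S ?hp_le1// -hpD addnC addnBA.
Qed.

Lemma at_levelS K u : (u.2 <= K)%N -> at_level K.+1 u = S 2^-1 (at_level K u).
Proof. by move=> h; rewrite -addn1 at_level_add// hp1. Qed.

Definition pre_dist u v :=
  2 ^+ (u.2 + v.2).+1 * mdist (at_level (u.2 + v.2) u) (at_level (u.2 + v.2) v).

Lemma pre_dist_level K u v : (u.2 <= K)%N -> (v.2 <= K)%N ->
  pre_dist u v = 2 ^+ K.+1 * mdist (at_level K u) (at_level K v).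
Proof.
have step k j : (u.2 <= k)%N -> (v.2 <= k)%N ->
    2 ^+ (k + j).+1 * mdist (at_level (k + j) u) (at_level (k + j) v) =
    2 ^+ k.+1 * mdist (at_level k u) (at_level k v).
  move=> hu hv; rewrite !at_level_add// dist_S ?hp_le1//.
  rewrite ger0_norm ?(ltW (half_pow_gt0 _ _))// -addSn exprD mulrA.
  by rewrite -[_ * _ * hp j]mulrA hp_pow mulr1.
move=> hu hv; rewrite -(step K (u.2 + v.2)%N)// addnC step// ?leq_addr// leq_addl//.
Qed.

Lemma pre_dist0 K u v : (u.2 <= K)%N -> (v.2 <= K)%N ->
  at_level K u = at_level K v -> pre_dist u v = 0.
Proof. by move=> hu hv h; rewrite (pre_dist_level hu hv) h mdistxx mulr0. Qed.

(** The weights compensate the halving in [s_mid]: 2^(k + k' + 1) times the midpoint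
    of 2^-k' m and 2^-k m' is 2^k m + 2^k' m'. *)
Definition pre_add u v : P :=
  (mid (S (hp v.2) u.1) (S (hp u.2) v.1), (u.2 + v.2).+1).

Lemma at_level_addP K u v : (u.2 + v.2 <= K)%N ->
  at_level K.+1 (pre_add u v) = mid (at_level K u) (at_level K v).
Proof.
move=> h; rewrite /at_level /= subSS -S_mid ?hp_le1// !S_S ?hp_le1// -!hpD.
congr (mid (S (hp _) _) (S (hp _) _)).
  by lia.
by lia.
Qed.

(** The number of halvings after which a becomes a scalar of absolute value at
    most 1, hence a symbol of the language. *)
Definition shift (a : R) := (Num.trunc `|a|).+1.

Lemma shift_le (a : R) j : (shift a <= j)%N -> `|a * hp j| <= 1.
Proof.
move=> h; rewrite normrM [`|hp j|]ger0_norm ?(ltW (half_pow_gt0 _ _))//.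
rewrite -[leRHS](hp_pow j) ler_pM2r ?half_pow_gt0//.
apply: ltW; apply: lt_le_trans (truncnS_gt _) _.
by rewrite -natrX ler_nat (leq_trans h)// ltnW// ltn_expl.
Qed.

Definition pre_scale (a : R) u : P := (S (a * hp (shift a)) u.1, (u.2 + shift a)%N).

Lemma at_level_scale a K j u : (u.2 <= K)%N -> (shift a <= j)%N ->
  at_level (K + j) (pre_scale a u) = S (a * hp j) (at_level K u).
Proof.
move=> hu hj; rewrite /at_level /= !S_S ?hp_le1 ?shift_le//.
congr (S _ _); rewrite [LHS]mulrC -!mulrA -!hpD; congr (_ * hp _).
by lia.
Qed.

Definition pre_zero : P := (s_zero M, 0%N).

Lemma at_level_zero K : at_level K pre_zero = s_zero M.
Proof. exact: S_zero. Qed.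

Definition pre_space : prenormed R.
Proof.
refine (@Prenormed R P pre_zero pre_add pre_scale pre_dist _ _ _ _ _ _ _ _ _ _ _ _ _).
- by move=> u; rewrite /pre_dist mdistxx mulr0.
- by move=> u v; rewrite /pre_dist metric_sym [(u.2 + v.2)%N]addnC.
- move=> v u w; pose K := (u.2 + v.2 + w.2)%N.
  have uK : (u.2 <= K)%N by rewrite /K -addnA leq_addr.
  have vK : (v.2 <= K)%N by rewrite /K addnAC leq_addl.
  have wK : (w.2 <= K)%N by rewrite /K leq_addl.
  rewrite (pre_dist_level uK wK) (pre_dist_level uK vK) (pre_dist_level vK wK) -mulrDr.
  by rewrite ler_pM2l ?exprn_gt0// metric_triangle.
- move=> u u' v v'; pose K := (u.2 + v.2 + (u'.2 + v'.2))%N.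
  have h1 : (u.2 + v.2 <= K)%N by rewrite leq_addr.
  have h2 : (u'.2 + v'.2 <= K)%N by rewrite leq_addl.
  rewrite (@pre_dist_level K.+1)//= !at_level_addP//.
  have h3 := leq_trans (leq_addr v.2 u.2) h1; have h4 := leq_trans (leq_addl u.2 v.2) h1.
  have h5 := leq_trans (leq_addr v'.2 u'.2) h2; have h6 := leq_trans (leq_addl u'.2 v'.2) h2.
  rewrite (pre_dist_level h3 h5) (pre_dist_level h4 h6) -mulrDr exprSr -mulrA.
  rewrite ler_pM2l ?exprn_gt0// -ler_pdivlMl// mulrC; exact: s_mid_lip.
- move=> a u v; pose K := (u.2 + v.2)%N; pose j := shift a.
  have uK : (u.2 <= K)%N by rewrite leq_addr.
  have vK : (v.2 <= K)%N by rewrite leq_addl.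
  rewrite (@pre_dist_level (K + j)) ?leq_add//= !at_level_scale// dist_S ?shift_le//.
  rewrite (pre_dist_level uK vK) normrM [`|hp j|]ger0_norm ?(ltW (half_pow_gt0 _ _))//.
  rewrite -addSn exprD mulrACA -!mulrA.
  rewrite [hp j * _]mulrA [hp j * _]mulrC hp_pow mul1r.
  by rewrite mulrCA.
- move=> u v w; pose K := (u.2 + v.2 + w.2)%N.
  apply: (@pre_dist0 K.+2) => /=; try by rewrite /K; lia.
  rewrite !at_level_addP /=; try by rewrite /K; lia.
  by rewrite !at_levelS ?midA//; rewrite /K; lia.
- move=> u v; apply: (@pre_dist0 (u.2 + v.2).+1) => /=; try lia.
  by rewrite !at_level_addP ?(midC (at_level _ u))//; lia.
- move=> u; apply: (@pre_dist0 u.2.+1) => //=.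
  by rewrite at_level_addP//= at_level_zero mid0 at_levelS.
- move=> u; pose j := shift (-1); pose K := (u.2 + j)%N.
  apply: (@pre_dist0 (K + K).+1) => /=; try by rewrite /K /j; lia.
  rewrite at_level_addP /=; last by rewrite /K /j; lia.
  rewrite at_level_zero.
  have -> : (K + K = (u.2 + u.2 + j) + j)%N by rewrite /K; lia.
  rewrite at_level_scale//; last lia.
  rewrite [at_level (_ + j + j) u]at_level_add; last lia.
  by rewrite -S_S ?hp_le1 ?normrN ?normr1// midN.
- move=> a b u; pose j := (shift a + shift b + shift (a * b))%N.
  apply: (@pre_dist0 (u.2 + j + j)) => /=; try by rewrite /j; lia.
  rewrite at_level_scale /=; try by rewrite /j; lia.
  rewrite at_level_scale /=; try by rewrite /j; lia.
  rewrite -addnA at_level_scale /=; try by rewrite /j; lia.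
  rewrite S_S ?shift_le /j; try lia.
  by congr (S _ _); rewrite [in RHS]hpD; ring.
- move=> u; pose j := shift 1.
  apply: (@pre_dist0 (u.2 + j)) => /=; try by rewrite /j; lia.
  by rewrite at_level_scale// mul1r at_level_add.
- move=> a u v; pose j := shift a; pose K := (u.2 + v.2)%N.
  apply: (@pre_dist0 (K.+1 + (j + j))) => /=; try by rewrite /K /j; lia.
  rewrite at_level_scale /=; try by rewrite /K /j; lia.
  rewrite at_level_addP//.
  rewrite addSn at_level_addP /=; try by rewrite /K /j; lia.
  rewrite !at_level_scale ?S_mid//; try by rewrite /K /j; lia.
  by apply: shift_le; rewrite /j; lia.
- move=> a b u; pose j := (shift a + shift b + shift (a + b))%N.
  apply: (@pre_dist0 (u.2 + u.2 + (j + j)).+1) => /=; try by rewrite /j; lia.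
  rewrite at_level_addP /=; last by rewrite /j; lia.
  rewrite !at_level_scale; try by rewrite /j; lia.
  rewrite -addnS at_level_scale; try by rewrite /j; lia.
  rewrite -S_mean; try by apply: shift_le; rewrite /j; lia.
  by congr (S _ _); rewrite half_powS; field.
Defined.

(** The Banach space is the completion of the space of formal multiples 2^k m. The
    image of M need not be the whole ball yet; formal multiples are dense. *)
Lemma embed_in_ball : exists (X : completeNormedModType R) (e : M -> ball_of X),
  is_embedding e /\
  forall (x : X) d, 0 < d -> exists m k, `|x - 2 ^+ k *: val (e m)| <= d.
Proof.
have [X [i [iD iZ id dense]]] : exists (X : completeNormedModType R) (i : P -> X),
    [/\ forall u v, i (pre_add u v) = i u + i v,
        forall a v, i (pre_scale a v) = a *: i v,
        forall u v, `|i u - i v| = pre_dist u v &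
        forall (x : X) e, 0 < e -> exists v, `|x - i v| <= e].
  exact: (prenormed_completion pre_space).
have ieq (u v : P) : pre_dist u v = 0 -> i u = i v.
  by move=> h; apply/eqP; rewrite -subr_eq0 -normr_eq0 id h.
have at_level_base K m : at_level K (m, 0%N) = S (hp K) m.
  by rewrite /at_level subn0.
have at_level_base0 m : at_level 0 (m, 0%N) = m.
  by rewrite at_level_base /half_pow expr0 S1.
have i0 : i pre_zero = 0.
  have : i (pre_add pre_zero pre_zero) = i pre_zero.
    by apply: ieq; exact: (@padd0 R pre_space pre_zero).
  by rewrite iD => /eqP; rewrite -subr_eq0 addrK => /eqP.
have dist0 (m m' : M) : pre_dist (m, 0%N) (m', 0%N) = 2 * mdist m m'.
  by rewrite /pre_dist /at_level /= addn0 subnn /half_pow !expr0 !S1 expr1.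
have ni (m : M) : `|i (m, 0%N)| = s_norm M m.
  by rewrite -[i (m, 0%N)]subr0 -i0 id dist0 norm_dist.
have n1 m : `|i (m, 0%N)| <= 1 by rewrite ni; have /andP[] := s_norm_itv m.
pose e m : ball_of X := exist _ (i (m, 0%N)) (n1 m).

exists X, e; split; last first.
  move=> x d /(dense x)[[m k] h]; exists m, k.
  rewrite (_ : 2 ^+ k *: val (e m) = i (m, k))//.
  rewrite /= -iZ; apply: ieq; set j := shift (2 ^+ k).
  have h1 : ((pre_scale (2 ^+ k) (m, 0%N)).2 <= 0 + (j + k))%N by exact: leq_addr.
  have h2 : ((m, k).2 <= 0 + (j + k))%N by exact: leq_addl.
  apply: (pre_dist0 h1 h2).
  rewrite at_level_scale ?leq_addr//.
  have -> : 2 ^+ k * hp (j + k) = hp j by rewrite addnC hpD mulrA hp_pow mul1r.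
  by rewrite /at_level [LHS]/= subnn [X in S _ X]S1 add0n addnK.
split.
- move=> m m'; rewrite -[LHS]/(`|i (m, 0%N) - i (m', 0%N)| / 2) id.
  by rewrite dist0 mulrC mulrA mulVf// mul1r.
- by apply: val_inj; exact: i0.
- move=> m; apply: val_inj; rewrite /= -scaleN1r -iZ; apply: ieq.
  apply: (@pre_dist0 (0 + shift (-1))) => //.
  rewrite at_level_scale// at_level_base at_level_base0 opp_S.
  by rewrite S_S ?hp_le1 ?normrN ?normr1// mulrC.
- move=> m m'; apply: val_inj => /=.
  rewrite -iD; apply: (@scalerI _ _ 2) => //.
  rewrite scalerA mulfV// scale1r scaler_nat mulr2n -iD; apply: ieq.
  apply: (@pre_dist0 1) => //; rewrite !at_level_addP//.
  by rewrite midxx !at_level_base0.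
- move=> a m; apply: val_inj; rewrite /= -iZ; apply: ieq.
  have a1 : `|val a| <= 1 by exact: (valP a).
  apply: (@pre_dist0 (0 + shift (val a))) => //.
  have -> : s_scale M a m = S (val a) m by rewrite scal_val.
  rewrite at_level_scale// at_level_base at_level_base0.
  by rewrite S_S ?hp_le1// mulrC.
- by move=> m; exact: ni.
Qed.

End Facts.
End Representation.

(** * Models of the model completion are Gurarij spaces *)

Section Models.
Variable R : realType.
Local Notation hp := (half_pow R).

Section Companion.
Variable T : theory R.
Hypothesis Tc : companion (banach_theory R) T.
Hypothesis qe : eliminates_quantifiers T.

Lemma hp_scale (X : normedModType R) k (x y : X) :
  `|hp k *: x - y| = hp k * `|x - 2 ^+ k *: y|.
Proof.
rewrite -{2}(ger0_norm (ltW (half_pow_gt0 R k))) -normrZ; congr (`|_|).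
by rewrite scalerBr scalerA mulrC hp_pow scale1r.
Qed.

(** M embeds in the unit ball of some X, and [sandwich] applies to this ball: every
    y of the ball is close to some 2^k m, that is, 2^-k y is close to m, and a point
    of M with the same property is close to y. So M is dense, and it is complete. *)
Lemma model_is_ball (M : ball_structure R) : models M T ->
  exists X : completeNormedModType R, isomorphic M (ball_of X).
Proof.
move=> hM; have [N hN [h0 hh0]] := Tc.2 M hM.
have [X [e [he dense]]] := embed_in_ball (embedded_banach_like hN hh0).
have [P hP [g hg]] := Tc.1 (ball_of X) (@ball_of_models R X).
exists X, e => //.
have e_inj : injective e.
  by move=> m m' h; apply: mdist_positivity; rewrite -(emb_dist he) h mdistxx.
suff /choice[f hf] : forall y : ball_of X, exists m, e m = y.
  by exists f => // m; apply: e_inj; rewrite hf.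
move=> y.
have mdE (a b : ball_of X) : mdist a b = `|val a - val b| / 2 by [].
have dens d : 0 < d -> exists m, `|val y - val (e m)| < d.
  move=> d0; have d4 : 0 < d / 4 by rewrite divr_gt0.
  have [m [k hmk]] := dense (val y) _ d4.
  pose psi : formula R 2 := FDist (TScale (scal (hp k)) (TVar R ord0))
    (TVar R (lift ord0 ord0)).
  have d8 : 0 < hp k * (d / 16) by rewrite mulr_gt0 ?half_pow_gt0// divr_gt0.
  have [y'] := sandwich qe (psi := psi) (fun _ : 'I_1 => m) y hM hP he hg I d8.
  rewrite /= !env_cons0 !env_cons_lift -(emb_dist he) (emb_scale he) !mdE /=.
  rewrite !scalE ?hp_le1// !hp_scale => h.
  exists y'.
  have hk := half_pow_gt0 R k.
  have : `|val (e y') - 2 ^+ k *: val (e m)| <= `|val y - 2 ^+ k *: val (e m)| + d / 8.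
    rewrite -(ler_pM2l hk) mulrDr; lra.
  have := ler_distD (2 ^+ k *: val (e m)) (val y) (val (e y')).
  rewrite [`|2 ^+ k *: _ - _|]distrC; lra.
have [d d0|d m d' m' h h'|m hm] := @complete_limit R M (fun d m => `|val y - val (e m)| < d).
- exact: dens.
- rewrite ballEmdist /= -(emb_dist he) mdE.
  have := ler_distD (val y) (val (e m)) (val (e m')).
  have := normr_ge0 (val y - val (e m)); have := normr_ge0 (val y - val (e m')).
  rewrite [`|val (e m) - val y|]distrC; lra.
exists m; apply/esym/val_inj/eqP; rewrite -subr_eq0 -normr_le0.
apply/ler_addgt0Pl => d d0; rewrite addr0.
have d8 : 0 < d / 8 by rewrite divr_gt0.
have [m1 h1] := dens _ d8.
have := hm _ _ _ h1 d8; rewrite ballEmdist /= -(emb_dist he) mdE.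
have := ler_distD (val (e m1)) (val y) (val (e m)).
rewrite [`|val (e m1) - val (e m)|]distrC; lra.
Qed.

Lemma linear_ball_embedding (X Z : completeNormedModType R) (h : {linear X -> Z}) :
  isometric h ->
  exists e : ball_of X -> ball_of Z, is_embedding e /\ forall x, val (e x) = h (val x).
Proof.
move=> hh; have h1 (x : ball_of X) : `|h (val x)| <= 1 by rewrite hh; exact: (valP x).
pose e x : ball_of Z := exist _ (h (val x)) (h1 x).
exists e; split=> //; split.
- move=> x y; rewrite -[LHS]/(`|h (val x) - h (val y)| / 2) -raddfB hh//.
- by apply: val_inj; exact: raddf0.
- by move=> x; apply: val_inj; exact: raddfN.
- by move=> x y; apply: val_inj => /=; rewrite linearZ raddfD.
- by move=> a x; apply: val_inj => /=; rewrite linearZ.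
- by move=> x; exact: hh.
Qed.

Lemma sum_continuous (U : topologicalType) (I : Type) (s : seq I) (f : I -> U -> R) v :
  (forall i, f i x @[x --> v] --> f i v) ->
  \sum_(i <- s) f i x @[x --> v] --> \sum_(i <- s) f i v.
Proof.
move=> h; elim: s => [|i s IH].
  rewrite big_nil (_ : (fun x => _) = (fun=> 0)); first exact: cvg_cst.
  by apply/funext => x; rewrite big_nil.
rewrite big_cons (_ : (fun x => _) = (fun x => f i x + \sum_(j <- s) f j x)).
  by apply: (@cvgD _ R^o); [exact: h|exact: IH].
by apply/funext => x; rewrite big_cons.
Qed.

Section AverageDistance.
Variables (K : nat) (r : 'I_K -> R).
Hypothesis r01 : forall k, 0 <= r k <= 1.

(** The mean distance to prescribed values: a single formula that is small only when
    finitely many formulas are near their prescribed values. *)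
Definition avgdist_fun (v : 'rV[R]_K) : R :=
  K%:R^-1 * \sum_(k < K) `|v ord0 k - r k|.

Lemma avgdist_continuous : {within unit_cube R K, continuous avgdist_fun}.
Proof.
apply: continuous_subspaceT => v; have Fv : Filter (nbhs v) by exact: nbhs_filter.
apply: cvgM; first exact: cvg_cst.
apply: sum_continuous => k; apply: (@cvg_norm _ R^o); apply: (@cvgB _ R^o).
  exact: coord_continuous.
exact: cvg_cst.
Qed.

Lemma avgdist_itv v : unit_cube R K v -> 0 <= avgdist_fun v <= 1.
Proof.
move=> hv; rewrite mulr_ge0 ?invr_ge0 ?sumr_ge0//=.
have [K0|K0] := eqVneq K 0%N.
  by rewrite /avgdist_fun big1 ?mulr0 ?ler01// => -[k kK]; exfalso; move: kK; rewrite K0.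
rewrite ler_pdivrMl ?mulr1 ?ltr0n ?lt0n//.
apply: le_trans (_ : \sum_(k < K) 1 <= _).
  apply: ler_sum => k _; have /andP[x0 x1] := hv k; have /andP[y0 y1] := r01 k.
  by rewrite ler_norml; apply/andP; split; lra.
by rewrite sumr_const card_ord.
Qed.

Definition avgdist := Connective avgdist_continuous avgdist_itv.

Lemma avgdist_le v e k : avgdist_fun v <= e -> `|v ord0 k - r k| <= K%:R * e.
Proof.
have K0 : (0 < K)%N by case: (k) => j; exact: leq_ltn_trans.
rewrite ler_pdivrMl ?ltr0n// => h; apply: le_trans h.
by rewrite (bigD1 k)//= lerDl sumr_ge0.
Qed.

End AverageDistance.

(** Each step halves the sum built so far, so the term of index j enters with weight
    2^-j: all terms end up with the common factor 2^-m. *)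
Fixpoint lterm n (A : nat -> R) (x : nat -> 'I_n) m : term R n :=
  if m is j.+1 then TMid (TScale (scal (A j * hp j)) (TVar R (x j))) (lterm A x j)
  else TZero.

Lemma lterm_eval (X : completeNormedModType R) n A (x : nat -> 'I_n) m
    (v : 'I_n -> ball_of X) : (forall j, (j < m)%N -> `|A j| <= 1) ->
  val (term_eval v (lterm A x m)) = hp m *: lc m A (fun j => val (v (x j))).
Proof.
elim: m => [|m IH] hA /=; first by rewrite lc0 scaler0.
rewrite IH => [|j jm]; last by apply: hA; exact: leqW.
rewrite scalE; last by rewrite normrM mulr_ile1 ?hp_le1// hA.
pose B j : X := val (v (x j)).
rewrite -[LHS]/(2^-1 *: ((A m * hp m) *: B m + hp m *: lc m A B)) -[RHS]/(_ *: lc m.+1 A B).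
by rewrite lcS half_powS; lmod_over R X.
Qed.

Lemma lterm_norm (X : completeNormedModType R) n A (x : nat -> 'I_n) m
    (v : 'I_n -> ball_of X) : (forall j, (j < m)%N -> `|A j| <= 1) ->
  s_norm (ball_of X) (term_eval v (lterm A x m)) =
    hp m * `|lc m A (fun j => val (v (x j)))|.
Proof.
by move=> hA; rewrite -(gtr0_norm (half_pow_gt0 R m)) -normrZ -lterm_eval.
Qed.

Definition fam (A : Type) (V : lmodType R) (F : A -> V) n (w : 'I_n -> A) (j : nat) : V :=
  if insub j is Some i then F (w i) else 0.

Lemma famE (A : Type) (V : lmodType R) (F : A -> V) n (w : 'I_n -> A) (i : 'I_n) :
  fam F w i = F (w i).
Proof. by rewrite /fam valK. Qed.

(** After rescaling into the unit balls, a finite net of coefficients expresses the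
    wanted property of y by one quantifier-free formula, which vanishes at z;
    [sandwich] with the ball of Z in the middle provides y. *)
Lemma model_one_point (X : completeNormedModType R) :
  models (ball_of X) T -> one_point X.
Proof.
move=> hX Z h n v z d hh d0.
pose s := 1 + \sum_(i < n) `|v i| + `|z|.
have s0 : 0 < s by rewrite /s -addrA ltr_pwDl// addr_ge0// sumr_ge0.
have sP (W : completeNormedModType R) (w : W) : `|w| <= s -> `|s^-1 *: w| <= 1.
  by move=> hw; rewrite normrZ normfV (gtr0_norm s0) ler_pdivrMl// mulr1.
have vs (i : 'I_n) : `|v i| <= s.
  rewrite /s (bigD1 i)//= -!addrA addrCA lerDl !addr_ge0// sumr_ge0//.
have zs : `|z| <= s by rewrite /s lerDr addr_ge0// sumr_ge0.
pose vb (i : 'I_n) : ball_of X := exist _ (s^-1 *: v i) (sP _ _ (vs i)).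
pose zb : ball_of Z := exist _ (s^-1 *: z) (sP _ _ zs).
have [e [he eE]] := linear_ball_embedding hh.
have [P hP [g hg]] := Tc.1 (ball_of Z) (@ball_of_models R Z).
pose m := n.+1.
have ds : 0 < d / s by rewrite divr_gt0.
have m0 : 0 < 4 * m%:R :> R by rewrite mulr_gt0// ltr0n.
have [K [A [A1 hA]]] := @cube_net R m _ (divr_gt0 ds m0).
pose x j : 'I_n.+1 := inord (if (j < n)%N then j.+1 else 0%N).
have envE (W : completeNormedModType R) (w : 'I_n -> ball_of W) y (f : nat -> W) c :
    (forall i : 'I_n, val (w i) = f i) ->
    lc m c (fun j => val (env_cons y w (x j))) = lc m c (ext n f (val y)).
  move=> wf; apply: eq_lc => // j jm; rewrite /x /ext; case: ifP => jn.
    rewrite (_ : inord _ = lift ord0 (Ordinal jn)) ?env_cons_lift ?wf//.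
    by apply: val_inj; rewrite /= inordK.
  rewrite (_ : inord _ = ord0) ?env_cons0//.
  by apply: val_inj; rewrite /= inordK.
pose t k := lterm (A k) x m.
pose r (k : 'I_K) := s_norm (ball_of Z) (term_eval (env_cons zb (e \o vb)) (t k)).
have r01 k : 0 <= r k <= 1 by exact: s_norm_itv.
pose psi : formula R n.+1 := FConn (avgdist r01) (fun k : 'I_K => FNorm (t k)).
have K1 : 0 < K%:R + 1 :> R by rewrite ltr_wpDl.
(* a mean of K numbers that is at most eta bounds each of them by K * eta *)
pose eta := hp m * (d / s / 4) / (K%:R + 1).
have eta0 : 0 < eta by rewrite !divr_gt0// mulr_gt0 ?half_pow_gt0// !divr_gt0.
have [|yb] := sandwich qe (psi := psi) vb zb hX hP he hg _ eta0; first by move=> k.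
have -> : eval psi (env_cons zb (e \o vb)) = 0.
  rewrite /= /avgdist_fun big1 ?mulr0// => k _.
  by rewrite mxE /= subrr normr0.
rewrite add0r => hyb.
pose u' := ext n (fun i => s^-1 *: h (v i)) (s^-1 *: z).
pose w' := ext n (fun i => s^-1 *: v i) (val yb).
have u'1 i : (i < m)%N -> `|u' i| <= 1.
  move=> _; rewrite /u' /ext; case: ifP => hi; last by exact: (sP Z).
  by rewrite -linearZ hh; exact: (valP (vb (Ordinal hi))).
have w'1 i : (i < m)%N -> `|w' i| <= 1.
  move=> _; rewrite /w' /ext; case: ifP => hi; last exact: (valP yb).
  exact: (valP (vb (Ordinal hi))).
have net k : (k < K)%N -> `| `|lc m (A k) u'| - `|lc m (A k) w'| | <= d / s / 4.
  move=> kK; have hk := half_pow_gt0 R m.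
  have : `|s_norm (ball_of X) (term_eval (env_cons yb vb) (t k)) - r (Ordinal kK)| <=
      K%:R * eta.
    by have := avgdist_le (Ordinal kK) hyb; rewrite mxE.
  have -> : r (Ordinal kK) = hp m * `|lc m (A k) u'|.
    rewrite /r lterm_norm; last by move=> j _; exact: A1.
    by congr (_ * `|_|); apply: envE => i; rewrite /= eE /= linearZ.
  have -> : s_norm (ball_of X) (term_eval (env_cons yb vb) (t k)) = hp m * `|lc m (A k) w'|.
    rewrite lterm_norm; last by move=> j _; exact: A1.
    by congr (_ * `|_|); apply: envE.
  rewrite -mulrBr normrM (gtr0_norm hk) distrC => le_eta.
  rewrite -(ler_pM2l hk); apply: le_trans le_eta _.
  by rewrite /eta; apply: mul_div1_le => //; rewrite mulr_gt0// !divr_gt0.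
exists (s *: val yb) => c.
have -> : lc n.+1 c (ext n (h \o v) z) = s *: lc m c u'.
  rewrite /m !lc_ext scalerDr; congr (_ + _).
    rewrite /lc scaler_sumr; apply: eq_bigr => i _ /=.
    by rewrite !scalerA; congr (_ *: _); field; rewrite gt_eqF.
  by rewrite !scalerA; congr (_ *: _); field; rewrite gt_eqF.
have -> : lc n.+1 c (ext n v (s *: val yb)) = s *: lc m c w'.
  rewrite /m !lc_ext scalerDr; congr (_ + _).
    rewrite /lc scaler_sumr; apply: eq_bigr => i _ /=.
    by rewrite !scalerA; congr (_ *: _); field; rewrite gt_eqF.
  by rewrite !scalerA mulrC.
rewrite !normrZ -mulrBr normrM normr_id (gtr0_norm s0) -ler_pdivlMl// mulrA.
rewrite [s^-1 * d]mulrC.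
apply: le_trans (net_control hA ler01 (lip_lc u'1) (lip_lc w'1) net c) _.
rewrite ler_wpM2r ?l1_ge0//.
have -> : 2 * 1 * m%:R * (d / s / (4 * m%:R)) = d / s / 2.
  have mN : m%:R != 0 :> R by rewrite pnatr_eq0.
  have sN : s != 0 by rewrite gt_eqF.
  by field; rewrite sN mN.
lra.
Qed.

Lemma model_gurarij (M : ball_structure R) : models M T ->
  exists2 G : completeNormedModType R, gurarij G & isomorphic M (ball_of G).
Proof.
move=> hM; have [X iso] := model_is_ball hM.
exists X => //; apply/one_point_gurarij/model_one_point.
by case: iso => h he hb; apply/(iso_models T he hb).
Qed.

End Companion.
End Models.

(** * Gurarij spaces are models *)

Section Converse.
Variable R : realType.

Fixpoint tcoef n (t : term R n) : 'I_n -> R :=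
  match t with
  | TVar i => fun j => (j == i)%:R
  | TZero => fun=> 0
  | TOpp s => fun j => - tcoef s j
  | TMid s s' => fun j => (tcoef s j + tcoef s' j) / 2
  | TScale a s => fun j => val a * tcoef s j
  end.

Definition fsum (X : completeNormedModType R) n (c : 'I_n -> R) (v : 'I_n -> ball_of X) : X :=
  \sum_(i < n) c i *: val (v i).

Lemma term_coef (X : completeNormedModType R) n (t : term R n) (v : 'I_n -> ball_of X) :
  val (term_eval v t) = fsum (tcoef t) v.
Proof.
elim: t => [i||t IH|t IHt s IHs|a t IH] /=.
- rewrite /fsum (bigD1 i)//= eqxx scale1r big1 ?addr0// => j /negbTE ->.
  by rewrite scale0r.
- by rewrite /fsum big1// => j _; rewrite scale0r.
- by rewrite IH /fsum -sumrN; apply: eq_bigr => j _; rewrite scaleNr.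
- rewrite IHt IHs /fsum -big_split scaler_sumr; apply: eq_bigr => j _ /=.
  by rewrite -scalerDl scalerA mulrC.
- by rewrite IH /fsum scaler_sumr; apply: eq_bigr => j _; rewrite scalerA.
Qed.

Lemma tcoef_le n (t : term R n) : \sum_i `|tcoef t i| <= 1.
Proof.
elim: t => [i||t IH|t IHt s IHs|a t IH] /=.
- rewrite (bigD1 i)//= eqxx normr1 big1 ?addr0// => j /negbTE ->.
  by rewrite normr0.
- by rewrite big1// => j _; rewrite normr0.
- by under eq_bigr do rewrite normrN.
- apply: le_trans (_ : (\sum_i `|tcoef t i| + \sum_i `|tcoef s i|) / 2 <= _); last by lra.
  rewrite -big_split mulr_suml; apply: ler_sum => i _.
  rewrite normrM [`|2^-1|]ger0_norm ?invr_ge0// ler_pM2r ?invr_gt0//.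
  exact: ler_normD.
- apply: le_trans IH; apply: ler_sum => i _; rewrite normrM.
  by rewrite ler_piMl//; exact: (valP a).
Qed.

Definition fclose (X : completeNormedModType R) n d (v w : 'I_n -> ball_of X) :=
  forall c, `| `|fsum c v| - `|fsum c w| | <= d * \sum_i `|c i|.

(** Terms are linear combinations with coefficients of l1 norm at most 1, so atomic
    formulas are controlled by the norms of combinations; connectives are continuous
    on the cube. *)
Lemma qf_continuity (X : completeNormedModType R) n (phi : formula R n)
    (v : 'I_n -> ball_of X) e : quantifier_free phi -> 0 < e ->
  exists2 d, 0 < d & forall w, fclose d v w -> `|eval phi v - eval phi w| <= e.
Proof.
elim: phi v e => {n} [n t|n t s|n k u args IH|n psi IH|n psi IH] v e qf e0;
  last by case: qf.
- exists e => // w vw.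
  have normE (z : 'I_n -> ball_of X) : eval (FNorm t) z = `|fsum (tcoef t) z|.
    by rewrite -term_coef.
  rewrite !normE; by apply: le_trans (vw _) _; rewrite ler_piMr ?(ltW e0)// tcoef_le.
- exists e => // w vw.
  have mdE (z : 'I_n -> ball_of X) : eval (FDist t s) z =
      `|fsum (fun i => tcoef t i - tcoef s i) z| / 2.
    rewrite -[LHS]/(`|val (term_eval z t) - val (term_eval z s)| / 2) !term_coef.
    by rewrite /fsum -sumrB; under eq_bigr do rewrite -scalerBl.
  rewrite !mdE -mulrBl normrM [`|2^-1|]ger0_norm ?invr_ge0// ler_pdivrMr//.
  apply: le_trans (vw _) _; rewrite ler_wpM2l ?(ltW e0)//.
  apply: le_trans (_ : \sum_i `|tcoef t i| + \sum_i `|tcoef s i| <= _).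
    by rewrite -big_split; apply: ler_sum => i _; exact: ler_normB.
  by rewrite -[leRHS]/(1 + 1) lerD ?tcoef_le.
- pose s (z : 'I_n -> ball_of X) : 'rV[R]_k := \row_(i < k) eval (args i) z.
  have scube z : unit_cube R k (s z) by move=> i; rewrite mxE; exact: eval_itv.
  have /subspace_continuousP/(_ _ (scube v)) := @conn_continuous R k u.
  move=> /cvgrPdist_le/(_ e e0); rewrite near_withinE => /nbhs_ballP[r /= r0 hr].
  have r2 : 0 < r / 2 by rewrite divr_gt0.
  have /choice[d hd] : forall i : 'I_k, exists d, 0 < d /\ forall w,
      fclose d v w -> `|eval (args i) v - eval (args i) w| <= r / 2.
    by move=> i; have [d d0 hd] := IH i v _ (qf i) r2; exists d.
  (* a positive lower bound of the finitely many d i *)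
  pose D := (1 + \sum_(i < k) (d i)^-1)^-1.
  have D1 : 0 < 1 + \sum_(i < k) (d i)^-1.
    by rewrite ltr_pwDl// sumr_ge0// => i _; rewrite invr_ge0 ltW; have [] := hd i.
  have D0 : 0 < D by rewrite invr_gt0.
  have Dd i : D <= d i.
    have [di0 _] := hd i; rewrite invf_ple ?posrE//.
    rewrite (bigD1 i)//= addrCA lerDl addr_ge0// sumr_ge0// => j _.
    by rewrite invr_ge0 ltW; have [] := hd j.
  exists D => // w vw; apply: hr (scube w).
  split=> // i j; rewrite !mxE -ball_normE /=; have [_ /(_ w)] := hd j.
  move=> /(_ _)/le_lt_trans; apply; last lra.
  by move=> c; apply: le_trans (vw c) _; rewrite ler_wpM2r ?sumr_ge0.
- by case: qf.
Qed.

(** Environments put the new variable first, families put the new vector last. *)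
Definition ccons n (c : 'I_n.+1 -> R) (j : nat) : R :=
  if insub j is Some i then c (lift ord0 (i : 'I_n)) else c ord0.

Lemma fsum_cons (X : completeNormedModType R) n c x (w : 'I_n -> ball_of X) :
  fsum c (env_cons x w) = lc n.+1 (ccons c) (ext n (fam val w) (val x)).
Proof.
rewrite /fsum big_ord_recl env_cons0 lc_ext addrC; congr (_ + _).
  by apply: eq_bigr => i _; rewrite env_cons_lift /ccons famE valK.
by rewrite /ccons insubF ?ltnn.
Qed.

Lemma l1_cons n (c : 'I_n.+1 -> R) : l1 n.+1 (ccons c) = \sum_i `|c i|.
Proof.
rewrite l1S big_ord_recl addrC; congr (_ + _); first by rewrite /ccons insubF ?ltnn.
by apply: eq_bigr => i _; rewrite /ccons valK.
Qed.

(** Homogeneity forces h x = k e(x / k) for k at least the norm of x; the value does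
    not depend on k because e commutes with scalars. *)
Lemma emb_linear (G X : completeNormedModType R) (e : ball_of G -> ball_of X) :
  is_embedding e ->
  exists2 h : {linear G -> X}, isometric h & forall x, val (e x) = h (val x).
Proof.
move=> he.
have nE k (x : G) : `|x| <= k -> 0 < k -> `|k^-1 *: x| <= 1.
  by move=> xk k0; rewrite normrZ normfV (gtr0_norm k0) ler_pdivrMl// mulr1.
pose B k x := insubd (ub_zero G) (k^-1 *: x) : ball_of G.
have BE k (x : G) : `|x| <= k -> 0 < k -> val (B k x) = k^-1 *: x.
  by move=> xk k0; rewrite val_insubd nE.
pose f x : X := (`|x| + 1) *: val (e (B (`|x| + 1) x)).
have fE k (x : G) : `|x| <= k -> 0 < k -> f x = k *: val (e (B k x)).
  suff main j l : `|x| <= j -> 0 < j -> j <= l ->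
      j *: val (e (B j x)) = l *: val (e (B l x)).
    move=> xk k0; have x1 : 0 < `|x| + 1 by rewrite ltr_wpDl.
    rewrite /f; have [kx|/ltW kx] := leP k (`|x| + 1); first by rewrite -(main k).
    by rewrite (main _ k)// lerDl.
  move=> xj j0 jl; have l0 := lt_le_trans j0 jl; have xl := le_trans xj jl.
  have jl1 : `|j / l| <= 1 by rewrite gtr0_norm ?divr_gt0// ler_pdivrMr// mul1r.
  have -> : B l x = s_scale (ball_of G) (scal (j / l)) (B j x).
    apply: val_inj; rewrite /= scalE// !BE// scalerA; congr (_ *: _).
    by rewrite mulrAC mulfV ?gt_eqF// mul1r.
  rewrite (emb_scale he) /= scalE// scalerA; congr (_ *: _).
  by rewrite mulrC mulfVK ?gt_eqF.
have fl : linear f.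
  move=> a x y; pose k := `|x| + `|y| + 1.
  have k0 : 0 < k by rewrite ltr_wpDl// addr_ge0.
  pose A := `|a| + 1.
  have A0 : 0 < A by rewrite ltr_wpDl.
  have xk : `|x| <= k by rewrite /k -addrA lerDl addr_ge0.
  have yk : `|y| <= k by rewrite /k addrAC lerDr addr_ge0.
  have yAk : `|y| <= A * k.
    by apply: le_trans yk _; rewrite ler_peMl ?(ltW k0)// lerDr.
  have axAk : `|a *: x| <= A * k.
    by rewrite normrZ ler_pM// /A lerDl.
  have Ak0 : 0 < A * k by rewrite mulr_gt0.
  have aA : `|a / A| <= 1.
    by rewrite normrM normfV (gtr0_norm A0) ler_pdivrMr// mul1r lerDl.
  have sk : `|a *: x + y| <= 2 * (A * k).
    by apply: le_trans (ler_normD _ _) _; rewrite mulr2n mulrDl mul1r lerD.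
  have sk0 : 0 < 2 * (A * k) by rewrite mulr_gt0.
  have e1 : B (2 * (A * k)) (a *: x + y) = s_mid (ball_of G) (B (A * k) (a *: x)) (B (A * k) y).
    apply: val_inj; rewrite /= !BE// -scalerDr scalerA; congr (_ *: _).
    by rewrite invfM.
  have e2 : B (A * k) (a *: x) = s_scale (ball_of G) (scal (a / A)) (B k x).
    apply: val_inj; rewrite /= !BE// scalE// !scalerA; congr (_ *: _).
    by rewrite invfM mulrC mulrA.
  rewrite (fE _ _ sk sk0) e1 (emb_mid he) e2 (emb_scale he) /= scalE//.
  rewrite (fE _ _ xk k0) (fE _ _ yAk Ak0) !scalerA.
  rewrite scalerDr !scalerA; congr (_ *: _ + _ *: _); field; rewrite ?gt_eqF//.
exists (HB.pack f (GRing.isLinear.Build _ _ _ _ f fl) : {linear G -> X}).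
  move=> x; rewrite /= /f normrZ; have x1 : 0 < `|x| + 1 by rewrite ltr_wpDl.
  have -> : `|val (e (B (`|x| + 1) x))| = `|val (B (`|x| + 1) x)|.
    exact: (emb_norm he).
  by rewrite BE ?lerDl// -normrZ scalerA mulfV ?gt_eqF// scale1r.
move=> x /=; have x1 : `|val x| <= 1 by exact: (valP x).
rewrite (fE 1)// scale1r; congr (val (e _)).
by apply: val_inj; rewrite BE// invr1 scale1r.
Qed.

Section TarskiVaught.
Variables (T : theory R) (G X : completeNormedModType R).
Variables (e : ball_of G -> ball_of X) (h : {linear G -> X}).
Hypotheses (qe : eliminates_quantifiers T) (hX : models (ball_of X) T)
  (hG : gurarij G) (he : is_embedding e) (hh : isometric h)
  (eE : forall x, val (e x) = h (val x)).

(** Up to d / 3 the formula is quantifier-free, hence determined by norms of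
    combinations, and [gurarij_realize] copies those of x over v into G. *)
Lemma realize_formula n (psi : formula R n.+1) (v : 'I_n -> ball_of G) (x : ball_of X) d :
  0 < d -> exists y : ball_of G,
    `|eval psi (env_cons x (e \o v)) - eval psi (env_cons (e y) (e \o v))| <= d.
Proof.
move=> d0; have d3 : 0 < d / 3 by rewrite divr_gt0.
have [th qf hth] := qe psi d3.
have [r r0 hr] := qf_continuity (env_cons x (e \o v)) qf d3.
pose u := ext n (h \o fam val v) (val x).
have r2 : 0 < r / 2 by rewrite divr_gt0.
have [|y' y'v hy'] := gurarij_realize (v := fam val v) (u := u) hG hh r2 (leqnSn n).
  by move=> i hi; rewrite /u /ext hi.
have x1 : `|val x| <= 1 by exact: (valP x).
have y'1 : `|y' n| <= 1 + r / 2.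
  have := hy' (delta R n); rewrite !lc_delta// l1_delta// /u /ext ltnn ler_norml.
  by move=> /andP[? ?]; lra.
have k0 : 0 < 1 + r / 2 by rewrite ltr_wpDl.
(* the copy of x may leave the ball by r / 2, and is scaled back *)
have y1 : `|(1 + r / 2)^-1 *: y' n| <= 1.
  by rewrite normrZ normfV (gtr0_norm k0) ler_pdivrMl// mulr1.
pose y : ball_of G := exist (fun z : G => is_true (`|z| <= 1)) _ y1.
exists y.
have yy' : `|y' n - val y| <= r / 2.
  have -> : y' n - val y = (r / 2 / (1 + r / 2)) *: y' n.
    rewrite -{1}[y' n]scale1r -scalerBl; congr (_ *: _).
    by field; rewrite -?mulr2n; apply/eqP; lra.
  rewrite normrZ [`|r / 2 / _|]gtr0_norm ?divr_gt0// mulrAC ler_pdivrMr//.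
  by rewrite ler_pM2l.
have clo : fclose r (env_cons x (e \o v)) (env_cons (e y) (e \o v)).
  move=> c; rewrite !fsum_cons -l1_cons.
  have famv i : (i < n)%N -> fam val (e \o v) i = h (fam val v i).
    by move=> hi; rewrite -[i]/(val (Ordinal hi)) !famE /= eE.
  have -> : lc n.+1 (ccons c) (ext n (fam val (e \o v)) (val x)) = lc n.+1 (ccons c) u.
    by apply: eq_lc => // i _; rewrite /u /ext; case: ifP => // hi; rewrite famv.
  have -> : lc n.+1 (ccons c) (ext n (fam val (e \o v)) (val (e y))) =
      h (lc n.+1 (ccons c) (ext n (fam val v) (val y))).
    rewrite linear_lc; apply: eq_lc => // i _.
    rewrite -[RHS]/(h (ext _ _ _ i)) /ext.
    by case: ifP => hi; [exact: famv|exact: eE].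
  rewrite hh; have -> : r = r / 2 + r / 2 by rewrite -splitr.
  apply: (eps_close_trans hy'); apply: eps_close_perturb => i.
  rewrite ltnS leq_eqVlt /ext => /orP[/eqP ->|hi]; first by rewrite ltnn.
  by rewrite hi y'v// subrr normr0 ltW.
have := hr _ clo.
have := hth _ hX (env_cons x (e \o v)); have := hth _ hX (env_cons (e y) (e \o v)).
have := ler_distD (eval th (env_cons x (e \o v))) (eval psi (env_cons x (e \o v)))
  (eval psi (env_cons (e y) (e \o v))).
have := ler_distD (eval th (env_cons (e y) (e \o v))) (eval th (env_cons x (e \o v)))
  (eval psi (env_cons (e y) (e \o v))).
rewrite [`|eval th (env_cons (e y) _) - eval psi _|]distrC; lra.
Qed.

(** The Tarski-Vaught test: by [realize_formula], quantifiers over the ball of X and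
    over the ball of G give the same values. *)
Lemma tarski_vaught n (phi : formula R n) (v : 'I_n -> ball_of G) :
  eval phi (e \o v) = eval phi v.
Proof.
elim: phi v => {n} [n t|n t s|n k u args IH|n psi IH|n psi IH] v.
- exact: (qf_eval_emb he (phi := FNorm t)).
- exact: (qf_eval_emb he (phi := FDist t s)).
- by rewrite /=; congr (u _); apply/rowP => i; rewrite !mxE IH.
- apply/eqP; rewrite eq_le; apply/andP; split.
    apply: sup_eval_le => x; apply/ler_addgt0Pl => d d0.
    have [y] := realize_formula psi v x d0.
    rewrite -env_cons_map IH; have := le_sup_eval psi v y.
    rewrite ler_norml => ? /andP[? ?]; lra.
  apply: sup_eval_le => y; rewrite -IH env_cons_map; exact: le_sup_eval.
- apply/eqP; rewrite eq_le; apply/andP; split.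
    apply: le_inf_eval => y; rewrite -IH env_cons_map; exact: inf_eval_le.
  apply: le_inf_eval => x; apply/ler_addgt0Pl => d d0.
  have [y] := realize_formula psi v x d0.
  rewrite -env_cons_map IH; have := inf_eval_le psi v y.
  rewrite ler_norml => ? /andP[? ?]; lra.
Qed.

End TarskiVaught.

(** The ball of G embeds in a model, which is the ball of some X, and the embedding
    is elementary. *)
Lemma gurarij_model (T : theory R) (G : completeNormedModType R) :
  companion (banach_theory R) T -> eliminates_quantifiers T ->
  gurarij G -> models (ball_of G) T.
Proof.
move=> Tc qe hG; have [N hN [g hg]] := Tc.1 _ (@ball_of_models R G).
have [X [f hf fb]] := model_is_ball Tc qe hN.
have hX : models (ball_of X) T by apply/(iso_models T hf fb).
have hgf := embedding_comp hg hf.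
have [h hh hE] := emb_linear hgf.
move=> phi /hX; rewrite /sentence_eval.
rewrite -(tarski_vaught qe hX hG hgf hh hE phi) => <-.
by congr (eval _ _); exact: env0_unique.
Qed.

End Converse.

Theorem theorem2p3 (R : realType) :
  (forall Tstar : theory R,
     model_completion (banach_theory R) Tstar ->
     forall M : ball_structure R,
       models M Tstar <->
       exists2 G : completeNormedModType R,
         gurarij G & isomorphic M (ball_of G)) /\
  (exists G : completeNormedModType R,
     [/\ gurarij G, separable G
       & forall H : completeNormedModType R,
           gurarij H -> separable H -> isometrically_isomorphic G H]).
Proof.
split.
  move=> T [Tc qe] M; split; first exact: model_gurarij.
  move=> [G hG [h he hb]]; apply/(iso_models T he hb).
  exact: gurarij_model.
have [G hG sG] := separable_gurarij_exists R.
exists G; split=> // H hH sH.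
have [g dg] := separable_enum sG; have [k dk] := separable_enum sH.
exact: gurarij_unique hG hH dg dk.
Qed.
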